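(* Let $L$ be any local field, and for $j,N\in\mathbb{N}$ let $[j]_N\in\{0,\ldots,N-1\}$ denote the mod $N$ reduction of $j$. Then, for all $n\ge 1$, $$Y_L(n,2)\ \geq\ \max\left\{Y_L(1,1)^{n-1}Y_L(1,2),\ n+1\right\}.$$ More generally, when $n\geq k-1\geq 1$, $$Y_L(n,k)\ \geq\ \max\left\{Y_L(1,1)^{n-k+1}Y_L(1,2)^{k-1},\ Y_L\!\left(\left\lfloor \tfrac{n}{k-1}\right\rfloor,2\right)^{k-1-[n]_{k-1}}Y_L\!\left(\left\lfloor \tfrac{n}{k-1}\right\rfloor+1,2\right)^{[n]_{k-1}}\right\},$$ and, when $1\leq n\leq k-1$, $$Y_L(n,k)\ \geq\ Y_L\!\left(1,\left\lfloor \tfrac{n+k-1}{n}\right\rfloor\right)^{n-[k-1]_{n}}Y_L\!\left(1,\left\lfloor \tfrac{n+k-1}{n}\right\rfloor+1\right)^{[k-1]_{n}}.$$ More explicitly, the following lower bounds hold. (i) $L=\mathbb{R}$: $Y_{\mathbb{R}}(n,k)\geq\left\lfloor \frac{n+k-1}{k-1}\right\rfloor^{k-1-[n]_{k-1}}\left\lfloor \frac{n+2k-2}{k-1}\right\rfloor^{[n]_{k-1}}$ if $n\geq k-1\geq 1$, and $Y_{\mathbb{R}}(n,k)\geq\left\lfloor \frac{n+k-1}{n}\right\rfloor^{n-[k-1]_n}\left\lfloor \frac{2n+k-1}{n}\right\rfloor^{[k-1]_n}$ if $1\leq n\leq k-1$. (ii) $L=\mathbb{Q}_2$: $Y_{\mathbb{Q}_2}(n,k)\geq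 2^n3^{k-1}$ if $n\geq k-1\geq 1$, and $Y_{\mathbb{Q}_2}(n,k)\geq 2^n\left\lfloor \frac{n+k-1}{n}\right\rfloor^{n-[k-1]_n}\left\lfloor \frac{2n+k-1}{n}\right\rfloor^{[k-1]_n}$ if $1\leq n\leq k-1$. (iii) $L=\mathbb{Q}_p$ with $p\geq 3$ prime: $Y_{\mathbb{Q}_p}(n,k)\geq\left\lfloor \frac{n+k-1}{k-1}\right\rfloor^{k-1-[n]_{k-1}}\left\lfloor \frac{n+2k-2}{k-1}\right\rfloor^{[n]_{k-1}}$ if $n\geq k-1\geq 1$, and $Y_{\mathbb{Q}_p}(n,k)\geq\left(2\left\lfloor \frac{n+k-1}{n}\right\rfloor-1\right)^{n-[k-1]_n}\left(2\left\lfloor \frac{n+k-1}{n}\right\rfloor+1\right)^{[k-1]_n}$ if $1\leq n\leq k-1$. (iv) $L=\mathbb{F}_q((t))$ with $q$ a prime power: $Y_{\mathbb{F}_q((t))}(n,k)\geq\max\left\{q+1,\left\lfloor \frac{n+k-1}{k-1}\right\rfloor\right\}^{k-1-[n]_{k-1}}\max\left\{q+1,\left\lfloor \frac{n+2k-2}{k-1}\right\rfloor\right\}^{[n]_{k-1}}$ if $n\geq k-1\geq 1$, and $Y_{\mathbb{F}_q((t))}(n,k)\geq\left(\frac{q^{\left\lfloor \frac{n+k-1}{n}\right\rfloor}-1}{q-1}\right)^{n-[k-1]_n}\left(\frac{q^{\left\lfloor \frac{2n+k-1}{n}\right\rfloor}-1}{q-1}\right)^{[k-1]_n}$ if $1\leq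 n\leq k-1$.
   Context: A local field $L$ means: $\mathbb{C}$, $\mathbb{R}$, any finite algebraic extension of $\mathbb{Q}_p$ ($p$ prime), or $\mathbb{F}_q((t))$ ($q$ a prime power). An $(n+k)$-nomial $n\times n$ system over $L$ is a tuple $F=(f_1,\ldots,f_n)$ of Laurent polynomials $f_i\in L[x_1^{\pm1},\ldots,x_n^{\pm1}]$ such that the total number of distinct exponent vectors in the monomial term expansions of $f_1,\ldots,f_n$ is $n+k$. A root of $F$ is non-degenerate if the Jacobian matrix of $F$ at it has rank $n$. Generalized phase: for $y\in L^*$ with $L\in\{\mathbb{R},\mathbb{C}\}$, $\phi(y):=y/|y|$ with $|\cdot|$ the usual absolute value. For $L$ non-Archimedean, let $\mathfrak{M}$ be the maximal ideal of the ring of integers of $L$, fix a uniformizer $\rho$ (a generator of $\mathfrak{M}$), let $\mathrm{ord}$ be the corresponding valuation (so $\mathrm{ord}\,\rho=1$), and set $\phi(y):=\frac{y}{\rho^{\mathrm{ord}\, y}} \bmod \mathfrak{M}$. $Y_L(n,k)$ is the supremum, over all $(n+k)$-nomial $n\times n$ systems $F$ over $L$, of the number of non-degenerate roots of $F$ in $L^n$ all of whose coordinates have generalized phase $1$ (possibly $+\infty$). *)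

(* Defs.v *)
From HB Require Import structures.
From mathcomp Require Import all_boot all_order all_algebra all_field.
From mathcomp Require Import fraction finmap complex.
From mathcomp Require Import all_classical all_reals all_analysis.

Set Implicit Arguments.
Unset Strict Implicit.
Unset Printing Implicit Defensive.

Import Order.TTheory GRing.Theory Num.Theory.

Local Open Scope classical_set_scope.
Local Open Scope ring_scope.

Section ClassicalInverse.
Variable A : comNzRingType.

Definition cunit : {pred A} := fun x => `[< exists y : A, y * x = 1 >].

Definition cinv (x : A) : A := xget x [set y | y * x = 1].

Lemma cmulVr : {in cunit, left_inverse 1 cinv *%R}.
Proof.
move=> x /asboolP [y xy]; rewrite /cinv.
by case: xgetP => [z -> //|/(_ y)].
Qed.

Lemma cunitPl (x y : A) : y * x = 1 -> x \in cunit.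
Proof. by move=> xy; apply/asboolP; exists y. Qed.

Lemma cinv_out : {in [predC cunit], cinv =1 id}.
Proof.
move=> x xNU; rewrite /cinv; case: xgetP => [z _ zx|//].
by move: xNU; rewrite inE /= (cunitPl zx).
Qed.
End ClassicalInverse.

(* Z_p as the inverse limit of the rings Z/p^n: [pdig x n] is the reduction of
   x in Z/p^n, represented in [0, p^n). *)
Record padic_int (p : nat) (p_pr : prime p) := PadicInt {
  pdig :> nat -> nat;
  pdigP : forall n, pdig n = (pdig n.+1 %% p ^ n)%N }.

Section PadicInt.
Variables (p : nat) (p_pr : prime p).
Local Notation Zp := (padic_int p_pr).
Implicit Types x y z : Zp.

Lemma padic_int_eq x y : pdig x =1 pdig y -> x = y.
Proof.
case: x y => [x Px] [y Py] /= /funext exy; move: Px Py; rewrite exy => Px Py.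
by congr PadicInt; apply: Prop_irrelevance.
Qed.

Lemma modpS n m : ((m %% p ^ n.+1) %% p ^ n = m %% p ^ n)%N.
Proof. by rewrite modn_dvdm // dvdn_exp2l. Qed.

Lemma pdig_mod x n : (x n %% p ^ n = x n)%N.
Proof. by rewrite {1}pdigP modn_mod -pdigP. Qed.

Lemma pdig_le x n m : (n <= m)%N -> (x m %% p ^ n = x n)%N.
Proof.
move=> /subnK <-; elim: (m - n)%N => [|d IH]; first by rewrite pdig_mod.
by rewrite -{}IH addSn [in RHS]pdigP modn_dvdm // dvdn_exp2l // leq_addl.
Qed.

Definition mk_padic (s : nat -> nat)
    (h : forall n, s n.+1 = s n %[mod p ^ n]) : Zp.
Proof.
exists (fun n => s n %% p ^ n)%N => n.
by rewrite modpS h.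
Defined.

Lemma pmodS x n : x n.+1 = x n %[mod p ^ n].
Proof. by rewrite -pdigP pdig_mod. Qed.

Fact padd_sub x y n : (x n.+1 + y n.+1 = x n + y n %[mod p ^ n])%N.
Proof. by rewrite -modnDm !pmodS modnDm. Qed.
Fact pmul_sub x y n : (x n.+1 * y n.+1 = x n * y n %[mod p ^ n])%N.
Proof. by rewrite -modnMm !pmodS modnMm. Qed.
Fact popp_sub x n : (p ^ n.+1 - x n.+1 = p ^ n - x n %[mod p ^ n])%N.
Proof.
have lex m : (x m <= p ^ m)%N.
  by rewrite -pdig_mod ltnW // ltn_mod expn_gt0 prime_gt0.
apply/eqP; rewrite -(eqn_modDr (x n)) subnK // modnn -modnDmr -[in (x n %% _)%N](pmodS x n).
rewrite modnDmr subnK //.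
by rewrite -/(p ^ n %| p ^ n.+1)%N dvdn_exp2l.
Qed.

Definition padd x y : Zp := mk_padic (padd_sub x y).
Definition pmul x y : Zp := mk_padic (pmul_sub x y).
Definition popp x : Zp := mk_padic (popp_sub x).
Definition pzero : Zp := @mk_padic (fun=> 0%N) (fun=> erefl).
Definition pone : Zp := @mk_padic (fun=> 1%N) (fun=> erefl).

HB.instance Definition _ := gen_eqMixin Zp.
HB.instance Definition _ := gen_choiceMixin Zp.

Fact paddA : associative padd.
Proof.
by move=> x y z; apply: padic_int_eq => n /=; rewrite modnDml modnDmr addnA.
Qed.
Fact paddC : commutative padd.
Proof. by move=> x y; apply: padic_int_eq => n /=; rewrite addnC. Qed.
Fact padd0 : left_id pzero padd.
Proof. by move=> x; apply: padic_int_eq => n /=; rewrite mod0n pdig_mod. Qed.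
Fact paddN : left_inverse pzero popp padd.
Proof.
move=> x; apply: padic_int_eq => n /=.
rewrite modnDml mod0n subnK ?modnn //.
by rewrite -pdig_mod ltnW // ltn_mod expn_gt0 prime_gt0.
Qed.
HB.instance Definition _ := GRing.isZmodule.Build Zp paddA paddC padd0 paddN.

Fact pmulA : associative pmul.
Proof.
by move=> x y z; apply: padic_int_eq => n /=; rewrite modnMml modnMmr mulnA.
Qed.
Fact pmulC : commutative pmul.
Proof. by move=> x y; apply: padic_int_eq => n /=; rewrite mulnC. Qed.
Fact pmul1 : left_id pone pmul.
Proof.
by move=> x; apply: padic_int_eq => n /=; rewrite modnMml mul1n pdig_mod.
Qed.
Fact pmulD : left_distributive pmul padd.
Proof.
by move=> x y z; apply: padic_int_eq => n /=; rewrite modnMml modnDm mulnDl.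
Qed.
Fact pone_neq0 : pone != pzero.
Proof.
apply/eqP => /(congr1 (fun x : Zp => x 1%N)) /=.
by rewrite expn1 mod0n modn_small // prime_gt1.
Qed.
HB.instance Definition _ :=
  GRing.Zmodule_isComNzRing.Build Zp pmulA pmulC pmul1 pmulD pone_neq0.

HB.instance Definition _ := GRing.ComNzRing_hasMulInverse.Build Zp
  (@cmulVr Zp) (@cunitPl Zp) (@cinv_out Zp).

Lemma padic_neq0 x : x != 0 -> exists n, forall m, (n <= m)%N ->
  (0 < x m)%N && (logn p (x m) < n)%N.
Proof.
move=> x0; have [n xn] : exists n, x n <> 0%N.
  apply: contrapT => /forallNP x_0; case/eqP: x0; apply: padic_int_eq => n /=.
  by rewrite mod0n; apply: contrapT; exact: x_0.
exists n => m le_nm; have xmn := pdig_le x le_nm.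
have xm0 : (0 < x m)%N.
  by rewrite lt0n; apply/eqP => xm; apply: xn; rewrite -xmn xm mod0n.
rewrite xm0 ltnNge; apply/negP => le_n; apply: xn; rewrite -xmn; apply/eqP.
by rewrite -/(p ^ n %| x m)%N pfactor_dvdn.
Qed.

Fact padic_idomain : GRing.integral_domain_axiom Zp.
Proof.
move=> x y xy0; apply: contraT; rewrite negb_or.
move=> /andP [/padic_neq0 [n xn] /padic_neq0 [m ym]].
have /andP [x_gt0 lx] := xn (n + m)%N (leq_addr _ _).
have /andP [y_gt0 ly] := ym (n + m)%N (leq_addl _ _).
move: xy0 => /(congr1 (fun z : Zp => z (n + m)%N)) /= /eqP.
rewrite mod0n -/(p ^ (n + m) %| x (n + m) * y (n + m))%N.
rewrite pfactor_dvdn ?muln_gt0 ?x_gt0 // lognM // leqNgt.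
by rewrite -addSn leq_add // ltnW.
Qed.
HB.instance Definition _ := GRing.ComUnitRing_isIntegral.Build Zp padic_idomain.
End PadicInt.

Definition padic_num (p : nat) (p_pr : prime p) := {fraction (padic_int p_pr)}.
HB.instance Definition _ p (p_pr : prime p) :=
  GRing.Field.on (padic_num p_pr).

Record power_series (F : fieldType) := PowerSeries { pscoef :> nat -> F }.

Section PowerSeries.
Variable F : fieldType.
Local Notation PS := (power_series F).
Implicit Types s t u : PS.

Lemma power_series_eq s t : pscoef s =1 pscoef t -> s = t.
Proof. by case: s t => [s] [t] /= /funext ->. Qed.

HB.instance Definition _ := gen_eqMixin PS.
HB.instance Definition _ := gen_choiceMixin PS.

Definition psadd s t : PS := PowerSeries (fun n => s n + t n).
Definition psopp s : PS := PowerSeries (fun n => - s n).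
Definition pszero : PS := PowerSeries (fun=> 0).
Definition psone : PS := PowerSeries (fun n => (n == 0%N)%:R).
Definition psmul s t : PS :=
  PowerSeries (fun n => \sum_(i < n.+1) s i * t (n - i)%N).

Fact psaddA : associative psadd.
Proof. by move=> s t u; apply: power_series_eq => n /=; rewrite addrA. Qed.
Fact psaddC : commutative psadd.
Proof. by move=> s t; apply: power_series_eq => n /=; rewrite addrC. Qed.
Fact psadd0 : left_id pszero psadd.
Proof. by move=> s; apply: power_series_eq => n /=; rewrite add0r. Qed.
Fact psaddN : left_inverse pszero psopp psadd.
Proof. by move=> s; apply: power_series_eq => n /=; rewrite addNr. Qed.
HB.instance Definition _ := GRing.isZmodule.Build PS psaddA psaddC psadd0 psaddN.

Definition pstrunc m s : {poly F} := \poly_(i < m) s i.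

Lemma psmul_trunc m s t n : (n < m)%N ->
  psmul s t n = (pstrunc m s * pstrunc m t)`_n.
Proof.
move=> lt_nm; rewrite coefM; apply: eq_bigr => i _; rewrite !coef_poly.
have le_in : (i <= n)%N by rewrite -ltnS.
by rewrite (leq_ltn_trans le_in lt_nm) (leq_ltn_trans (leq_subr i n) lt_nm).
Qed.

Fact psmulC : commutative psmul.
Proof.
move=> s t; apply: power_series_eq => n.
by rewrite !(@psmul_trunc n.+1) // mulrC.
Qed.
Fact psmulA : associative psmul.
Proof.
move=> s t u; apply: power_series_eq => n.
transitivity ((pstrunc n.+1 s * (pstrunc n.+1 t * pstrunc n.+1 u))`_n).
  rewrite coefM; apply: eq_bigr => i _.
  by rewrite -psmul_trunc ?ltnS ?leq_subr // coef_poly ltn_ord.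
rewrite mulrA coefM; apply: eq_bigr => i _.
by rewrite -psmul_trunc ?ltn_ord // coef_poly ltnS leq_subr.
Qed.
Fact psmul1 : left_id psone psmul.
Proof.
move=> s; apply: power_series_eq => n /=.
rewrite big_ord_recl /= mul1r subn0 big1 ?addr0 // => i _.
by rewrite mul0r.
Qed.
Fact psmulD : left_distributive psmul psadd.
Proof.
move=> s t u; apply: power_series_eq => n /=.
by rewrite -big_split /=; apply: eq_bigr => i _; rewrite mulrDl.
Qed.
Fact psone_neq0 : psone != pszero.
Proof.
apply/eqP => /(congr1 (fun s : PS => s 0%N)) /= /eqP.
by rewrite oner_eq0.
Qed.
HB.instance Definition _ :=
  GRing.Zmodule_isComNzRing.Build PS psmulA psmulC psmul1 psmulD psone_neq0.

HB.instance Definition _ := GRing.ComNzRing_hasMulInverse.Build PS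
  (@cmulVr PS) (@cunitPl PS) (@cinv_out PS).

Lemma power_series_neq0 s : s != 0 -> exists n, s n != 0 /\
  forall m, (m < n)%N -> s m = 0.
Proof.
move=> s0; have ex : exists n, s n != 0.
  apply: contrapT => /forallNP s_0; case/eqP: s0; apply: power_series_eq => n.
  by apply/eqP/negP => /negP; exact: s_0.
case: (ex_minnP ex) => n sn min_n; exists n; split=> // m lt_mn.
by apply/eqP; apply: contraTT lt_mn => /min_n; rewrite -leqNgt.
Qed.

Fact power_series_idomain : GRing.integral_domain_axiom PS.
Proof.
move=> s t st0; apply: contraT; rewrite negb_or => /andP [].
move=> /power_series_neq0 [n [sn s_lt]] /power_series_neq0 [m [tm t_lt]].
move: st0 => /(congr1 (fun z : PS => z (n + m)%N)) /=.
have lt_n : (n < (n + m).+1)%N by rewrite ltnS leq_addr.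
rewrite (bigD1 (Ordinal lt_n)) //= addKn big1 ?addr0.
  by move/eqP; rewrite mulf_eq0 (negbTE sn) (negbTE tm).
move=> i; rewrite -val_eqE /= neq_ltn => /orP [/s_lt -> | lt_ni].
  by rewrite mul0r.
rewrite t_lt ?mulr0 // ltn_subLR; first by rewrite ltn_add2r.
by rewrite -ltnS.
Qed.
HB.instance Definition _ :=
  GRing.ComUnitRing_isIntegral.Build PS power_series_idomain.
End PowerSeries.

(* F((t)) as the fraction field of F[[t]]. *)
Definition laurent_series (F : fieldType) := {fraction (power_series F)}.
HB.instance Definition _ (F : fieldType) := GRing.Field.on (laurent_series F).

(* Valuation and phase attached to a field L with (discrete valuation) ring of
   integers O and uniformizer rho. *)
Section NonArchimedean.
Variables (L : fieldType) (O : set L).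

Definition int_unit : set L := [set x | [/\ O x, x != 0 & O x^-1]].

Definition max_ideal : set L := O `\` int_unit.

Definition uniformizer (rho : L) : Prop :=
  max_ideal = [set rho * a | a in O].

Variable rho : L.

Definition ord (y : L) : int := xget 0 [set m : int | int_unit (y / rho ^ m)].

Definition nonarch_phase1 : set L :=
  [set y | y != 0 /\ max_ideal (y / rho ^ ord y - 1)].
End NonArchimedean.

Definition arch_phase1 (K : numFieldType) : set K :=
  [set y | y != 0 /\ y / `|y| = 1].

(* The ring of integers of a finite extension of Q_p is the integral closure
   of Z_p. *)
Definition padic_integers (p : nat) (p_pr : prime p)
    (L : fieldExtType (padic_num p_pr)) : set L :=
  [set x | integralOver (fun a : padic_int p_pr => (tofrac a)%:A : L) x].

Definition laurent_integers (F : fieldType) : set (laurent_series F) :=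
  range (@tofrac (power_series F)).

(* Local fields; the non-Archimedean ones carry the uniformizer used to define
   the generalized phase. *)
Inductive local_field (R : realType) : Type :=
| RealField
| ComplexField
| PadicField (p : nat) (p_pr : prime p) (L : fieldExtType (padic_num p_pr))
    (rho : L) of uniformizer (@padic_integers p p_pr L) rho
| LaurentField (F : finFieldType) (rho : laurent_series F)
    of uniformizer (@laurent_integers F) rho.
Arguments RealField R : clear implicits.
Arguments ComplexField R : clear implicits.
Arguments PadicField R {p p_pr} L {rho} _.
Arguments LaurentField R F {rho} _.

Definition carrier (R : realType) (L : local_field R) : fieldType :=
  match L with
  | RealField => R
  | ComplexField => R[i]
  | PadicField _ _ L _ _ => L
  | LaurentField F _ _ => laurent_series F
  end.

Definition phase1 (R : realType) (L : local_field R) : set (carrier L) :=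
  match L with
  | RealField => @arch_phase1 R
  | ComplexField => @arch_phase1 R[i]
  | PadicField p p_pr L rho _ => nonarch_phase1 (@padic_integers p p_pr L) rho
  | LaurentField F rho _ => nonarch_phase1 (@laurent_integers F) rho
  end.

(* Laurent polynomials as finitely supported maps from exponent vectors to
   coefficients. *)
Definition laurent_poly (K : fieldType) (n : nat) :=
  {fsfun 'rV[int]_n -> K with 0}.

Section LaurentSystems.
Variables (K : fieldType) (n : nat).
Implicit Types (f : laurent_poly K n) (F : 'I_n -> laurent_poly K n).
Implicit Types (x : 'rV[K]_n).

Definition lp_eval f x : K :=
  \sum_(a <- finsupp f) f a * \prod_(j < n) x 0 j ^ a 0 j.

Definition lp_deriv (j : 'I_n) f : laurent_poly K n :=
  [fsfun b in [fset a - delta_mx 0 j | a in finsupp f]%fset =>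
     f (b + delta_mx 0 j) *~ (b 0 j + 1) | 0].

Definition lp_jacobian F x : 'M[K]_n :=
  \matrix_(i, j) lp_eval (lp_deriv j (F i)) x.

Definition lp_support F : {fset 'rV[int]_n} :=
  \big[fsetU/fset0]_(i < n) finsupp (F i).

Definition nomial_system (k : nat) F : Prop := #|` lp_support F| = (n + k)%N.

Definition nondeg_root F x : Prop :=
  (forall i, lp_eval (F i) x = 0) /\ \rank (lp_jacobian F x) = n.
End LaurentSystems.

Definition Y (R : realType) (L : local_field R) (n k : nat) : \bar R :=
  ereal_sup [set counting [set x : 'rV[carrier L]_n |
                             nondeg_root F x /\ forall j, phase1 (x 0 j)]
            | F in @nomial_system (carrier L) n k].

(* Main.v *)
(** Systems in disjoint sets of variables can be juxtaposed; after dividing each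
    block by one of its monomials they share the constant monomial, whence
    [Y L n1 (k1 + 1) * Y L n2 (k2 + 1) <= Y L (n1 + n2) (k1 + k2 + 1)].  All the
    general inequalities follow from this, except [n + 1 <= Y L n 2], and the
    explicit ones then only need univariate lower bounds.

    For [n + 1 <= Y L n 2], consider [x_i = 1 + e ^ (2 i + 1) X ^ b] with
    [b = (2, -2, 2, -2, ...)].  Putting [v ^ 2 = X ^ b], its roots correspond to
    those of a polynomial in [v] of degree [n + 1] whose Newton polygon has the
    slopes [0, ..., n]: near [v = e ^ (- j)] there is exactly one root, obtained
    by the intermediate value theorem over the reals and by Hensel's lemma in
    Z_p or F[[t]].  A finite extension of Q_p needs no completeness argument:
    some power of [p] has phase 1, so the roots can be taken in Q_p.

    Over a p-adic field, [2 k - 1] roots of a [(k + 1)]-nomial are produced by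
    induction: [x ^ D f(x) - T ^ D f(T)], with [T] tiny and [D] p-adically close
    to [- T f'(T) / f(T)], keeps the roots of [f] and gains two roots near [T].
    Over F_q((t)), the zero set of an additive polynomial with [k + 1] terms is
    an F_q-space of dimension [k], and each of its lines contains exactly one
    element of phase 1. *)

Require Import Defs.
From HB Require Import structures.
From mathcomp Require Import all_boot all_order all_algebra all_field.
From mathcomp Require Import fraction finmap complex.
From mathcomp Require Import all_classical all_reals all_analysis.
From mathcomp Require Import ring zify.

Set Implicit Arguments.
Unset Strict Implicit.
Unset Printing Implicit Defensive.

Import Order.TTheory GRing.Theory Num.Theory.

Local Open Scope ring_scope.

(** * Laurent systems *)

(** Non-degeneracy in the chain system costs nothing beyond counting. The Jacobian matrix there is
    the identity minus a rank-one matrix, invertible as soon as the corresponding root of the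
    polynomial in [v] is simple; a polynomial of degree at most [n + 1] with [n + 1] distinct roots
    has only simple ones. The uniformizer is arbitrary, so even [p] or [t] may fail to have phase 1.
    In the p-adic and chain constructions every coordinate is therefore a power of one fixed element
    of phase 1 times a factor close to 1, and only the stability of phase 1 under products and
    inverses is used. Degenerate parameters (a vanishing coefficient, a coincidence of roots) are
    avoided by taking the parameter among the large powers of that element and outside the roots of
    a nonzero polynomial. Over Q_2 there is one more device: [-1] has phase 1 and every [1 + 8 z] is
    a square, so replacing [x] by [x ^ 2] doubles the number of roots without changing the number of
    terms. This is the origin of the factor [2 ^ n]. *)

Section LaurentCalculus.
Variables (K : fieldType) (n : nat).
Implicit Types (f : laurent_poly K n) (x : 'rV[K]_n) (a b : 'rV[int]_n).

Definition mon x a : K := \prod_(j < n) x 0 j ^ a 0 j.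

Lemma monD x a b : (forall j, x 0 j != 0) -> mon x (a + b) = mon x a * mon x b.
Proof.
move=> x0; rewrite /mon -big_split; apply: eq_bigr => j _.
by rewrite mxE expfzDr.
Qed.

Lemma mon0 x : mon x 0 = 1.
Proof. by rewrite /mon big1 // => j _; rewrite mxE expr0z. Qed.

Lemma mon_delta x j : mon x (delta_mx 0 j) = x 0 j.
Proof.
rewrite /mon (bigD1 j) //= !mxE !eqxx expr1z big1 ?mulr1 // => i /negbTE ij.
by rewrite mxE ij andbF expr0z.
Qed.

Lemma monB x a b : (forall j, x 0 j != 0) -> mon x (a - b) = mon x a / mon x b.
Proof.
move=> x0; apply: (canRL (mulfK _)); last by rewrite -monD // subrK.
by apply/prodf_neq0 => j _; rewrite expfz_neq0.
Qed.

Lemma mon_neq0 x a : (forall j, x 0 j != 0) -> mon x a != 0.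
Proof. by move=> x0; apply/prodf_neq0 => j _; rewrite expfz_neq0. Qed.

Lemma lp_evalE f (S : {fset 'rV[int]_n}) x : (finsupp f `<=` S)%fset ->
  lp_eval f x = \sum_(a <- S) f a * mon x a.
Proof.
move=> sub; rewrite /lp_eval; apply: big_fset_incl => // a _.
by rewrite memNfinsupp => /eqP ->; rewrite mul0r.
Qed.

(** Multiplication by [x_j] turns the partial derivative into the Euler operator, which is diagonal
    on monomials: exponents are no longer shifted, and all equations of a system can be summed over
    one common [S]. *)
Lemma lp_derivE j f (S : {fset 'rV[int]_n}) x : (forall j, x 0 j != 0) ->
  (finsupp f `<=` S)%fset ->
  lp_eval (lp_deriv j f) x = (\sum_(a <- S) f a * (a 0 j)%:~R * mon x a) / x 0 j.
Proof.
move=> x0 sub.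
rewrite (@lp_evalE _ [fset a - delta_mx 0 j | a in S]%fset); last first.
  apply: fsubset_trans (finsupp_sub _ _ _) _; apply/fsubsetP => b.
  case/imfsetP => a aS ->; apply/imfsetP; exists a => //.
  exact: (fsubsetP sub).
rewrite big_imfset /=; last by move=> a b _ _ /addIr.
rewrite mulr_suml; apply: eq_bigr => a _.
rewrite monB // mon_delta mulrA; congr (_ * _ / _).
rewrite fsfunE subrK !mxE !eqxx /= subrK mulrzr.
case: ifPn => // /negP; case: (f a =P 0) => [->|/eqP fa0 []]; first by rewrite mul0rz.
by apply/imfsetP; exists a => //=; rewrite mem_finsupp.
Qed.

Lemma unit_nondeg_root (F : 'I_n -> laurent_poly K n) x :
  (forall i, lp_eval (F i) x = 0) -> lp_jacobian F x \in unitmx ->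
  nondeg_root F x.
Proof. by move=> Fx /mxrank_unit. Qed.

Lemma nondeg_root_unit (F : 'I_n -> laurent_poly K n) x :
  nondeg_root F x -> lp_jacobian F x \in unitmx.
Proof. by case=> _ rk; rewrite -row_free_unit -row_leq_rank rk. Qed.

Lemma lp_supportP (F : 'I_n -> laurent_poly K n) a :
  reflect (exists i, F i a != 0) (a \in lp_support F).
Proof.
rewrite /lp_support; apply: (iffP idP) => [|[i0]].
  elim/big_ind: _ => [|A B IHA IHB|i _]; first by rewrite in_fset0.
    by rewrite in_fsetU => /orP [/IHA | /IHB].
  by rewrite mem_finsupp; exists i.
by rewrite -mem_finsupp => ai; rewrite (bigD1 i0) // in_fsetU ai.
Qed.

Lemma finsupp_lp_support (F : 'I_n -> laurent_poly K n) i :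
  (finsupp (F i) `<=` lp_support F)%fset.
Proof.
by apply/fsubsetP => a; rewrite mem_finsupp => ai; apply/lp_supportP; exists i.
Qed.

End LaurentCalculus.

(** [s] is the exact support and not a superset, because a system has a prescribed number of
    monomials. *)
Definition sparse (A : nzRingType) (f : {poly A}) (s : seq nat) :=
  uniq s /\ forall i, (f`_i != 0) = (i \in s).

(** * Univariate polynomials as systems in one variable *)

Section Univariate.
Variable K : fieldType.
Implicit Type f : {poly K}.

Lemma sparse_poly f s : sparse f s -> f = \sum_(i <- s) f`_i *: 'X^i.
Proof.
move=> [us fs]; apply/polyP => i; rewrite coef_sum.
under eq_bigr => j _ do rewrite coefZ coefXn.
have [is_|] := boolP (i \in s).
  rewrite (bigD1_seq i) //= eqxx mulr1 big1 ?addr0 // => j.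
  by rewrite eq_sym => /negbTE ->; rewrite mulr0.
move=> ins; move: (ins); rewrite -fs negbK => /eqP ->.
rewrite big_seq big1 // => j js; case: eqP => [ij|]; last by rewrite mulr0.
by rewrite -ij in js; rewrite js in ins.
Qed.

Definition lp_of_poly (f : {poly K}) (s : seq nat) : laurent_poly K 1 :=
  [fsfun a in [fset const_mx i%:Z | i in s]%fset => f`_(absz (a 0 0)) | 0].

Lemma const_mx_inj (i j : nat) : (const_mx i%:Z : 'rV_1) = const_mx j%:Z -> i = j.
Proof. by move/matrixP/(_ 0 0); rewrite !mxE => -[]. Qed.

Lemma poly_nomial_system f s k : sparse f s -> size s = k.+1 ->
  nomial_system k (fun _ : 'I_1 => lp_of_poly f s).
Proof.
move=> [us fs] ss; rewrite /nomial_system add1n -ss.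
rewrite /lp_support big_ord1.
have -> : finsupp (lp_of_poly f s) = [fset const_mx i%:Z | i in s]%fset.
  apply/fsetP => a; rewrite mem_finsupp fsfunE.
  case: ifPn; last by rewrite eqxx.
  by case/imfsetP => i /= si ->; rewrite mxE /= fs si.
rewrite card_imfset; last exact: const_mx_inj.
by apply/perm_size/uniq_perm; rewrite ?enum_finmem_uniq // => i; rewrite enum_finmemE.
Qed.

Lemma poly_nondeg_root f s (r : K) : sparse f s -> r != 0 -> root f r ->
  f^`().[r] != 0 -> nondeg_root (fun _ : 'I_1 => lp_of_poly f s) (const_mx r).
Proof.
move=> [us fs] r0 fr f'r.
have x0 (j : 'I_1) : (const_mx r : 'rV[K]_1) 0 j != 0 by rewrite mxE.
have monE (i : nat) : mon (const_mx r) (const_mx i%:Z : 'rV_1) = r ^+ i.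
  by rewrite /mon big_ord1 !mxE.
have sE (G : 'rV[int]_1 -> K) :
    \sum_(a <- [fset const_mx i%:Z | i in s]%fset) G a
      = \sum_(i <- s) G (const_mx i%:Z).
  by rewrite big_imfset /=; [rewrite undup_id | move=> i j _ _ /const_mx_inj].
have sub : (finsupp (lp_of_poly f s) `<=` [fset const_mx i%:Z | i in s])%fset.
  exact: finsupp_sub.
have lpE (i : nat) : i \in s -> lp_of_poly f s (const_mx i%:Z) = f`_i.
  move=> si; rewrite fsfunE mxE /=; case: imfsetP => // -[].
  by exists i.
have hE : f.[r] = \sum_(i <- s) f`_i * r ^+ i.
  rewrite {1}(sparse_poly (conj us fs)) horner_sum; apply: eq_bigr => i _.
  by rewrite !hornerE.
have dE : f^`().[r] * r = \sum_(i <- s) f`_i * i%:R * r ^+ i.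
  rewrite {1}(sparse_poly (conj us fs)) linear_sum horner_sum mulr_suml.
  apply: eq_bigr => i _; rewrite /= derivZ derivXn hornerZ hornerMn hornerXn -!mulrA.
  congr (_ * _); case: i => [|i]; first by rewrite mulr0n !mul0r.
  by rewrite /= mulrnAl -exprSr -mulr_natl.
apply: unit_nondeg_root => [_|].
  rewrite (lp_evalE _ sub) sE; move: fr; rewrite /root hE => /eqP fr.
  by rewrite -[RHS]fr; apply: eq_big_seq => i si; rewrite lpE // monE.
rewrite unitmxE unitfE det_mx11 mxE (lp_derivE _ x0 sub) sE mxE.
rewrite mulf_neq0 ?invr_eq0 //.
rewrite (_ : bigop _ _ _ = f^`().[r] * r) ?mulf_neq0 // dE.
by apply: eq_big_seq => i si; rewrite lpE // monE mxE.
Qed.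

End Univariate.

(** * Juxtaposition of two systems *)

Section Transport.
Variables (K : fieldType) (n m : nat) (S : {fset 'rV[int]_n}).
Variables (h : 'rV[int]_n -> 'rV[int]_m) (g : 'rV[int]_m -> 'rV[int]_n).
Hypothesis hK : cancel h g.

(** Coefficients are pulled back along [g]; the restriction to the image of [S] is essential, since
    [g] need not be injective. *)
Definition lp_transport (f : laurent_poly K n) : laurent_poly K m :=
  [fsfun b in [fset h a | a in S]%fset => f (g b) | 0].

Variable f : laurent_poly K n.

Lemma lp_transport_in a : a \in S -> lp_transport f (h a) = f a.
Proof.
move=> aS; rewrite fsfunE hK; case: imfsetP => // -[].
by exists a.
Qed.

Lemma lp_transport_out b : b \notin [fset h a | a in S]%fset ->
  lp_transport f b = 0.
Proof. by move=> bS; rewrite fsfunE (negbTE bS). Qed.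

Let sub : (finsupp (lp_transport f) `<=` [fset h a | a in S])%fset.
Proof. exact: finsupp_sub. Qed.

Lemma lp_transport_eval (y : 'rV[K]_m) :
  lp_eval (lp_transport f) y = \sum_(a <- S) f a * mon y (h a).
Proof.
rewrite (lp_evalE _ sub) big_imfset /=; last by move=> a b _ _ /(can_inj hK).
by apply: eq_big_seq => a aS; rewrite lp_transport_in.
Qed.

Lemma lp_transport_deriv j (y : 'rV[K]_m) : (forall j, y 0 j != 0) ->
  lp_eval (lp_deriv j (lp_transport f)) y
    = (\sum_(a <- S) f a * (h a 0 j)%:~R * mon y (h a)) / y 0 j.
Proof.
move=> y0; rewrite (lp_derivE _ y0 sub) big_imfset /=; last first.
  by move=> a b _ _ /(can_inj hK).
by congr (_ / _); apply: eq_big_seq => a aS; rewrite lp_transport_in.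
Qed.

End Transport.

Section BlockSystem.
Variables (K : fieldType) (n1 n2 k1 k2 : nat).
Variables (F1 : 'I_n1 -> laurent_poly K n1) (F2 : 'I_n2 -> laurent_poly K n2).
Variables (a1 : 'rV[int]_n1) (a2 : 'rV[int]_n2).
Hypotheses (a1P : a1 \in lp_support F1) (a2P : a2 \in lp_support F2).

Let h1 (a : 'rV[int]_n1) : 'rV[int]_(n1 + n2) := row_mx (a - a1) 0.
Let g1 (b : 'rV[int]_(n1 + n2)) : 'rV[int]_n1 := lsubmx b + a1.
Let h2 (a : 'rV[int]_n2) : 'rV[int]_(n1 + n2) := row_mx 0 (a - a2).
Let g2 (b : 'rV[int]_(n1 + n2)) : 'rV[int]_n2 := rsubmx b + a2.

Let h1K : cancel h1 g1.
Proof. by move=> a; rewrite /g1 row_mxKl subrK. Qed.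
Let h2K : cancel h2 g2.
Proof. by move=> a; rewrite /g2 row_mxKr subrK. Qed.

(* Each block is divided by a monomial of its own support, so that the two
   blocks share the constant monomial. *)
Definition block_system (i : 'I_(n1 + n2)) : laurent_poly K (n1 + n2) :=
  match fintype.split i with
  | inl i1 => lp_transport (lp_support F1) h1 g1 (F1 i1)
  | inr i2 => lp_transport (lp_support F2) h2 g2 (F2 i2)
  end.

Lemma block_systemL i :
  block_system (lshift n2 i) = lp_transport (lp_support F1) h1 g1 (F1 i).
Proof. by rewrite /block_system (unsplitK (inl i)). Qed.

Lemma block_systemR i :
  block_system (rshift n1 i) = lp_transport (lp_support F2) h2 g2 (F2 i).
Proof. by rewrite /block_system (unsplitK (inr i)). Qed.

(** The two supports meet in the constant monomial only, so exactly one monomial is saved. *)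
Lemma block_nomial_system : nomial_system k1.+1 F1 -> nomial_system k2.+1 F2 ->
  nomial_system (k1 + k2).+1 block_system.
Proof.
rewrite /nomial_system => c1 c2.
set S1 := [fset h1 a | a in lp_support F1]%fset.
set S2 := [fset h2 a | a in lp_support F2]%fset.
have -> : lp_support block_system = (S1 `|` S2)%fset.
  apply/fsetP => b; rewrite in_fsetU; apply/lp_supportP/orP.
    move=> [i0]; rewrite /block_system; case: fintype.split => i.
      by case: (boolP (b \in S1)) => [|/lp_transport_out ->]; [left | rewrite eqxx].
    by case: (boolP (b \in S2)) => [|/lp_transport_out ->]; [right | rewrite eqxx].
  case=> /imfsetP [a /= aS ->]; have /lp_supportP [i0 Fa] := aS.
    by exists (lshift n2 i0); rewrite block_systemL lp_transport_in.
  by exists (rshift n1 i0); rewrite block_systemR lp_transport_in.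
rewrite cardfsU.
have -> : (S1 `&` S2 = [fset 0])%fset.
  apply/fsetP => b; rewrite in_fsetI in_fset1; apply/andP/eqP.
    case=> /imfsetP [a /= _ ->] /imfsetP [a' /= _ /eq_row_mx [E _]].
    by rewrite /h1 E row_mx0.
  move=> ->; split; apply/imfsetP.
    by exists a1; rewrite // /h1 subrr row_mx0.
  by exists a2; rewrite // /h2 subrr row_mx0.
rewrite cardfs1 !card_imfset ?c1 ?c2 /=; last 2 first.
- exact: can_inj h2K.
- exact: can_inj h1K.
by lia.
Qed.

Lemma mon_row_mx (x1 : 'rV[K]_n1) (x2 : 'rV[K]_n2) (b1 : 'rV[int]_n1)
    (b2 : 'rV[int]_n2) :
  mon (row_mx x1 x2) (row_mx b1 b2) = mon x1 b1 * mon x2 b2.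
Proof.
rewrite /mon big_split_ord; congr (_ * _); apply: eq_bigr => i _.
  by rewrite !row_mxEl.
by rewrite !row_mxEr.
Qed.

(** The Jacobian matrix is block diagonal, each block being the old one divided by the value of the
    chosen monomial. *)
Lemma block_nondeg_root (x1 : 'rV[K]_n1) (x2 : 'rV[K]_n2) :
  (forall j, x1 0 j != 0) -> (forall j, x2 0 j != 0) ->
  nondeg_root F1 x1 -> nondeg_root F2 x2 ->
  nondeg_root block_system (row_mx x1 x2).
Proof.
move=> x10 x20 r1 r2; have [u1 u2] := (nondeg_root_unit r1, nondeg_root_unit r2).
case: r1 r2 => [r1 _] [r2 _].
have y0 j : row_mx x1 x2 0 j != 0.
  by rewrite mxE; case: fintype.split.
apply: unit_nondeg_root => [i|].
  rewrite /block_system; case: fintype.split => {}i; rewrite lp_transport_eval //.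
    transitivity (lp_eval (F1 i) x1 / mon x1 a1); last by rewrite r1 mul0r.
    rewrite (lp_evalE _ (finsupp_lp_support F1 i)).
    rewrite mulr_suml; apply: eq_bigr => a _.
    by rewrite mon_row_mx mon0 mulr1 monB // mulrA.
  transitivity (lp_eval (F2 i) x2 / mon x2 a2); last by rewrite r2 mul0r.
    rewrite (lp_evalE _ (finsupp_lp_support F2 i)).
  rewrite mulr_suml; apply: eq_bigr => a _.
  by rewrite mon_row_mx mon0 mul1r monB // mulrA.
have -> : lp_jacobian block_system (row_mx x1 x2) =
    block_mx ((mon x1 a1)^-1 *: lp_jacobian F1 x1) 0
             0 ((mon x2 a2)^-1 *: lp_jacobian F2 x2).
  apply/matrixP => i j; rewrite [LHS]mxE.
  rewrite -(fintype.splitK i) -(fintype.splitK j).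
  case: (fintype.split i) => {}i; case: (fintype.split j) => {}j /=.
  - rewrite block_systemL lp_transport_deriv // block_mxEul row_mxEl !mxE.
    rewrite (lp_derivE _ x10 (finsupp_lp_support F1 i)) mulrA; congr (_ / _).
    (* Shifting the exponents by [a1] changes the derivative by a multiple of the value of [F1 i] at
       the root, which is zero. *)
    have E : \sum_(a <- lp_support F1) F1 i a * mon x1 a = 0.
      by rewrite -(lp_evalE _ (finsupp_lp_support F1 i)).
    rewrite -[RHS]subr0 -[X in _ = _ - X](mulr0 ((mon x1 a1)^-1 * (a1 0 j)%:~R)).
    rewrite -[X in _ = _ - _ * X]E.
    rewrite !mulr_sumr -sumrB; apply: eq_bigr => a _.
    rewrite /h1 mon_row_mx mon0 mulr1 monB // row_mxEl !mxE intrB; ring.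
  - rewrite block_systemL lp_transport_deriv // block_mxEur [RHS]mxE.
    rewrite big1 ?mul0r // => a _.
    by rewrite /h1 row_mxEr mxE mulr0 mul0r.
  - rewrite block_systemR lp_transport_deriv // block_mxEdl [RHS]mxE.
    rewrite big1 ?mul0r // => a _.
    by rewrite /h2 row_mxEl mxE mulr0 mul0r.
  - rewrite block_systemR lp_transport_deriv // block_mxEdr row_mxEr !mxE.
    rewrite (lp_derivE _ x20 (finsupp_lp_support F2 i)) mulrA; congr (_ / _).
    have E : \sum_(a <- lp_support F2) F2 i a * mon x2 a = 0.
      by rewrite -(lp_evalE _ (finsupp_lp_support F2 i)).
    rewrite -[RHS]subr0 -[X in _ = _ - X](mulr0 ((mon x2 a2)^-1 * (a2 0 j)%:~R)).
    rewrite -[X in _ = _ - _ * X]E.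
    rewrite !mulr_sumr -sumrB; apply: eq_bigr => a _.
    rewrite /h2 mon_row_mx mon0 mul1r monB // row_mxEr !mxE intrB; ring.
rewrite unitmxE det_ublock unitrM -!unitmxE !unitmxZ ?u1 ?u2 //.
  by rewrite unitfE invr_eq0 mon_neq0.
by rewrite unitfE invr_eq0 mon_neq0.
Qed.

End BlockSystem.

(** * Supermultiplicativity of Y *)

Section RootCounts.
Variables (K : fieldType) (P : set K).

Definition phase_roots n (F : 'I_n -> laurent_poly K n) : set 'rV[K]_n :=
  [set x | nondeg_root F x /\ forall j, P (x 0 j)]%classic.

(** Root counts are handled through finite lists, so that products of counts are products of
    naturals even when [Y] is infinite. *)
Definition attains n k (N : nat) := exists2 F : 'I_n -> laurent_poly K n,
  nomial_system k F & exists s : seq 'rV[K]_n,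
    [/\ uniq s, size s = N & {in s, forall x, phase_roots F x}].

(** Some system with [n + k] monomials must exist, or the supremum would be [-oo]. All equations are
    equal here, with monomials on the diagonal. *)
Lemma attains0 n k : (0 < n)%N -> attains n k 0.
Proof.
case: n => // n _.
pose S := [fset (const_mx i%:Z : 'rV[int]_n.+1) | i in iota 0 (n.+1 + k)]%fset.
exists (fun=> [fsfun a in S => 1 | 0]); last by exists [::].
rewrite /nomial_system; set F := fun _ => _.
have -> : lp_support F = S.
  apply/fsetP => a; apply/lp_supportP/idP => [[i0]|aS].
    by rewrite /F fsfunE; case: ifP => //; rewrite eqxx.
  by exists 0; rewrite /F fsfunE aS oner_eq0.
rewrite card_imfset => [|i j /matrixP /(_ 0 0)]; last by rewrite !mxE => -[].
rewrite -[RHS](size_iota 0); apply/perm_size/uniq_perm.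
- exact: enum_finmem_uniq.
- exact: iota_uniq.
- exact: enum_finmemE.
Qed.

Lemma attains_poly (f : {poly K}) (s : seq nat) k (rs : seq K) :
  (forall y, P y -> y != 0) ->
  sparse f s -> size s = k.+1 -> uniq rs ->
  {in rs, forall r, [/\ root f r, f^`().[r] != 0 & P r]} ->
  attains 1 k (size rs).
Proof.
move=> P0 fs ss urs rsP; exists (fun=> lp_of_poly f s).
  exact: poly_nomial_system.
exists [seq const_mx r | r <- rs]; split; last 1 first.
- move=> _ /mapP [r /rsP [fr f'r Pr] ->]; split=> [|j]; last by rewrite mxE.
  exact: poly_nondeg_root fs (P0 _ Pr) fr f'r.
- by rewrite map_inj_uniq // => r r' /matrixP /(_ 0 0); rewrite !mxE.
- by rewrite size_map.
Qed.

Lemma attainsM n1 k1 N1 n2 k2 N2 : (forall y, P y -> y != 0) ->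
  attains n1 k1.+1 N1 -> attains n2 k2.+1 N2 ->
  attains (n1 + n2) (k1 + k2).+1 (N1 * N2).
Proof.
move=> P0 [F1 c1 [s1 [u1 <- s1P]]] [F2 c2 [s2 [u2 <- s2P]]].
have [a1 a1P] : exists a, a \in lp_support F1.
  by apply/fset0Pn; rewrite -cardfs_gt0 c1 addnS.
have [a2 a2P] : exists a, a \in lp_support F2.
  by apply/fset0Pn; rewrite -cardfs_gt0 c2 addnS.
exists (block_system F1 F2 a1 a2); first exact: block_nomial_system.
exists [seq row_mx x1 x2 | x1 <- s1, x2 <- s2]; split.
- by rewrite allpairs_uniq // => -[x y] [x' y'] _ _ /= /eq_row_mx [-> ->].
- by rewrite size_allpairs.
- move=> _ /allpairsP [[x1 x2] /= [/s1P [r1 P1] /s2P [r2 P2] ->]].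
  split; last by move=> j; rewrite mxE; case: fintype.split.
  by apply: block_nondeg_root => // j; exact: P0.
Qed.

End RootCounts.

Lemma counting_ge (T : choiceType) (R : realType) (A : set T) (s : seq T) :
  uniq s -> {in s, forall x, A x} -> ((size s)%:R%:E <= counting A :> \bar R)%E.
Proof.
move=> us sA; rewrite /counting; case: asboolP => [fA|_]; last exact: leey.
rewrite lee_fin ler_nat; apply: uniq_leq_size => // x xs.
by rewrite in_fset_set // inE; exact: sA.
Qed.

(** Either factor may be infinite. For [a = +oo], a positive element of [S] forces [c = +oo];
    without one the supremum is 0, and so is the product. *)
Lemma mule_ereal_sup_le (R : realType) (a c : \bar R) (S : set (\bar R)) :
  (0 <= a)%E -> (S !=set0)%classic -> (forall s, S s -> 0 <= s)%E ->
  (forall s, S s -> a * s <= c)%E -> (a * ereal_sup S <= c)%E.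
Proof.
move=> a0 [s0 Ss0] S0 Sc; case: a a0 Sc => [r||] //; last first.
  move=> _ Sc; case: (pselect (exists2 s, S s & (0 < s)%E)) => [[s Ss s_gt0]|N].
    by move: (Sc _ Ss); rewrite gt0_mulye // leye_eq => /eqP ->; exact: leey.
  have S_0 s : S s -> s = 0%E.
    move=> Ss; apply/eqP; rewrite eq_le S0 // andbT leNgt; apply/negP => s_gt0.
    by apply: N; exists s.
  have -> : ereal_sup S = 0%E.
    apply/eqP; rewrite eq_le; apply/andP; split.
      by apply: ge_ereal_sup => s /S_0 ->.
    by apply: le_ereal_sup_tmp; exists s0 => //; exact: S0.
  by rewrite mule0 -(mule0 +oo%E) -(S_0 _ Ss0); exact: Sc.
rewrite lee_fin le_eqVlt => /orP [/eqP <- Sc|r0 Sc].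
  by rewrite mul0e -(mul0e s0); exact: Sc.
rewrite -ereal_sup_pZl //; apply: ge_ereal_sup => _ [s Ss <-].
exact: Sc.
Qed.

Section YBounds.
Variables (R : realType) (L : local_field R).

Lemma phase1_neq0 (y : carrier L) : phase1 y -> y != 0.
Proof. by case: L y => [||p p_pr E rho ?|F rho ?] y []. Qed.

(** An infinite set of roots has finite subsets of every size, so it contributes [+oo] on both
    sides. *)
Lemma YE n k : Y L n k =
  ereal_sup [set N%:R%:E | N in attains (@phase1 R L) n k]%classic.
Proof.
apply/eqP; rewrite eq_le; apply/andP; split; last first.
  apply: ge_ereal_sup => _ [_ [F cF [s [us <- sF]]] <-].
  apply: le_ereal_sup_tmp; exists (counting (phase_roots (@phase1 R L) F)).
    by exists F.
  exact: counting_ge.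
apply: ge_ereal_sup => _ [F cF <-].
rewrite -/(phase_roots _ _) /counting; case: asboolP => [fA|iA].
  apply: le_ereal_sup_tmp; eexists; last exact: lexx.
  eexists; last reflexivity; exists F => //.
  exists (fset_set (phase_roots (@phase1 R L) F)); split => //; first exact: fset_uniq.
  by move=> x; rewrite in_fset_set // inE.
rewrite leye_eq; apply/eqP/eqyP => A A0.
have [B sB nB] := infinite_set_fset (Num.trunc A).+1 iA.
apply: (@le_trans _ _ #|` B|%:R%:E).
  rewrite lee_fin; apply/ltW/(lt_le_trans (truncnS_gt _)).
  by rewrite ler_nat.
apply: ereal_sup_ubound; exists #|` B| => //; exists F => //.
by exists B; split => [||x xB]; [exact: fset_uniq | | exact: sB].
Qed.

Lemma attains_le_Y n k N : attains (@phase1 R L) n k N -> (N%:R%:E <= Y L n k)%E.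
Proof. by move=> aN; rewrite YE; apply: ereal_sup_ubound; exists N. Qed.

Lemma Y_ge0 n k : (0 < n)%N -> (0 <= Y L n k)%E.
Proof. by move=> n0; apply: (@attains_le_Y _ _ 0); exact: attains0. Qed.

Lemma YM n1 k1 n2 k2 : (0 < n1)%N -> (0 < n2)%N ->
  (Y L n1 k1.+1 * Y L n2 k2.+1 <= Y L (n1 + n2) (k1 + k2).+1)%E.
Proof.
move=> n10 n20; rewrite [Y L n2 _]YE.
apply: mule_ereal_sup_le; first exact: Y_ge0.
- by exists 0%:R%:E, 0%N => //; exact: attains0.
- by move=> _ [N _ <-]; rewrite lee_fin.
move=> _ [N2 a2 <-]; rewrite muleC YE.
apply: mule_ereal_sup_le; first by rewrite lee_fin.
- by exists 0%:R%:E, 0%N => //; exact: attains0.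
- by move=> _ [N _ <-]; rewrite lee_fin.
move=> _ [N1 a1 <-]; rewrite -EFinM -natrM mulnC; apply: attains_le_Y.
by apply: attainsM => //; exact: phase1_neq0.
Qed.

Lemma YX n k m : (0 < n)%N -> (Y L n k.+1 ^+ m.+1 <= Y L (n * m.+1) (k * m.+1).+1)%E.
Proof.
move=> n0; elim: m => [|m IH]; first by rewrite !muln1.
rewrite expeS !(mulnS _ m.+1); apply: le_trans (YM _ _ _ _) => //; last first.
  by rewrite muln_gt0 n0.
by apply: lee_wpmul2l => //; exact: Y_ge0.
Qed.

(** A zero exponent means an absent block, which is split off instead of being juxtaposed; one block
    has to remain. *)
Lemma Y_powM n1 k1 m1 n2 k2 m2 : (0 < n1)%N -> (0 < n2)%N -> (0 < m1)%N ->
  (Y L n1 k1.+1 ^+ m1 * Y L n2 k2.+1 ^+ m2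
    <= Y L (n1 * m1 + n2 * m2) (k1 * m1 + k2 * m2).+1)%E.
Proof.
case: m1 => // m1 n10 n20 _; case: m2 => [|m2].
  by rewrite expe0 mule1 !muln0 !addn0; exact: YX.
apply: le_trans (YM _ _ _ _); rewrite ?muln_gt0 ?n10 ?n20 //.
by apply: lee_pmul; rewrite ?expe_ge0 ?Y_ge0 //; exact: YX.
Qed.

End YBounds.

(** * The chain system *)

Section ParityProducts.
Variables (T : Type) (idx : T) (op : Monoid.com_law idx).

Lemma big_even_recl n (f : nat -> T) :
  \big[op/idx]_(i < n.+1 | ~~ odd i) f i
    = op (f 0%N) (\big[op/idx]_(i < n | odd i) f i.+1).
Proof.
rewrite big_mkcond big_ord_recl /= [in RHS]big_mkcond; congr (op _ _).
by apply: eq_bigr => i _; rewrite /= negbK.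
Qed.

Lemma big_odd_recl n (f : nat -> T) :
  \big[op/idx]_(i < n.+1 | odd i) f i = \big[op/idx]_(i < n | ~~ odd i) f i.+1.
Proof. by rewrite big_mkcond big_ord_recl Monoid.mul1m [in RHS]big_mkcond. Qed.

End ParityProducts.

(** This balances the powers of [e]: an index [i < j] costs [e ^ (2 (j - i) - 1)], and the even
    indices cost [j] more than the odd ones, which is the denominator of [v = w / e ^ j]. Truncated
    subtraction gives 0 for [i >= j]. *)
Lemma sum_parity_shift n j : (j <= n)%N ->
  (\sum_(i < n | ~~ odd i) (2 * (j - i) - 1)
    = j + \sum_(i < n | odd i) (2 * (j - i) - 1))%N.
Proof.
elim: n j => [|n IH] [|j] // jn; first by rewrite !big_ord0.
  by rewrite !big1 // => i _; rewrite sub0n.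
rewrite (big_even_recl _ _ (fun i => 2 * (j.+1 - i) - 1)%N).
rewrite (big_odd_recl _ _ (fun i => 2 * (j.+1 - i) - 1)%N) /=.
under eq_bigr => i _ do rewrite subSS.
under [in RHS]eq_bigr => i _ do rewrite subSS.
rewrite IH //; move: (\sum_(i < n | odd i) _)%N => X; lia.
Qed.

Section ChainPolynomial.
Variables (A : comNzRingType) (n : nat).
Implicit Types (e w : A) (j : nat).

(** This is [1 + e ^ (2 i + 1) v ^ 2] at [v = w / e ^ j], multiplied by [e ^ (2 (j - i) - 1)] when
    [i < j], so that no negative power of [e] occurs. *)
Definition chain_form j (i : nat) e w :=
  if (i < j)%N then w ^+ 2 + e ^+ (2 * (j - i) - 1)
  else 1 + e ^+ (2 * (i - j) + 1) * w ^+ 2.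

(* With [v = w / e ^+ j], the equation
   [\prod_(i even) (1 + e ^+ (2 * i + 1) * v ^+ 2)
      = v * \prod_(i odd) (1 + e ^+ (2 * i + 1) * v ^+ 2)]
   becomes [chain_poly j e w = 0] after clearing the powers of [e]. *)
Definition chain_poly j e w :=
  \prod_(i < n | ~~ odd i) chain_form j i e w
    - w * \prod_(i < n | odd i) chain_form j i e w.

Definition cong_mod e (x y : A) := exists s, x = y + e * s.

Lemma cong_modM e x1 y1 x2 y2 : cong_mod e x1 y1 -> cong_mod e x2 y2 ->
  cong_mod e (x1 * x2) (y1 * y2).
Proof.
by move=> [s ->] [t ->]; exists (y1 * t + s * y2 + e * s * t); ring.
Qed.

Lemma cong_mod_prod e (P : pred 'I_n) (f g : 'I_n -> A) :
  (forall i, cong_mod e (f i) (g i)) ->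
  cong_mod e (\prod_(i | P i) f i) (\prod_(i | P i) g i).
Proof.
move=> fg; elim/big_ind2: _ => [|x1 x2 y1 y2|i _]; last exact: fg.
  by exists 0; rewrite mulr0 addr0.
exact: cong_modM.
Qed.

Lemma chain_form_mod j (i : nat) e w :
  cong_mod e (chain_form j i e w) (if (i < j)%N then w ^+ 2 else 1).
Proof.
rewrite /chain_form; case: ltnP => ij.
  exists (e ^+ (2 * (j - i) - 2)); rewrite -exprS; congr (_ + _ ^+ _); lia.
by exists (e ^+ (2 * (i - j)) * w ^+ 2); rewrite addn1 exprS mulrA.
Qed.

(** Twice the number of even (odd) indices below [j] is [j] rounded up (down) to an even number.
    Peeling off index 0 exchanges the parities, so the two equations need each other in the
    induction. *)
Lemma chain_prod_step j w : (j <= n)%N ->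
  (\prod_(i < n | ~~ odd i) (if (i < j)%N then w ^+ 2 else 1) = w ^+ (j + odd j))
  * (\prod_(i < n | odd i) (if (i < j)%N then w ^+ 2 else 1) = w ^+ (j - odd j)).
Proof.
elim: n j => [|m IH] [|j] // jm; first by rewrite !big_ord0 !expr0.
  by rewrite !big1 // => i _; rewrite ltn0.
rewrite (big_even_recl _ _ (fun i => if (i < j.+1)%N then w ^+ 2 else 1)).
rewrite (big_odd_recl _ _ (fun i => if (i < j.+1)%N then w ^+ 2 else 1)) /=.
have [-> ->] := IH j jm; rewrite -exprD.
by split; congr (_ ^+ _); case: (boolP (odd j)) => /=; case: (j) => //; lia.
Qed.

(** Modulo [e], the value 1 is a simple zero whose derivative is a sign. This is the input both for
    Hensel's lemma and for the sign change over the reals. *)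
Lemma chain_poly_mod j e w : (j <= n)%N ->
  cong_mod e (chain_poly j e w) ((-1) ^+ j * (w ^+ j * (1 - w))).
Proof.
move=> jn; have [E O] := chain_prod_step w jn.
have [s sE] := cong_mod_prod (fun i : 'I_n => ~~ odd i)
  (fun i : 'I_n => chain_form_mod j i e w).
have [t tE] := cong_mod_prod (fun i : 'I_n => odd i)
  (fun i : 'I_n => chain_form_mod j i e w).
exists (s - w * t); rewrite /chain_poly sE tE E O -signr_odd.
case: (boolP (odd j)) jn => [|_ _]; last by rewrite expr0 addn0 subn0; ring.
move: {+}j => [|m] // _ _; rewrite subn1 addn1 /= !exprS; ring.
Qed.

End ChainPolynomial.

Lemma rmorph_chain_form (A B : comNzRingType) (phi : {rmorphism A -> B}) j i e w :
  phi (chain_form j i e w) = chain_form j i (phi e) (phi w).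
Proof.
rewrite /chain_form; case: ifP => _; first by rewrite rmorphD !rmorphXn.
by rewrite rmorphD rmorph1 rmorphM !rmorphXn.
Qed.

Lemma rmorph_chain_poly (A B : comNzRingType) (phi : {rmorphism A -> B}) n j e w :
  phi (chain_poly n j e w) = chain_poly n j (phi e) (phi w).
Proof.
rewrite /chain_poly rmorphB rmorphM !rmorph_prod.
by congr (_ - _ * _); apply: eq_bigr => i _; exact: rmorph_chain_form.
Qed.

Lemma horner_chain_poly (A : comNzRingType) n j (e w : A) :
  (chain_poly n j e%:P 'X).[w] = chain_poly n j e w.
Proof.
rewrite -[LHS]/(horner_eval w _) rmorph_chain_poly /= /horner_eval.
by rewrite hornerC hornerX.
Qed.

Lemma horner_deriv_prod (K : fieldType) (I : Type) (r : seq I) (P : pred I)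
    (f : I -> {poly K}) x : (forall i, (f i).[x] != 0) ->
  (\prod_(i <- r | P i) f i)^`().[x]
    = (\prod_(i <- r | P i) (f i).[x]) * \sum_(i <- r | P i) (f i)^`().[x] / (f i).[x].
Proof.
move=> f0; elim: r => [|i r IH]; first by rewrite !big_nil -polyC1 derivC horner0 mulr0.
rewrite !big_cons; case: (P i) => //; rewrite derivM !hornerE IH horner_prod.
by field; exact: f0.
Qed.

Section ChainSystem.
Variables (K : fieldType) (P : set K) (n : nat) (e : K).
Hypotheses (n_gt0 : (0 < n)%N) (e_neq0 : e != 0).

Let c (i : nat) : K := e ^+ (2 * i + 1).
Let x_ (v : K) : 'rV[K]_n := \row_i (1 + c i * v ^+ 2).
(** With [A] and [B] the products of the coordinates of even and odd index, [X ^ b = (A / B) ^ 2].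
    The entries are 2 and -2 to make this a square with the canonical root [v = A / B], whence the
    polynomial equation [A = v B]. *)
Let b : 'rV[int]_n := \row_i (if odd i then - 2%:Z else 2%:Z).
Let d i : 'rV[int]_n := delta_mx 0 i.
Let S : {fset 'rV[int]_n} := ([fset 0; b] `|` [fset d i | i in 'I_n])%fset.

Definition chain_system (i : 'I_n) : laurent_poly K n :=
  [fsfun a in S => (a == d i)%:R - (a == 0)%:R - c i * (a == b)%:R | 0].

Let dS i : d i \in S.
Proof. by rewrite in_fsetU; apply/orP; right; apply/imfsetP; exists i. Qed.
Let S0 : 0 \in S. Proof. by rewrite !inE eqxx. Qed.
Let Sb : b \in S. Proof. by rewrite !inE eqxx orbT. Qed.

Let b_neq0 : b != 0.
Proof.
apply/eqP => /matrixP /(_ 0 (Ordinal n_gt0)); rewrite !mxE.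
by case: odd.
Qed.
Let d_neq0 i : d i != 0.
Proof. by apply/eqP => /matrixP /(_ 0 i); rewrite !mxE !eqxx. Qed.
Let d_neqb i : d i != b.
Proof.
by apply/eqP => /matrixP /(_ 0 i); rewrite !mxE !eqxx; case: odd.
Qed.
Let d_inj : injective d.
Proof.
move=> i j /matrixP /(_ 0 i); rewrite !mxE !eqxx /=.
by case: eqP.
Qed.

Lemma chain_nomial_system : nomial_system 2 chain_system.
Proof.
rewrite /nomial_system.
have -> : lp_support chain_system = S.
  apply/fsetP => a; apply/lp_supportP/idP => [[i0]|aS].
    by rewrite fsfunE; case: ifP => //; rewrite eqxx.
  move: (aS); rewrite in_fsetU in_fset2 => /orP [/orP [] /eqP aE|].
  - exists (Ordinal n_gt0); rewrite fsfunE aS aE eqxx.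
    rewrite ![0 == _]eq_sym (negbTE (d_neq0 _)) (negbTE b_neq0) mulr0 subr0 sub0r.
    by rewrite oppr_eq0 oner_eq0.
  - exists (Ordinal n_gt0); rewrite fsfunE aS aE eqxx.
    rewrite [b == d _]eq_sym (negbTE (d_neqb _)) (negbTE b_neq0) subr0 sub0r mulr1.
    by rewrite oppr_eq0 expf_neq0.
  - case/imfsetP => i _ aE; exists i; rewrite fsfunE aS aE eqxx.
    by rewrite (negbTE (d_neq0 _)) (negbTE (d_neqb _)) mulr0 !subr0 oner_eq0.
rewrite cardfsU cardfs2 eq_sym b_neq0 card_imfset //.
have -> : ([fset 0; b] `&` [fset d i | i in 'I_n] = fset0)%fset.
  apply/fsetP => a; rewrite in_fsetI in_fset2 in_fset0; apply/negP => /andP [].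
  move=> a0b /imfsetP [i _ aE]; move: a0b.
  by rewrite aE (negbTE (d_neq0 _)) (negbTE (d_neqb _)).
rewrite cardfs0 subn0 addnC; congr (_ + _)%N.
rewrite -[RHS]card_ord cardE; apply/perm_size/uniq_perm.
- exact: enum_finmem_uniq.
- exact: enum_uniq.
- by move=> i; rewrite [RHS]mem_enum; exact: enum_finmemE.
Qed.

Let sum_delta (G : 'rV[int]_n -> K) u : u \in S ->
  \sum_(a <- S) (a == u)%:R * G a = G u.
Proof.
move=> uS; rewrite (bigD1_seq u) //= ?fset_uniq // eqxx mul1r.
by rewrite big1 ?addr0 // => a /negbTE ->; rewrite mul0r.
Qed.

Let sum_chain i (G : 'rV[int]_n -> K) :
  \sum_(a <- S) chain_system i a * G a = G (d i) - G 0 - c i * G b.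
Proof.
rewrite -(sum_delta _ (dS i)) -(sum_delta _ S0) -(sum_delta _ Sb) mulr_sumr.
rewrite -!sumrB; apply: eq_big_seq => a aS.
by rewrite fsfunE aS !mulrBl mulrA.
Qed.

Let sub i : (finsupp (chain_system i) `<=` S)%fset.
Proof. exact: finsupp_sub. Qed.

Let A_ (v : K) := \prod_(i < n | ~~ odd i) (1 + c i * v ^+ 2).
Let B_ (v : K) := \prod_(i < n | odd i) (1 + c i * v ^+ 2).

Let q i : {poly K} := 1 + c i *: 'X^2.
Let G := \prod_(i < n | ~~ odd i) q i - 'X * \prod_(i < n | odd i) q i.

Let qE i v : (q i).[v] = 1 + c i * v ^+ 2.
Proof. by rewrite !hornerE. Qed.

Let GE v : G.[v] = A_ v - v * B_ v.
Proof.
rewrite /G !hornerE !horner_prod; congr (_ - _ * _);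
by apply: eq_bigr => i _; rewrite qE.
Qed.

Let size_G : (size G <= n.+2)%N.
Proof.
have sq i : (size (q i) <= 3)%N.
  rewrite (leq_trans (size_polyD _ _)) // geq_max size_poly1 /=.
  by rewrite (leq_trans (size_scale_leq _ _)) // size_polyXn.
(* Each factor has degree at most 2, so the degrees are at most [m] rounded up and down to an even
   number. *)
have H m : (size (\prod_(i < m | ~~ odd i) q i)%R <= m + odd m + 1)%N /\
           (size (\prod_(i < m | odd i) q i)%R <= m - odd m + 1)%N.
  elim: m => [|m [IHA IHB]]; first by rewrite !big_ord0 size_poly1.
  have EA : \prod_(i < m.+1 | ~~ odd i) q i
      = (\prod_(i < m | ~~ odd i) q i) * (if odd m then 1 else q m).
    by rewrite big_mkcond big_ord_recr -big_mkcond if_neg.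
  have EB : \prod_(i < m.+1 | odd i) q i
      = (\prod_(i < m | odd i) q i) * (if odd m then q m else 1).
    by rewrite big_mkcond big_ord_recr -big_mkcond.
  have sM (p r : {poly K}) (k l : nat) : (size p <= k.+1)%N -> (size r <= l.+1)%N ->
      (size (p * r)%R <= (k + l).+1)%N.
    move=> pk rl; rewrite (leq_trans (size_polyMleq _ _)) //.
    by rewrite -subn1 leq_subLR add1n -addnS -addSn leq_add.
  rewrite EA EB /=; case: (boolP (odd m)) IHA IHB => /= om IHA IHB; rewrite mulr1; split.
  - by rewrite (leq_trans IHA) // !addn1 addn0.
  - have -> : (m.+1 - 0 + 1 = (m - 1 + 2).+1)%N by case: (m) om => //; lia.
    by apply: sM => //; rewrite -addn1.
  - have -> : (m.+1 + 1 + 1 = (m + 2).+1)%N by lia.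
    by apply: sM => //; rewrite addn0 addn1 in IHA.
  - by rewrite (leq_trans IHB) // subSS !subn0.
have [HA HB] := H n; rewrite (leq_trans (size_polyD _ _)) // geq_max size_polyN.
rewrite (leq_trans HA) /=; last by case: odd; lia.
rewrite mulrC; have [->|B0] := eqVneq (\prod_(i < n | odd i) q i) 0.
  by rewrite mul0r size_poly0.
by rewrite size_mulX // ltnS (leq_trans HB) //; lia.
Qed.

(** The Jacobian matrix is [1 - C D] with [C] a column and [D] a row, invertible once the scalar
    [1 - D C] is nonzero. Logarithmic differentiation gives [v G'(v) = - v B (1 - D C)] at a
    root. *)
Lemma chain_nondeg_root v : (forall i, x_ v 0 i != 0) ->
  A_ v = v * B_ v -> G^`().[v] != 0 -> nondeg_root chain_system (x_ v).
Proof.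
move=> x0 AvB G'v.
have B0 : B_ v != 0.
  by apply/prodf_neq0 => i _; have := x0 i; rewrite mxE.
have A0 : A_ v != 0.
  by apply/prodf_neq0 => i _; have := x0 i; rewrite mxE.
have v0 : v != 0 by apply: contra_neq A0 => v0; rewrite AvB v0 mul0r.
have monb : mon (x_ v) b = v ^+ 2.
  rewrite /mon (bigID (fun i : 'I_n => ~~ odd i)) /=.
  rewrite (eq_bigr (fun i : 'I_n => (1 + c i * v ^+ 2) ^+ 2)); last first.
    by move=> i /negbTE oi; rewrite !mxE oi.
  rewrite [X in _ * X](eq_big (fun i : 'I_n => odd i)
      (fun i : 'I_n => ((1 + c i * v ^+ 2) ^+ 2)^-1)).
  - rewrite prodfV !prodrXl -/(A_ v) -/(B_ v) AvB exprMn mulfK //.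
    by rewrite expf_neq0.
  - by move=> i; rewrite negbK.
  - by move=> i; rewrite negbK => oi; rewrite !mxE oi.
apply: unit_nondeg_root => [i|].
  rewrite (lp_evalE _ (sub i)) sum_chain mon_delta mon0 monb mxE; ring.
pose C : 'cV[K]_n := \col_i c i.
pose D : 'rV[K]_n := \row_j ((b 0 j)%:~R * v ^+ 2 / x_ v 0 j).
have -> : lp_jacobian chain_system (x_ v) = 1%:M - C *m D.
  apply/matrixP => i j; rewrite mxE (lp_derivE _ x0 (sub i)).
  under eq_bigr => a _ do rewrite -mulrA.
  rewrite (sum_chain i (fun a => (a 0 j)%:~R * mon (x_ v) a)).
  have -> : (1%:M - C *m D) i j
      = (i == j)%:R - c i * ((b 0 j)%:~R * v ^+ 2 / x_ v 0 j).
    by rewrite !mxE big_ord1 !mxE.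
  rewrite mon_delta mon0 monb [(0 : 'rV_n) 0 j]mxE [d i 0 j]mxE eqxx /=.
  rewrite mul0r subr0 mulrBl !mulrA; congr (_ - _).
  rewrite eq_sym; case: eqP => [->|_]; last by rewrite !mul0r.
  by rewrite mul1r mulfV.
pose del := \sum_(j < n) D 0 j * C j 0.
have DC : D *m C = del%:M.
  by apply/matrixP => i j; rewrite !mxE !ord1 eqxx mulr1n.
have del1 : 1 - del != 0.
  apply: contra G'v => /eqP del1; apply/eqP/(mulfI v0); rewrite mulr0.
  have dq i : v * ((q i)^`().[v] / (q i).[v]) = 2%:R * c i * v ^+ 2 / (1 + c i * v ^+ 2).
    rewrite qE mulrA; congr (_ / _); rewrite /q derivD derivC derivZ derivXn.
    by rewrite !hornerE /=; ring.
  have q0 (i : 'I_n) : (q i).[v] != 0 by have := x0 i; rewrite mxE qE.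
  rewrite /G derivB derivM derivX mul1r !hornerE !horner_deriv_prod //.
  rewrite !horner_prod; under eq_bigr => i _ do rewrite qE.
  under [X in _ - (X + _)]eq_bigr => i _ do rewrite qE.
  under [X in _ - (_ + _ * (X * _))]eq_bigr => i _ do rewrite qE.
  rewrite -/(A_ v) -/(B_ v) AvB.
  set Se := \sum_(i < n | ~~ odd i) _; set So := \sum_(i < n | odd i) _.
  have -> : v * (v * B_ v * Se - (B_ v + v * (B_ v * So)))
     = v * B_ v * (v * Se - v * So - 1) by ring.
  rewrite (_ : v * Se - v * So = del) ?(subr0_eq del1) ?subrr ?mulr0 //.
  rewrite /del (bigID (fun i : 'I_n => ~~ odd i)) /= !mulr_sumr -sumrN.
  congr (_ + _); first apply: eq_bigr => i oi; last apply: eq_big => [i|i oi].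
  - by rewrite dq !mxE (negbTE oi); field; have := x0 i; rewrite mxE.
  - by rewrite negbK.
  - by rewrite dq !mxE oi; field; have := x0 i; rewrite mxE.
(* The inverse comes from the Sherman-Morrison formula. *)
have /mulmx1_unit [] // :
    (1%:M - C *m D) *m (1%:M + (1 - del)^-1 *: (C *m D)) = 1%:M.
rewrite mulmxBl !mulmxDr !mulmx1 mul1mx -!scalemxAr -!mulmxA (mulmxA D C D) DC.
rewrite mul_scalar_mx -scalemxAr; apply/matrixP => i j; rewrite !mxE.
set X := \sum__ _; field.
by [].
Qed.

Lemma chain_attains (vs : seq K) : (forall y, P y -> y != 0) -> uniq vs ->
  size vs = n.+1 ->
  {in vs, forall v, A_ v = v * B_ v /\ forall i : 'I_n, P (1 + c i * v ^+ 2)} ->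
  attains P n 2 n.+1.
Proof.
move=> P0 uvs svs vsP.
have xP v : v \in vs -> forall i, x_ v 0 i != 0.
  by move=> /vsP [_ Pv] i; rewrite mxE; exact/P0/Pv.
have Gv v : v \in vs -> root G v.
  by move=> /vsP [AvB _]; rewrite /root GE AvB subrr.
have G0 : G != 0.
  apply: contra_eq_neq (GE 0) => ->; rewrite horner0 mul0r subr0 eq_sym.
  by apply/prodf_neq0 => i _; rewrite expr0n mulr0 addr0 oner_eq0.
(* The degree bound is reached, so [G] is a constant times the product of the ['X - v], which is
   separable. *)
have sG : size G = (size vs).+1.
  apply/eqP; rewrite eqn_leq {1}svs size_G /=.
  by apply: max_poly_roots => //; apply/allP.
have sepG : separable_poly G.
  have /all_roots_prod_XsubC -> // : all (root G) vs by apply/allP.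
    by rewrite (eqp_separable (eqp_scale _ _)) ?lead_coef_eq0 // separable_prod_XsubC.
  by rewrite uniq_rootsE.
exists chain_system; first exact: chain_nomial_system.
exists [seq x_ v | v <- vs]; split; last 1 first.
- move=> _ /mapP [v vvs ->]; have [AvB Pv] := vsP _ vvs.
  split=> [|j]; last by rewrite mxE.
  apply: chain_nondeg_root => //; first exact: xP.
  by move: sepG; rewrite separable_poly.unlock => /coprimep_root; apply; exact: Gv.
(* [v] is recovered from the coordinates as [A_ v / B_ v]. *)
- rewrite map_inj_in_uniq // => v v' vvs v'vs xE.
  have [AvB _] := vsP _ vvs; have [AvB' _] := vsP _ v'vs.
  have xE' (i : 'I_n) : 1 + c i * v ^+ 2 = 1 + c i * v' ^+ 2.
    by move/matrixP/(_ 0 i): xE; rewrite !mxE.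
  have BE : B_ v = B_ v' by apply: eq_bigr => i _; exact: xE'.
  have AE : A_ v = A_ v' by apply: eq_bigr => i _; exact: xE'.
  apply: (@mulIf _ (B_ v)); last by rewrite -AvB {1}AE AvB' BE.
  by apply/prodf_neq0 => i _; have := xP _ vvs i; rewrite mxE.
- by rewrite size_map.
Qed.

(** The powers of [e] absorbed by [chain_form] are divided out again through [P e^-1] and
    multiplicativity; the last hypothesis says that the values [v = w / e ^ j] are distinct. *)
Lemma chain_poly_attains (ws : nat -> K) : (forall y, P y -> y != 0) ->
  (forall x y, P x -> P y -> P (x * y)) -> P 1 -> P e^-1 ->
  (forall j, (j <= n)%N -> chain_poly n j e (ws j) = 0) ->
  (forall i j, (j <= n)%N -> P (chain_form j i e (ws j))) ->
  (forall i j, (i < j <= n)%N -> ws j <> e ^+ (j - i) * ws i) ->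
  attains P n 2 n.+1.
Proof.
move=> P0 PM P1 Pe ws0 wsP ws_inj.
pose v_ j := ws j / e ^+ j.
have vE j i : 1 + c i * v_ j ^+ 2 = chain_form j i e (ws j) / e ^+ (2 * (j - i) - 1).
  rewrite /v_ /c /chain_form expr_div_n -exprM; case: ltnP => ij.
    have -> : (j * 2 = (2 * i + 1) + (2 * (j - i) - 1))%N by lia.
    rewrite [e ^+ (_ + (_ - 1))]exprD; have := expf_neq0 (2 * (j - i) - 1) e_neq0.
    have := expf_neq0 (2 * i + 1) e_neq0.
    by move: (e ^+ (2 * i + 1)) (e ^+ (2 * (j - i) - 1)) => x y x0 y0; field; rewrite ?x0 ?y0.
  rewrite (_ : (2 * (j - i) - 1 = 0)%N) ?expr0 ?divr1; last by lia.
  have -> : (2 * i + 1 = (j * 2) + (2 * (i - j) + 1))%N by lia.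
  rewrite [e ^+ (_ + (_ + 1))]exprD; have := expf_neq0 (j * 2) e_neq0.
  by move: (e ^+ (j * 2)) (e ^+ (2 * (i - j) + 1)) => x y x0; field.
apply: (@chain_attains [seq v_ j | j <- iota 0 n.+1]) => //.
- rewrite map_inj_in_uniq ?iota_uniq // => i j.
  rewrite !mem_iota !add0n /= => i_n j_n vv.
  wlog: i j i_n j_n vv / (i <= j)%N => [W|].
    by case: (leqP i j) => [/W -> //|/ltnW /W <-].
  rewrite leq_eqVlt => /orP [/eqP // | ij]; exfalso.
  apply: (ws_inj i j); first by rewrite ij.
  move: vv; rewrite /v_ => /(congr1 (fun z => z * e ^+ j)); rewrite mulfVK ?expf_neq0 //.
  move=> <-; rewrite -{1}(subnK (ltnW ij)) exprD; have := expf_neq0 i e_neq0.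
  by move: (e ^+ i) (e ^+ (j - i)) => x y x0; field.
- by rewrite size_map size_iota.
move=> v /mapP [j]; rewrite mem_iota add0n /= ltnS => jn ->; split=> [|i].
  rewrite /A_ /B_; under eq_bigr => i _ do rewrite vE.
  under [in RHS]eq_bigr => i _ do rewrite vE.
  rewrite !prodf_div !prodrXr -/(index_enum _).
  have /eqP := ws0 _ jn; rewrite subr_eq0 => /eqP ->.
  rewrite (sum_parity_shift jn) exprD /v_; set N := (\sum_(i < n | odd i) _)%N.
  have := expf_neq0 N e_neq0; have := expf_neq0 j e_neq0.
  by move: (e ^+ N) (e ^+ j) => x y x0 y0; field; rewrite ?x0 ?y0.
rewrite vE; apply: (PM); first exact: wsP.
rewrite -exprVn; elim: (_ - _)%N => [|m IH]; first by rewrite expr0.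
by rewrite exprS; exact: PM.
Qed.

End ChainSystem.

(** * Hensel's lemma *)

Section Hensel.
Variables (A : comNzRingType) (pi : A).
Implicit Types (f h : {poly A}) (a x y : A).

(** The contraction principle for [y |-> pi * h(y)], for polynomials only. It needs no topology on
    [A], passes from [pi] to its multiples, and yields both inverses of [1 + pi * x] and Newton's
    method. *)
Definition henselian := forall h, exists y, y = pi * h.[y].

Lemma horner_sub_factor f x y : exists z, f.[x] - f.[y] = (x - y) * z.
Proof.
elim/poly_ind: f => [|f c [z E]]; first by exists 0; rewrite !horner0 mulr0 subrr.
exists (z * x + f.[y]); rewrite !hornerMXaddC mulrDr mulrA -E; ring.
Qed.

Lemma horner_taylor2 f a : exists q, forall h : A,
  f.[a + h] = f.[a] + f^`().[a] * h + h ^+ 2 * q.[h].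
Proof.
elim/poly_ind: f => [|f c [q E]].
  by exists 0 => h; rewrite deriv0 !horner0 mulr0 mul0r !addr0.
exists (q * ('X + a%:P) + f^`().[a]%:P) => h.
rewrite !hornerMXaddC E derivD derivC addr0 derivM derivX mulr1 !hornerE; ring.
Qed.

Hypothesis hensA : henselian.

Lemma henselian_inv x : exists y, (1 + pi * x) * y = 1.
Proof.
have [z zE] := hensA (- x *: (1 + 'X)).
exists (1 + z); rewrite !hornerE /= in zE.
by rewrite mulrDl mul1r [X in 1 + X + _]zE; ring.
Qed.

(** In the Taylor expansion at [a] with increment [f'(a) pi y], every term is a multiple of
    [f'(a) ^ 2 pi]. The cofactor is [c + y + pi y ^ 2 q], with [q] evaluated at the increment, and
    its vanishing is a fixed-point equation. *)
Lemma hensel f a c : f.[a] = f^`().[a] ^+ 2 * pi * c ->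
  exists y z, root f (a + f^`().[a] * pi * y)
    /\ f^`().[a + f^`().[a] * pi * y] = f^`().[a] * (1 + pi * z).
Proof.
set d := f^`().[a] => fa; have [q qE] := horner_taylor2 f a.
(* The unknown is [z = y + c], which is a multiple of [pi] as [henselian] requires. *)
have [z zE] := hensA (- ('X ^+ 2 * (q \Po ((d * pi) *: 'X))) \Po ('X - c%:P)).
pose y := z - c.
have yE : y = - c - pi * (y ^+ 2 * q.[d * pi * y]).
  by rewrite {1}/y zE !(horner_comp, hornerE) /= -/y; ring.
have [r rE] := horner_sub_factor f^`() (a + d * pi * y) a.
exists y, (y * r); split.
  rewrite /root qE -/d fa [X in _ + d * (d * pi * X)]yE; apply/eqP; ring.
by rewrite -(subrK d f^`().[_]) rE; ring.
Qed.

End Hensel.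

Section HenselianOfComplete.
Variables (A : comNzRingType) (pi : A).

Definition dvdpi n (x : A) := exists y, x = pi ^+ n * y.

Hypothesis separated : forall x, (forall n, dvdpi n x) -> x = 0.
Hypothesis complete : forall s : nat -> A,
  (forall n, dvdpi n (s n.+1 - s n)) -> exists l, forall n, dvdpi n (l - s n).

(** The iterates of 0 gain one power of [pi] per step; their limit is a fixed point modulo every
    [pi ^ n]. *)
Lemma henselian_complete : henselian pi.
Proof.
move=> h; pose s n := iter n (fun y => pi * h.[y]) 0.
have sP n : dvdpi n (s n.+1 - s n).
  elim: n => [|n [y yE]]; first by exists (s 1%N - s 0%N); rewrite expr0 mul1r.
  have [z zE] := horner_sub_factor h (s n.+1) (s n).
  exists (y * z); rewrite -[s n.+2]/(pi * h.[s n.+1]) -[X in _ - X]/(pi * h.[s n]).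
  by rewrite -mulrBr zE yE exprS; ring.
have [l lP] := complete sP; exists l.
apply: subr0_eq; apply: separated => n.
have [y yE] := lP n; have [y' yE'] := lP n.+1.
have [z zE] := horner_sub_factor h l (s n).
exists (pi * y' - pi * (y * z)).
rewrite -(subrK (s n.+1) l) yE' -addrA -[X in _ + (X - _)]/(pi * h.[s n]).
rewrite -yE' subrK; move/(canRL (subrK _)): zE => ->.
by rewrite yE yE' exprS; ring.
Qed.

End HenselianOfComplete.

(** * Hensel's lemma and units in the p-adic integers *)

Section PadicHensel.
Variables (p : nat) (p_pr : prime p).
Local Notation Zp := (padic_int p_pr).
Implicit Types x y : Zp.

Lemma pdig_nat m n : (m%:R : Zp) n = (m %% p ^ n)%N.
Proof.
elim: m => [|m IH]; first by rewrite mulr0n.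
rewrite mulrS -[pdig _ n]/((pone p_pr n + (m%:R : Zp) n) %% p ^ n)%N IH /=.
by rewrite modnDml modnDmr add1n.
Qed.

Lemma pdig_mul x y n : (x * y) n = (x n * y n %% p ^ n)%N.
Proof. by []. Qed.

Lemma pdig_add x y n : (x + y) n = ((x n + y n) %% p ^ n)%N.
Proof. by []. Qed.

Lemma padic_dvdP n x : dvdpi p%:R n x <-> x n = 0%N.
Proof.
split=> [[y ->]|xn0].
  by rewrite pdig_mul -natrX pdig_nat modnn mul0n mod0n.
have dvd m : (p ^ n %| x (n + m))%N by rewrite /dvdn pdig_le ?leq_addr // xn0.
(* These are the digits of the quotient: [x] modulo [p ^ (n + m)], divided by [p ^ n]. *)
have sP m : (x (n + m.+1) %/ p ^ n = x (n + m) %/ p ^ n %[mod p ^ m])%N.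
  rewrite addnS (divn_eq (x (n + m).+1) (p ^ (n + m))) -pdigP.
  rewrite expnD [(p ^ n * p ^ m)%N]mulnC mulnA divnMDl ?expn_gt0 ?prime_gt0 //.
  by rewrite modnMDl.
exists (mk_padic p_pr sP); apply: padic_int_eq => k.
rewrite pdig_mul -natrX pdig_nat /= modnMm mulnC divnK //.
by rewrite pdig_le ?leq_addl.
Qed.

Lemma padic_dvd_subP n x y : dvdpi p%:R n (x - y) <-> x n = y n.
Proof.
split=> [[z zE]|xy].
  rewrite -(subrK y x) zE pdig_add.
  have /padic_dvdP -> : dvdpi p%:R n (p%:R ^+ n * z : Zp) by exists z.
  by rewrite add0n pdig_mod.
apply/padic_dvdP; rewrite pdig_add xy -pdig_add.
by rewrite subrr /= mod0n.
Qed.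

Lemma padic_henselian : henselian (p%:R : Zp).
Proof.
apply: henselian_complete => [x xP|s sP].
  by apply: padic_int_eq => n; rewrite (padic_dvdP n x).1 // /pdig /= mod0n.
have lP n : (s n.+1 n.+1 = s n n %[mod p ^ n])%N.
  by have /padic_dvd_subP E := sP n; rewrite -pdigP E pdig_mod.
exists (mk_padic p_pr lP) => n; apply/padic_dvd_subP => /=.
by rewrite pdig_mod.
Qed.

Lemma padic_p_neq0 : p%:R != 0 :> Zp.
Proof.
apply/eqP => /(congr1 (fun x : Zp => x 2%N)); rewrite pdig_nat /= mod0n modn_small.
  by move=> p0; move: p_pr; rewrite p0.
by rewrite -{1}(expn1 p) ltn_exp2l // prime_gt1.
Qed.

Lemma padic_p_nonunit y : p%:R * y != 1.
Proof.
apply/eqP => /(congr1 (fun x : Zp => x 1%N)).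
rewrite pdig_mul pdig_nat expn1 modnn mul0n mod0n /= expn1 modn_small //.
exact: prime_gt1.
Qed.

(** If the residue of [x] is nonzero, Bezout gives [m] with [1 + m x] divisible by [p]; then [- m x]
    lies in [1 + p Z_p], which consists of units. *)
Lemma padic_unit_dvd x : (exists y, x * y = 1) \/ exists y, x = p%:R * y.
Proof.
have [x1|x1] := eqVneq (x 1%N) 0%N.
  by right; have /padic_dvdP [y ->] := x1; exists y; rewrite expr1.
left; have co : coprime (x 1%N) p.
  rewrite coprime_sym prime_coprime // gtnNdvd ?lt0n //.
  by rewrite -pdig_mod expn1 ltn_mod prime_gt0.
have [m _ dm] := Bezoutl (x 1%N) (prime_gt0 p_pr).
have /padic_dvdP [z zE] : (1 + m%:R * x) 1%N = 0%N.
  rewrite pdig_add pdig_mul pdig_nat /= expn1 modnMml modnDml modnDmr.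
  by apply/eqP; move: dm; rewrite gcdnC (eqP co).
have [y yE] := henselian_inv padic_henselian (- z).
exists (- m%:R * y); rewrite -[RHS]yE mulrA; congr (_ * _).
rewrite expr1 in zE.
by rewrite [X in 1 + X]mulrN -zE; ring.
Qed.

Lemma padic_valuation x : x != 0 ->
  exists n u v, x = p%:R ^+ n * u /\ u * v = 1.
Proof.
move=> x0; have [n nP] : exists n, ~ dvdpi p%:R n x.
  apply: contrapT => /forallNP dvd; case/eqP: x0; apply: padic_int_eq => n.
  have /padic_dvdP -> : dvdpi p%:R n x by apply: contrapT; exact: dvd.
  by rewrite /= mod0n.
have : exists n, `[< ~ dvdpi p%:R n x >] by exists n; apply/asboolP.
move=> /ex_minnP [[|m] /asboolP Nm min_m]; first by case: Nm; exists x; rewrite mul1r.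
have [y xE] : dvdpi p%:R m x.
  by apply: contrapT => /asboolP /min_m; rewrite ltnn.
exists m, y; have [[v yv]|[z yE]] := padic_unit_dvd y; first by exists v.
by case: Nm; exists z; rewrite xE yE exprSr mulrA.
Qed.

End PadicHensel.

(** * Hensel's lemma for formal power series *)

Section PowerSeriesHensel.
Variable F : fieldType.
Local Notation PS := (power_series F).
Implicit Types s t : PS.

Definition psX n : PS := PowerSeries (fun m => (m == n)%:R).

Lemma psXM n s m : (psX n * s : PS) m = if (n <= m)%N then s (m - n)%N else 0.
Proof.
rewrite -[LHS]/(\sum_(i < m.+1) (i == n :> nat)%:R * s (m - i)%N).
case: leqP => nm.
  have nm' : (n < m.+1)%N by [].
  rewrite (bigD1 (Ordinal nm')) //= eqxx mul1r big1 ?addr0 // => i.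
  by rewrite -val_eqE /= => /negbTE ->; rewrite mul0r.
rewrite big1 // => i _; case: eqP => [im|_]; last by rewrite mul0r.
by have := ltn_ord i; rewrite im ltnS leqNgt nm.
Qed.

Lemma psX_exp n : psX 1 ^+ n = psX n.
Proof.
elim: n => [|n IH]; first by rewrite expr0; exact: power_series_eq.
rewrite exprS IH; apply: power_series_eq => m; rewrite psXM /=.
by case: m => [|m] //=; rewrite subn1 eqSS.
Qed.

Lemma ps_dvdP n s : dvdpi (psX 1) n s <-> forall m, (m < n)%N -> s m = 0.
Proof.
split=> [[t ->] m mn|s0]; first by rewrite psX_exp psXM leqNgt mn.
exists (PowerSeries (fun m => s (m + n)%N)).
apply: power_series_eq => m; rewrite psX_exp psXM /=; case: leqP => [nm|/s0 //].
by rewrite subnK.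
Qed.

Lemma ps_henselian : henselian (psX 1).
Proof.
apply: henselian_complete => [s sP|s sP].
  by apply: power_series_eq => n; rewrite (ps_dvdP n.+1 s).1.
(* Coefficient [m] no longer changes from term [m + 1] of the sequence on. *)
exists (PowerSeries (fun m => s m.+1 m)) => n; apply/ps_dvdP => m mn.
rewrite -[LHS]/(s m.+1 m - s n m); elim: n mn => // n IH.
rewrite ltnS leq_eqVlt => /orP [/eqP ->|mn]; first exact: subrr.
have /ps_dvdP /(_ m mn) := sP n; rewrite -[LHS]/(s n.+1 m - s n m) => /subr0_eq ->.
exact: IH.
Qed.

Lemma psX_nonunit s : psX 1 * s != 1.
Proof.
apply/eqP => /(congr1 (fun t : PS => t 0%N)); rewrite psXM /= => /esym /eqP.
by rewrite oner_eq0.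
Qed.

Lemma ps_split s : s = PowerSeries (fun n => if n == 0%N then s 0%N else 0)
  + psX 1 * PowerSeries (fun n => s n.+1).
Proof.
apply: power_series_eq => n.
rewrite -[RHS]/((if n == 0%N then s 0%N else 0)
  + (psX 1 * PowerSeries (fun n => s n.+1) : PS) n) psXM.
by case: n => [|n] /=; rewrite ?addr0 // add0r subn1.
Qed.

End PowerSeriesHensel.

(** * The chain system over a Henselian ring *)

Section HenselChain.
Variables (A : comNzRingType) (pi : A) (K : fieldType) (iota : {rmorphism A -> K}).
Variables (P : set K) (e : A) (n : nat).
Hypotheses (hensA : henselian pi) (pi_nonunit : forall y, pi * y != 1).
Hypotheses (iota_inj : injective iota) (P0 : forall y, P y -> y != 0).
Hypotheses (PM : forall x y, P x -> P y -> P (x * y)).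
Hypotheses (P1 : forall a, P (iota (1 + pi * a))) (Pe : P (iota e)^-1).
Hypotheses (e_pi : exists e', e = pi * e') (n_gt0 : (0 < n)%N).

Lemma hensel_chain_root j : (j <= n)%N ->
  exists y, chain_poly n j e (1 + pi * y) = 0.
Proof.
move=> jn; have [e' eE] := e_pi.
pose H := chain_poly n j e%:P 'X.
have [s sE] := chain_poly_mod e%:P 'X jn.
(* The derivative at 1 is a sign modulo [e], so its square is 1 modulo [pi] and can be inverted.
   This brings [H.[1]], a multiple of [pi], to the shape that [hensel] asks for. *)
have [u uE] : exists u, H^`().[1] ^+ 2 = 1 + pi * u.
  have -> : H^`().[1] = (-1) ^+ j.+1 + e * s^`().[1].
    have sgE : (-1) ^+ j = ((-1) ^+ j)%:P :> {poly A} by rewrite rmorph_sign.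
    rewrite /H sE sgE !mul_polyC derivD !derivZ derivM derivB -polyC1 derivC derivX.
    rewrite !hornerE /= subrr expr1n exprS; ring.
  exists (e' * s^`().[1] * (2%:R * (-1) ^+ j.+1 + e * s^`().[1])).
  by rewrite sqrrD -exprM mulnC exprM sqrrN expr1n expr1n eE; ring.
have [v vE] := henselian_inv hensA u.
have [|y [z [/eqP r _]]] := @hensel _ pi hensA H 1 (v * (e' * s.[1])).
  have H1 : H.[1] = e * s.[1] by rewrite /H sE !hornerE /= subrr; ring.
  by rewrite uE mulrACA vE mul1r H1 eE; ring.
exists (H^`().[1] * y); rewrite mulrCA mulrA.
by rewrite -horner_chain_poly.
Qed.

Lemma hensel_chain_attains : attains P n 2 n.+1.
Proof.
have [e' eE] := e_pi.
have e0 : iota e != 0 by rewrite -invr_eq0; exact: P0.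
pose ws j := if pselect (j <= n)%N is left jn
  then 1 + pi * sval (cid (hensel_chain_root jn)) else 1.
have wsE j : exists y, ws j = 1 + pi * y.
  rewrite /ws; case: pselect => [jn|_]; last by exists 0; rewrite mulr0 addr0.
  by case: cid => y /= _; exists y.
have ws0 j : (j <= n)%N -> chain_poly n j e (ws j) = 0.
  by rewrite /ws; case: pselect => // jn _; case: cid.
have P_1 : P 1 by rewrite -(rmorph1 iota) -[1]addr0 -(mulr0 pi).
apply: (@chain_poly_attains K P n (iota e) n_gt0 e0 (fun j => iota (ws j))) => //.
- by move=> j jn; rewrite -rmorph_chain_poly ws0 // rmorph0.
- move=> i j jn; rewrite -rmorph_chain_form.
  suff [y ->] : exists y, chain_form j i e (ws j) = 1 + pi * y by [].
  have [y ->] := wsE j; rewrite /chain_form eE; case: ltnP => ij.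
    exists (y *+ 2 + pi * y ^+ 2 + e' * (pi * e') ^+ (2 * (j - i) - 2)).
    have -> : (2 * (j - i) - 1 = (2 * (j - i) - 2).+1)%N by lia.
    by rewrite [(pi * e') ^+ _.+1]exprS; ring.
  exists (e' * (pi * e') ^+ (2 * (i - j)) * (1 + pi * y) ^+ 2).
  by rewrite addn1 [(pi * e') ^+ _.+1]exprS; ring.
(* A coincidence would make [1 + pi * y] a multiple of [e], hence of [pi], and [pi] a unit. *)
- move=> i j /andP [ij jn]; rewrite -rmorphXn -rmorphM => /iota_inj.
  have [y ->] := wsE j; rewrite -(subnSK ij) exprS eE => E.
  have := pi_nonunit (e' * (pi * e') ^+ (j - i.+1) * ws i - y).
  by rewrite mulrBr !mulrA -E addrK eqxx.
Qed.

End HenselChain.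

(** * Non-Archimedean phases *)

Section NonArchPhase.
Variables (L : fieldType) (O : set L) (rho : L).
Hypotheses (O1 : O 1) (OB : forall x y, O x -> O y -> O (x - y)).
Hypotheses (OM : forall x y, O x -> O y -> O (x * y)).
Hypotheses (rhoP : uniformizer O rho) (M_neq0 : exists2 x, max_ideal O x & x != 0).

Lemma O_0 : O 0. Proof. by rewrite -(subrr 1); exact: OB. Qed.
Lemma O_N x : O x -> O (- x).
Proof. by move=> Ox; rewrite -sub0r; apply: OB => //; exact: O_0. Qed.
Lemma O_D x y : O x -> O y -> O (x + y).
Proof. by move=> Ox Oy; rewrite -[y]opprK; apply: OB => //; exact: O_N. Qed.
Lemma O_X x n : O x -> O (x ^+ n).
Proof. by move=> Ox; elim: n => [|n IH]; rewrite ?expr0 // exprS; exact: OM. Qed.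

Lemma max_idealP x : max_ideal O x <-> exists2 a, O a & x = rho * a.
Proof.
rewrite rhoP; split=> [[a Oa <-]|[a Oa ->]]; first by exists a.
by exists a.
Qed.

Lemma rho_neq0 : rho != 0.
Proof.
have [x /max_idealP [a _ ->]] := M_neq0.
by apply: contraNneq => ->; rewrite mul0r.
Qed.

Lemma O_rho : O rho.
Proof. by have [] : max_ideal O rho by apply/max_idealP; exists 1; rewrite ?mulr1. Qed.

Lemma rho_nonunit a : O a -> rho * a <> 1.
Proof.
move=> Oa E; have [_] : max_ideal O 1 by apply/max_idealP; exists a.
by apply; split; rewrite ?oner_eq0 ?invr1.
Qed.

Lemma int_unitP x : O x -> int_unit O x \/ exists2 a, O a & x = rho * a.
Proof.
move=> Ox; case: (pselect (int_unit O x)) => [|Nx]; first by left.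
by right; apply/max_idealP.
Qed.

Lemma int_unit1D a : O a -> int_unit O (1 + rho * a).
Proof.
move=> Oa; have /int_unitP [] // : O (1 + rho * a).
  by apply: O_D => //; apply: OM => //; exact: O_rho.
move=> [b Ob /(canRL (addrK _))]; rewrite -mulrBr => /esym E.
by case: (@rho_nonunit (b - a)) => //; exact: OB.
Qed.

Lemma int_unitM x y : int_unit O x -> int_unit O y -> int_unit O (x * y).
Proof.
move=> [Ox x0 Ox'] [Oy y0 Oy']; split; first exact: OM.
- by rewrite mulf_neq0.
- by rewrite invfM; exact: OM.
Qed.

Lemma int_unitV x : int_unit O x -> int_unit O x^-1.
Proof. by move=> [Ox x0 Ox']; split; rewrite ?invr_eq0 ?invrK. Qed.

Lemma int_unit_rho (m : int) : int_unit O (rho ^ m) -> m = 0.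
Proof.
have pos n : ~ int_unit O (rho ^+ n.+1).
  move=> [_ _ Oi]; apply: (@rho_nonunit (rho ^+ n / rho ^+ n.+1)).
    by apply: OM => //; apply: O_X; exact: O_rho.
  by rewrite mulrA -exprS divff // expf_neq0 // rho_neq0.
case: m => [[|n]|n] // U; first by case: (pos n).
by case: (pos n); rewrite -[rho ^+ _]invrK; exact: int_unitV.
Qed.

Lemma ordE (m : int) u : int_unit O u -> ord O rho (rho ^ m * u) = m.
Proof.
move=> Uu; have rm k : rho ^ k != 0 by rewrite expfz_neq0 // rho_neq0.
rewrite /ord; case: xgetP => [k _ /= Uk|/(_ m)]; last first.
  by case; rewrite /= mulrAC divff // mul1r.
have : int_unit O (rho ^ (m - k)).
  have -> : rho ^ (m - k) = rho ^ m * u / rho ^ k * u^-1.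
    rewrite mulrAC mulfK; last by case: Uu.
    by rewrite expfzDr ?rho_neq0 // -invr_expz.
  by apply: int_unitM => //; exact: int_unitV.
by move/int_unit_rho/eqP; rewrite subr_eq0 => /eqP.
Qed.

(** The forward direction holds whether [ord] is attained or takes its default value, so no
    valuation on [L] has to be constructed. Later phase computations go through this normal form. *)
Lemma nonarch_phase1P y : nonarch_phase1 O rho y <->
  exists (m : int) a, O a /\ y = rho ^ m * (1 + rho * a).
Proof.
have rm k : rho ^ k != 0 by rewrite expfz_neq0 // rho_neq0.
split=> [[y0 /max_idealP [a Oa E]]|[m [a [Oa ->]]]].
  by exists (ord O rho y), a; split; rewrite // -E addrC subrK mulrC divfK.
have [Ou u0 _] := int_unit1D Oa; split; first by rewrite mulf_neq0.
rewrite ordE; last exact: int_unit1D.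
rewrite mulrAC divff // mul1r addrC addKr; apply/max_idealP.
by exists a.
Qed.

Lemma nonarch_phase1_neq0 y : nonarch_phase1 O rho y -> y != 0.
Proof. by case. Qed.

Lemma nonarch_phase1M x y :
  nonarch_phase1 O rho x -> nonarch_phase1 O rho y -> nonarch_phase1 O rho (x * y).
Proof.
move=> /nonarch_phase1P [m [a [Oa ->]]] /nonarch_phase1P [k [b [Ob ->]]].
apply/nonarch_phase1P; exists (m + k), (a + b + rho * (a * b)); split.
  by apply: O_D; [exact: O_D | apply: OM; [exact: O_rho | exact: OM]].
by rewrite expfzDr ?rho_neq0 //; ring.
Qed.

Lemma nonarch_phase1V x : nonarch_phase1 O rho x -> nonarch_phase1 O rho x^-1.
Proof.
move=> /nonarch_phase1P [m [a [Oa ->]]]; apply/nonarch_phase1P.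
have [_ u0 Oi] := int_unit1D Oa.
exists (- m), (- a / (1 + rho * a)); split; first by apply: OM => //; exact: O_N.
by rewrite invfM invr_expz; congr (_ * _); field.
Qed.

Lemma nonarch_phase1_1D a : max_ideal O a -> nonarch_phase1 O rho (1 + a).
Proof.
move=> /max_idealP [b Ob ->]; apply/nonarch_phase1P; exists 0, b.
by rewrite expr0z mul1r.
Qed.

Lemma nonarch_phase1_rho (m : int) : nonarch_phase1 O rho (rho ^ m).
Proof.
by apply/nonarch_phase1P; exists m, 0; rewrite mulr0 addr0 mulr1; split=> //; exact: O_0.
Qed.

Lemma nonarch_phase1X x n : nonarch_phase1 O rho x -> nonarch_phase1 O rho (x ^+ n).
Proof.
move=> Px; elim: n => [|n IH]; first exact: (nonarch_phase1_rho 0).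
by rewrite exprS; exact: nonarch_phase1M.
Qed.

End NonArchPhase.

(** * Integers and phases in finite extensions of Q_p *)

Section PadicPhase.
Variables (p : nat) (p_pr : prime p) (L : fieldExtType (padic_num p_pr)).
Local Notation Zp := (padic_int p_pr).
Local Notation O := (@padic_integers p p_pr L).

Definition padic_iota (a : Zp) : L := (tofrac a)%:A.
HB.instance Definition _ :=
  GRing.RMorphism.copy padic_iota (in_alg L \o @tofrac Zp).

Lemma padic_iota_inj : injective padic_iota.
Proof.
move=> x y E; apply/eqP; rewrite -tofrac_eq; apply/eqP.
exact: (fmorph_inj (in_alg L)) E.
Qed.

Lemma padic_integersE x : O x = integralOver padic_iota x.
Proof. by []. Qed.

Lemma padic_O1 : O 1.
Proof. by have := @integral_id _ _ padic_iota 1; rewrite rmorph1. Qed.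
Lemma padic_OB x y : O x -> O y -> O (x - y).
Proof. by rewrite !padic_integersE; exact: integral_sub. Qed.
Lemma padic_OM x y : O x -> O y -> O (x * y).
Proof. by rewrite !padic_integersE; exact: integral_mul. Qed.
Lemma padic_O_iota a : O (padic_iota a).
Proof. exact: integral_id. Qed.

(** If [1 / p] were integral, its monic equation of degree [d], multiplied by [p ^ d], would read
    [1 + p y = 0] in Z_p. *)
Lemma padic_p_max : max_ideal O p%:R.
Proof.
have Op : O p%:R by rewrite -(rmorph_nat padic_iota); exact: padic_O_iota.
split=> // -[_ p0]; rewrite padic_integersE => -[q mq]; rewrite /root => /eqP.
rewrite horner_coef size_map_poly_id0; last first.
  by rewrite (monicP mq) rmorph1 oner_eq0.
have := monic_neq0 mq; rewrite -size_poly_gt0; set d := (size q).-1 => sq.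
have sqE : size q = d.+1 by rewrite prednK.
rewrite sqE big_ord_recr /= coef_map /=.
have -> : q`_d = 1 by move/monicP: mq.
rewrite rmorph1 mul1r => /(congr1 (fun z => z * p%:R ^+ d)).
rewrite mul0r mulrDl exprVn mulVf ?expf_neq0 // mulr_suml.
pose y : Zp := \sum_(i < d) q`_i * p%:R ^+ (d.-1 - i).
rewrite (_ : \sum_(i < d) _ = padic_iota (p%:R * y)).
  rewrite -(rmorph1 padic_iota) -rmorphD -(rmorph0 padic_iota) => /padic_iota_inj.
  move/eqP; rewrite addr_eq0 => /eqP E.
  by have := padic_p_nonunit (- y); rewrite mulrN E opprK eqxx.
rewrite rmorphM rmorph_sum mulr_sumr; apply: eq_bigr => i _.
rewrite coef_map rmorphM rmorphXn !rmorph_nat mulrCA -mulrA; congr (_ * _).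
have -> : p%:R ^+ d = p%:R ^+ i * p%:R ^+ (d.-1 - i).+1 :> L.
  by rewrite -exprD; congr (_ ^+ _); have := ltn_ord i; lia.
by rewrite -exprS exprVn mulKf ?expf_neq0.
Qed.

Lemma padic_M_neq0 : exists2 x, max_ideal O x & x != 0.
Proof.
exists p%:R; first exact: padic_p_max.
rewrite -(rmorph_nat padic_iota) -(rmorph0 padic_iota).
by apply: contra_neq (padic_p_neq0 p_pr) => /padic_iota_inj.
Qed.

(* Z_p[x] / p Z_p[x] is finite, since x is a root of a monic polynomial. *)
Lemma padic_pow_cong x : O x ->
  exists i j w, [/\ (i < j)%N, O w & x ^+ i - x ^+ j = p%:R * w].
Proof.
move=> Ox; have := Ox; rewrite padic_integersE => -[q mq qx].
pose r i : {poly Zp} := Pdiv.Ring.rmodp 'X^i q.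
have xr i : x ^+ i = (map_poly padic_iota (r i)).[x].
  have /(congr1 (fun f => (map_poly padic_iota f).[x])) := Pdiv.RingMonic.rdivp_eq mq 'X^i.
  rewrite rmorphXn /= map_polyX hornerXn => ->.
  rewrite rmorphD rmorphM /= hornerD hornerM.
  by move/rootP: qx => ->; rewrite mulr0 add0r.
have sr i : (size (r i) <= size q)%N.
  by apply/ltnW; rewrite Pdiv.Ring.ltn_rmodp monic_neq0.
have p_gt0 := prime_gt0 p_pr.
pose sig i : {ffun 'I_(size q) -> 'I_p.-1.+1} := 
    [ffun k : 'I_(size q) => inord (pdig ((r i)`_k)%R 1)].
have sig_cong i j : sig i = sig j -> exists2 w, O w & x ^+ i - x ^+ j = p%:R * w.
  move=> /ffunP sE.
  have dE (k : 'I_(size q)) : exists z, (r i)`_k - (r j)`_k = p%:R * z.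
    have lt1 (y : Zp) : (y 1%N < p.-1.+1)%N.
      by rewrite prednK // -[X in (_ < X)%N]expn1 -pdig_mod ltn_mod expn1.
    have := sE k; rewrite !ffunE => /(congr1 val) /=; rewrite !inordK //.
    by move/padic_dvd_subP => [z ->]; exists z; rewrite expr1.
  rewrite !xr !(@horner_coef_wide _ (size q)) ?(leq_trans (size_poly _ _)) //.
  rewrite -sumrB; elim/big_ind: _ => [|_ _ [w Ow ->] [w' Ow' ->]|k _].
  - by exists 0; rewrite ?mulr0 //; exact: O_0 padic_O1 padic_OB.
  - exists (w + w'); rewrite ?mulrDr //.
    exact: (O_D padic_O1 padic_OB).
  - have [z zE] := dE k; exists (padic_iota z * x ^+ k).
      apply: padic_OM; first exact: padic_O_iota.
      exact: (O_X padic_O1 padic_OM).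
    by rewrite !coef_map -mulrBl -rmorphB zE rmorphM rmorph_nat mulrA.
have : ~~ injectiveb (fun i : 'I_(#|{ffun 'I_(size q) -> 'I_p.-1.+1}|.+1) => sig i).
  apply/negP => /injectiveP /leq_card; rewrite card_ord ltnn //.
move=> /injectivePn [i [j ij /sig_cong [w Ow E]]].
move: ij; rewrite neq_ltn => /orP [ij|ji].
  by exists i, j, w.
exists j, i, (- w); split => //; first exact: (O_N padic_O1 padic_OB).
by rewrite mulrN -E opprB.
Qed.

Variable rho : L.
Hypothesis rhoP : uniformizer O rho.
Local Notation P := (nonarch_phase1 O rho).

Let O1 := padic_O1.
Let OB := @padic_OB.
Let OM := @padic_OM.
Let M0 := padic_M_neq0.

(** Write [p = rho ^ e * u] with [u] a unit. Two powers of [u] agree modulo [p], so some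
    [u ^ (l - k)] is 1 modulo [p], and [p ^ (l - k)] is a power of [rho] times an element of
    [1 + rho O]. *)
Lemma padic_phase1_pow : exists2 N, (0 < N)%N & P (p%:R ^+ N).
Proof.
have rho0 := rho_neq0 rhoP M0; have Orho := O_rho O1 rhoP.
have [a0 Oa0 pE] := (max_idealP rhoP p%:R).1 padic_p_max.
(* Two powers of [rho] agree modulo [p], and their difference is [rho ^ i] times a unit, so [p]
   divides [rho ^ i]. This bounds the exponents [e] with [rho ^ e] dividing [p]; the largest one
   leaves a unit cofactor. *)
have [i [w Ow rE]] : exists i, exists2 w, O w & rho ^+ i = p%:R * w.
  have [i [j [w [ij Ow E]]]] := padic_pow_cong Orho.
  have Oij : O (- rho ^+ (j - i.+1)).
    by apply: (O_N O1 OB); exact: (O_X O1 OM).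
  have [_ u0 Oi] := int_unit1D O1 OB OM rhoP Oij.
  exists i, (w / (1 + rho * - rho ^+ (j - i.+1))); first exact: OM.
  rewrite mulrA -E; apply: (canRL (mulfK u0)).
  by rewrite mulrDr mulr1 mulrN -exprS mulrN -exprD subnSK // subnKC // ltnW.
have bound e : (exists2 a, O a & p%:R = rho ^+ e * a) -> (e <= i)%N.
  move=> [a Oa E]; rewrite leqNgt; apply/negP => ie.
  apply: (@rho_nonunit L O rho O1 rhoP (rho ^+ (e - i.+1) * (a * w))).
    by apply: OM; [exact: (O_X O1 OM) | exact: OM].
  apply: (mulfI (expf_neq0 i rho0)); rewrite mulr1 {2}rE E.
  by rewrite -[in RHS](subnKC (ltnW ie)) exprD -(subnSK ie) exprS; ring.
have ex0 : exists e, `[< exists2 a, O a & p%:R = rho ^+ e * a >].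
  by exists 0%N; apply/asboolP; exists p%:R; rewrite ?mul1r //; case: padic_p_max.
have bound' e : `[< exists2 a, O a & p%:R = rho ^+ e * a >] -> (e <= i)%N.
  by move/asboolP; exact: bound.
case: (ex_maxnP ex0 bound') => e /asboolP [u Ou uE] max_e.
have Uu : int_unit O u.
  have [//|[b Ob ub]] := int_unitP rhoP Ou.
  have /max_e : `[< exists2 a, O a & p%:R = rho ^+ e.+1 * a >].
    by apply/asboolP; exists b => //; rewrite uE ub exprSr mulrA.
  by rewrite ltnn.
have [k [l [z [kl Oz E]]]] := padic_pow_cong Ou.
exists (l - k)%N; first by rewrite subn_gt0.
apply/(nonarch_phase1P O1 OB OM rhoP M0).
exists (e * (l - k))%:Z, (- (a0 * z / u ^+ k)).
have [_ u0 Ou'] := Uu; split.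
  apply: (O_N O1 OB); apply: OM; first exact: OM.
  by rewrite -exprVn; exact: (O_X O1 OM).
rewrite uE exprMn -exprM; congr (_ * _).
have uk0 : u ^+ k != 0 by rewrite expf_neq0.
apply: (mulfI uk0); rewrite -exprD subnKC ?(ltnW kl) //.
have -> : u ^+ l = u ^+ k - rho * a0 * z by rewrite -pE -E opprB addrC subrK.
by field.
Qed.

Lemma padic_phase1_1D a : P (padic_iota (1 + p%:R * a)).
Proof.
rewrite rmorphD rmorph1; apply: (nonarch_phase1_1D O1 OB OM rhoP M0).
have [b Ob pE] := (max_idealP rhoP p%:R).1 padic_p_max.
rewrite rmorphM rmorph_nat; apply/(max_idealP rhoP).
exists (b * padic_iota a); first by apply: OM => //; exact: padic_O_iota.
by rewrite mulrA -pE.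
Qed.

Lemma padic_attains_chain n : (0 < n)%N -> attains P n 2 n.+1.
Proof.
move=> n0; have [[//|N] _ PN] := padic_phase1_pow.
apply: (@hensel_chain_attains _ p%:R L padic_iota P (p%:R ^+ N.+1)) => //.
- exact: padic_henselian.
- exact: padic_p_nonunit.
- exact: padic_iota_inj.
- exact: nonarch_phase1_neq0.
- exact: (nonarch_phase1M O1 OB OM rhoP M0).
- exact: padic_phase1_1D.
- rewrite rmorphXn rmorph_nat; exact: (nonarch_phase1V O1 OB OM rhoP M0).
- by exists (p%:R ^+ N); rewrite exprS.
Qed.

End PadicPhase.

(** * Integers and phases in Laurent series fields *)

Section LaurentPhase.
Variables (F : fieldType).
Local Notation PS := (power_series F).
Local Notation L := (laurent_series F).
Local Notation O := (@laurent_integers F).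

Definition laurent_iota (a : PS) : L := tofrac a.
HB.instance Definition _ := GRing.RMorphism.copy laurent_iota (@tofrac PS).

Lemma laurent_iota_inj : injective laurent_iota.
Proof. by move=> x y /eqP; rewrite tofrac_eq => /eqP. Qed.

Lemma laurent_O_iota a : O (laurent_iota a).
Proof. by exists a. Qed.
Lemma laurent_O1 : O 1.
Proof. by exists 1 => //; rewrite tofrac1. Qed.
Lemma laurent_OB x y : O x -> O y -> O (x - y).
Proof. by move=> [a _ <-] [b _ <-]; exists (a - b); rewrite ?rmorphB. Qed.
Lemma laurent_OM x y : O x -> O y -> O (x * y).
Proof. by move=> [a _ <-] [b _ <-]; exists (a * b); rewrite ?rmorphM. Qed.

Lemma laurent_t_neq0 : laurent_iota (psX F 1) != 0.
Proof.
rewrite -(rmorph0 laurent_iota); apply/eqP => /laurent_iota_inj.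
move/(congr1 (fun t : PS => t 1%N)) => /= /eqP; by rewrite oner_eq0.
Qed.

Lemma laurent_t_max : max_ideal O (laurent_iota (psX F 1)).
Proof.
split; first exact: laurent_O_iota.
move=> [_ t0 [s _ sE]]; have := psX_nonunit s; case/eqP.
apply: laurent_iota_inj; rewrite rmorphM rmorph1.
by rewrite -[X in _ * X]/(tofrac s) sE divff.
Qed.

Lemma laurent_M_neq0 : exists2 x, max_ideal O x & x != 0.
Proof. by exists (laurent_iota (psX F 1)); [exact: laurent_t_max | exact: laurent_t_neq0]. Qed.

Variable rho : L.
Hypothesis rhoP : uniformizer O rho.
Local Notation P := (nonarch_phase1 O rho).

Let O1 := laurent_O1.
Let OB := @laurent_OB.
Let OM := @laurent_OM.
Let M0 := laurent_M_neq0.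

(** A series with nonzero constant term is invertible in F[[t]], which a uniformizer is not. *)
Lemma laurent_rhoE : exists r, rho = laurent_iota (psX F 1 * r).
Proof.
have [r _ rE] := O_rho O1 rhoP; rewrite -rE.
have [r0|r0] := eqVneq (r 0%N) 0.
  have /ps_dvdP [s sE] : forall m, (m < 1)%N -> r m = 0 by case.
  by exists s; rewrite sE expr1.
pose cst (c : F) : PS := PowerSeries (fun n => if n == 0%N then c else 0).
have cstM c s : cst c * s = PowerSeries (fun n => c * s n).
  apply: power_series_eq => n.
  rewrite -[LHS]/(\sum_(i < n.+1) (if i == 0%N :> nat then c else 0) * s (n - i)%N).
  by rewrite big_ord_recl /= subn0 big1 ?addr0 // => i _; rewrite mul0r.
have [y yE] := henselian_inv (@ps_henselian F)
  (cst (r 0%N)^-1 * PowerSeries (fun n => r n.+1)).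
case: (@rho_nonunit L O rho O1 rhoP (laurent_iota (cst (r 0%N)^-1 * y))).
  exact: laurent_O_iota.
rewrite -rE -[tofrac r]/(laurent_iota r) -rmorphM -(rmorph1 laurent_iota).
congr laurent_iota; rewrite -[RHS]yE mulrA; congr (_ * _).
rewrite {1}(ps_split r) -/(cst _) mulrDl; congr (_ + _); last first.
  by rewrite -mulrA [_ * cst _]mulrC.
rewrite cstM; apply: power_series_eq => n /=.
by case: (n == 0%N); rewrite ?mulr0 // mulfV.
Qed.

Lemma laurent_attains_chain n : (0 < n)%N -> attains P n 2 n.+1.
Proof.
move=> n0; have [r rE] := laurent_rhoE.
(* [rho] itself serves as [e]: it always has phase 1, whereas [t] may have another phase. *)
apply: (@hensel_chain_attains _ (psX F 1) L laurent_iota P (psX F 1 * r)) => //.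
- exact: ps_henselian.
- exact: psX_nonunit.
- exact: laurent_iota_inj.
- exact: nonarch_phase1_neq0.
- exact: (nonarch_phase1M O1 OB OM rhoP M0).
- move=> a; rewrite rmorphD rmorph1; apply: (nonarch_phase1_1D O1 OB OM rhoP M0).
  have /(max_idealP rhoP) [b Ob tE] := laurent_t_max.
  rewrite rmorphM /= tE; apply/(max_idealP rhoP).
  exists (b * laurent_iota a); last by rewrite mulrA.
  by apply: OM => //; exact: laurent_O_iota.
- by rewrite /= -rE -exprN1; exact: (nonarch_phase1_rho O1 OB OM rhoP M0 (-1)).
- by exists r.
Qed.

End LaurentPhase.

(** * Sparse polynomials over p-adic fields *)

(** Finitely many roots against infinitely many powers of [e]: a parameter can be taken small and
    generic at once. *)
Lemma pow_nonroot (A : idomainType) (e : A) (Q : {poly A}) N0 :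
  injective (fun n => e ^+ n) -> Q != 0 -> exists2 N, (N0 <= N)%N & Q.[e ^+ N] != 0.
Proof.
move=> e_inj Q0; apply: contrapT => H.
have : (size Q < size Q)%N; last by rewrite ltnn.
rewrite -{1}[size Q](size_iota N0) -(size_map (fun n => e ^+ n)).
apply: max_poly_roots => //; last by rewrite map_inj_uniq ?iota_uniq.
apply/allP => x /mapP [n]; rewrite mem_iota => /andP [n_ge _] ->.
by apply: contrapT => /negP nr; apply: H; exists n.
Qed.

Lemma henselianM (A : comNzRingType) (pi a : A) : henselian pi -> henselian (pi * a).
Proof.
by move=> H h; have [y yE] := H (a *: h); exists y; rewrite {1}yE hornerZ mulrA.
Qed.

Section PadicSparse.
Variables (A : idomainType) (p : nat).
Local Notation P := (p%:R).
Hypotheses (p_gt0 : (0 < p)%N) (hensA : henselian (P : A)).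
Hypotheses (P_nonunit : forall y : A, P * y != 1).
Hypotheses (natr_inj : injective (fun n => n%:R : A)).
Hypotheses (natr_dense : forall (x : A) n, exists m : nat, dvdpi (P : A) n (m%:R - x)).
Hypotheses (valuation : forall x : A, x != 0 ->
  exists n u v, x = P ^+ n * u /\ u * v = 1).
Implicit Types (f : {poly A}) (x y z r T : A).

Lemma padic_P_neq0 : P != 0 :> A.
Proof.
by apply: contraTneq p_gt0 => p0; rewrite (natr_inj (p0 : p%:R = 0%:R :> A)).
Qed.

Lemma padic_1D_neq0 z : 1 + P * z != 0.
Proof.
apply/eqP => E; have := P_nonunit (- z); rewrite mulrN -subr_eq0.
by rewrite -opprD addrC E oppr0 eqxx.
Qed.

Lemma padic_inv_1D z : exists y, (1 + P * z) * y = 1.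
Proof. exact: henselian_inv. Qed.

Lemma padic_dvd_pow x : x != 0 -> exists n y, x * y = P ^+ n.
Proof.
move=> /valuation [n [u [v [-> uv]]]]; exists n, v.
by rewrite -mulrA uv mulr1.
Qed.

Lemma padic_dvd_pow_seq (xs : seq A) : {in xs, forall x, x != 0} ->
  exists n, {in xs, forall x, exists y, x * y = P ^+ n}.
Proof.
elim: xs => [|x xs IH] xs0; first by exists 0%N.
have [n nP] : exists n, {in xs, forall x, exists y, x * y = P ^+ n}.
  by apply: IH => z zxs; apply: xs0; rewrite inE zxs orbT.
have [m [y yE]] : exists m y, x * y = P ^+ m.
  by apply: padic_dvd_pow; apply: xs0; rewrite mem_head.
exists (m + n)%N => z; rewrite inE => /orP [/eqP ->|/nP [w wE]].
  by exists (y * P ^+ n); rewrite mulrA yE exprD.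
by exists (w * P ^+ m); rewrite mulrA wE -exprD addnC.
Qed.

(* T is a root by construction.  Its derivative there is proportional to [l]
   below; when [l] is tiny but nonzero, a second root splits off from T. *)
Definition twin_poly f T D : {poly A} := 'X^D * f - (T ^+ D * f.[T])%:P.

(** With [x = T (1 + w)] the polynomial becomes a constant times [g(w) = w G(w)], where
    [G(0) = g'(0) = l] and [2 G'(0) = g''(0)]; Hensel's lemma for [G] at 0 gives the second root.
    [E] is [f(T) ^ 2] times the second derivative of [log f] under [x d/dx], and
    [f(T) g''(0) = E + l (l - f(T))]. The quantified [k] stands for [G'(0)], described through its
    double because 2 need not be invertible. *)
Lemma twin_roots f T D : (0 < D)%N -> T != 0 ->
  let l := D%:R * f.[T] + T * f^`().[T] in
  let E := f.[T] * (T * f^`().[T] + T ^+ 2 * f^`()^`().[T]) - (T * f^`().[T]) ^+ 2 in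
  l != 0 ->
  (forall k, 2%:R * k * f.[T] = E + l * (l - f.[T]) ->
     k != 0 /\ exists c, l = k ^+ 2 * P ^+ 3 * c) ->
  exists2 w, w != 0 & (exists y, w = P ^+ 3 * y) /\
    forall x, (x == T) || (x == T * (1 + w)) ->
      root (twin_poly f T D) x /\ (twin_poly f T D)^`().[x] != 0.
Proof.
case: D => // d _ T0 l E l0 kP; set D := d.+1 in l l0 kP *.
pose t : {poly A} := T *: (1 + 'X).
pose g := (1 + 'X) ^+ D * (f \Po t) - f.[T]%:P.
have tE w : t.[w] = T * (1 + w) by rewrite !hornerE.
have FE : twin_poly f T D \Po t = (T ^+ D) *: g.
  rewrite /twin_poly comp_polyB comp_polyM comp_polyC comp_Xn_poly.
  by rewrite {1}/t exprZn /g scalerBr -scalerAl polyCM -[X in _ = _ - X]mul_polyC.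
have td : t^`() = T%:P by rewrite /t derivZ derivD derivC derivX add0r alg_polyC.
have Fx w : (twin_poly f T D).[T * (1 + w)] = T ^+ D * g.[w].
  by rewrite -tE -horner_comp FE hornerZ.
have F'x w : (twin_poly f T D)^`().[T * (1 + w)] * T = T ^+ D * g^`().[w].
  rewrite -hornerZ -derivZ -FE deriv_comp td hornerM hornerC horner_comp.
  by rewrite tE.
have t0 : t.[0] = T by rewrite tE addr0 mulr1.
have X10 n : ((1 + 'X : {poly A}) ^+ n).[0] = 1.
  by rewrite horner_exp !hornerE expr1n.
have /factor_theorem [G GE] : root g 0.
  by rewrite /root /g hornerD hornerN hornerC hornerM X10 horner_comp t0 mul1r subrr.
rewrite subr0 in GE.
have X1 n : ((1 + 'X : {poly A}) ^+ n)^`() = (1 + 'X) ^+ n.-1 *+ n.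
  by rewrite deriv_exp derivD derivC derivX add0r mul1r.
have g'E : g^`() = (1 + 'X) ^+ d *+ D * (f \Po t)
    + (1 + 'X) ^+ D * ((f^`() \Po t) * T%:P).
  by rewrite /g derivB derivC subr0 derivM deriv_comp td X1.
have g'0 : g^`().[0] = l.
  rewrite g'E hornerD !hornerM hornerMn !X10 !horner_comp hornerC t0 /l; ring.
have g''0 : g^`()^`().[0] * f.[T] = E + l * (l - f.[T]).
  rewrite g'E derivD !derivM derivMn !X1 !deriv_comp td derivC mulr0 addr0.
  rewrite !hornerD !hornerM !hornerMn !X10 !horner_comp !hornerC t0 /l /E /D /=.
  ring.
have G0 : G.[0] = l by rewrite -g'0 GE derivM derivX !hornerE.
have [k0 [c lE]] : G^`().[0] != 0 /\ exists c, l = G^`().[0] ^+ 2 * P ^+ 3 * c.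
  apply: kP; rewrite -g''0 GE !(derivM, derivD, derivX, derivC) !hornerE /=; ring.
have hensP3 : henselian (P ^+ 3 : A).
  by rewrite exprS; apply: henselianM; exact: hensA.
have [|y [z []]] := @hensel _ _ hensP3 G 0 c; first by rewrite G0.
set w := 0 + _ => Gw G'w.
have w0 : w != 0.
  by apply: contraTneq Gw => ->; rewrite /root G0.
exists w => //; split; first by exists (G^`().[0] * y); rewrite /w; ring.
have FP v : g.[v] = 0 -> g^`().[v] != 0 ->
    root (twin_poly f T D) (T * (1 + v)) /\ (twin_poly f T D)^`().[T * (1 + v)] != 0.
  move=> gv g'v; split; first by rewrite /root Fx gv mulr0.
  apply: contra_neq g'v => F'0; apply: (mulfI (expf_neq0 D T0)).
  by rewrite mulr0 -F'x F'0 mul0r.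
move=> x /orP [/eqP ->|/eqP ->].
  have := FP 0; rewrite addr0 mulr1; apply; last by rewrite g'0.
  by rewrite GE !hornerE.
apply: FP; first by rewrite GE hornerM (rootP Gw) mul0r.
rewrite GE derivM derivX !hornerE /= (rootP Gw) addr0 G'w !mulf_neq0 //.
by rewrite exprS -mulrA padic_1D_neq0.
Qed.

Variable N : nat.
Hypothesis N_gt0 : (0 < N)%N.
Let eps : A := P ^+ N.

(* The exponents 2 * j and 3 make these elements squares when p = 2. *)
Definition good x := exists j z, x = eps ^+ (2 * j) * (1 + P ^+ 3 * z).

(** One more term for every two more roots. The nonzero constant coefficient is carried along
    because it fixes the valuation of [f(T)] for tiny [T]. *)
Definition sparse_roots k f (s : seq nat) (rs : seq A) :=
  [/\ sparse f s, size s = k.+2, f`_0 != 0, uniq rs & size rs = (2 * k + 1)%N] /\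
  {in rs, forall r, [/\ root f r, f^`().[r] != 0 & good r]}.

Lemma exprP_inj : injective (fun n => P ^+ n : A).
Proof.
move=> m n; wlog: m n / (m <= n)%N => [W mn|].
  by case: (leqP m n) => [/W -> //|/ltnW /W <-].
rewrite leq_eqVlt => /orP [/eqP //|mn E]; exfalso.
have := P_nonunit (P ^+ (n - m.+1)); rewrite -exprS subnSK //.
rewrite -(inj_eq (mulfI (expf_neq0 m padic_P_neq0))) -exprD subnKC ?(ltnW mn) //.
by rewrite mulr1 E eqxx.
Qed.

Lemma sparse_roots0 : exists f s rs, sparse_roots 0 f s rs.
Proof.
exists ('X - 1%:P), [:: 0%N; 1%N], [:: 1]; split; first split => //.
- split=> // i; rewrite coefB coefX coefC !inE.
  by case: i => [|[|i]] /=; rewrite ?sub0r ?oppr_eq0 ?subr0 ?oner_eq0 ?eqxx.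
- by rewrite coefB coefX coefC sub0r oppr_eq0 oner_eq0.
move=> r; rewrite inE => /eqP ->; split; first by rewrite root_XsubC.
  by rewrite derivXsubC hornerC oner_eq0.
by exists 0%N, 0; rewrite mulr0 addr0 mulr1.
Qed.

(** This is the [E] of [twin_roots] as a polynomial in [T]; at a simple root [r] it equals
    [- (r f'(r)) ^ 2]. *)
Lemma twin_nondeg_poly_neq0 f r : r != 0 -> root f r -> f^`().[r] != 0 ->
  f * ('X * f^`() + 'X^2 * f^`()^`()) - ('X * f^`()) ^+ 2 != 0.
Proof.
move=> r0 /rootP fr f'r; apply/eqP => /(congr1 (fun q => q.[r])).
rewrite !hornerE fr mul0r sub0r => /eqP; rewrite oppr_eq0 expf_eq0 mulf_eq0.
by rewrite (negbTE r0) (negbTE f'r).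
Qed.

Lemma sparse_twin_poly f s T D : sparse f s -> (0 < D)%N -> T ^+ D * f.[T] != 0 ->
  sparse (twin_poly f T D) (0%N :: [seq (D + i)%N | i <- s]).
Proof.
move=> [us fs] D0 c0; split.
  rewrite /= map_inj_uniq ?us ?andbT; last exact: addnI.
  by apply/mapP => -[i _]; lia.
move=> i; rewrite /twin_poly coefB coefXnM coefC inE.
case: i => [|i] /=; first by rewrite D0 sub0r oppr_eq0 c0.
rewrite subr0; case: ltnP => iD.
  by rewrite eqxx; apply/esym/negbTE/mapP => -[m _]; lia.
rewrite fs -{2}(subnKC iD) mem_map //; exact: addnI.
Qed.

(** [T] is fixed before [D]. The congruence on [D] serves the two new roots, and its size serves the
    old ones, which must move by less than their mutual distances. *)
Lemma sparse_rootsS k f s rs : sparse_roots k f s rs ->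
  exists f' s' rs', sparse_roots k.+1 f' s' rs'.
Proof.
move=> [[sf ss f0 urs srs] rsP].
have P0 := padic_P_neq0.
have eps0 : eps != 0 by rewrite expf_neq0.
have good0 r : good r -> r != 0.
  by move=> [j [z ->]]; rewrite mulf_neq0 ?expf_neq0 // exprS -mulrA padic_1D_neq0.
pose Ep := f * ('X * f^`() + 'X^2 * f^`()^`()) - ('X * f^`()) ^+ 2.
have Ep0 : Ep != 0.
  have [r rrs] : exists r, r \in rs by exists rs`_0; rewrite mem_nth // srs addn1.
  by have [fr f'r gr] := rsP _ rrs; apply: twin_nondeg_poly_neq0 (good0 _ gr) fr f'r.
have [v [u [u' [f0E uu']]]] := valuation f0.
(* Since [2 j < S <= t] below, [T] is a multiple of [eps * r ^ 2] for every known root [r]. *)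
have [S SP] : exists S, {in rs, forall r, exists j z,
    (2 * j < S)%N /\ r = eps ^+ (2 * j) * (1 + P ^+ 3 * z)}.
  have : {in rs, forall r, good r} by move=> r /rsP [].
  elim: (rs) => [|r l IH] gl; first by exists 0%N.
  have [S SP] : exists S, {in l, forall r, exists j z,
      (2 * j < S)%N /\ r = eps ^+ (2 * j) * (1 + P ^+ 3 * z)}.
    by apply: IH => x xl; apply: gl; rewrite inE xl orbT.
  have [j [z rE]] := gl _ (mem_head _ _).
  exists (S + (2 * j).+1)%N => x; rewrite inE => /orP [/eqP ->|/SP [j' [z' [lt xE]]]].
    by exists j, z; split; rewrite ?leq_addl.
  by exists j', z'; split; rewrite // ltn_addr.
have [t tS Et] : exists2 t, (S + v.+1 <= t)%N & Ep.[(eps ^+ 2) ^+ t] != 0.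
  apply: pow_nonroot => // m n; rewrite -!exprM => /exprP_inj /eqP.
  by rewrite !eqn_pmul2l // => /eqP.
set T := (eps ^+ 2) ^+ t in Et.
have T0 : T != 0 by rewrite !expf_neq0.
have [T' TE] : exists T', T = P ^+ v * (P * T').
  exists (P ^+ (N * 2 * t - v.+1)); rewrite /T /eps -!exprM -exprS -exprD.
  congr (_ ^+ _); have : (v.+1 <= N * 2 * t)%N; last by clear; lia.
  rewrite (leq_trans _ (leq_pmull _ _)) ?muln_gt0 ?N_gt0 //.
  by rewrite (leq_trans _ tS) // leq_addl.
have [q0 q0E] := horner_sub_factor f T 0.
(* [T] is divisible by [p ^ (v + 1)], so [f(T)] has the valuation [v] of [f(0)], and [theta], the
   exact value of [- T f'(T) / f(T)], lies in [A]. *)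
have [U [U' [fTU UU']]] : exists U U', f.[T] = P ^+ v * U /\ U * U' = 1.
  move: q0E; rewrite subr0 horner_coef0 f0E => /(canRL (subrK _)) fTE.
  have [y yE] := padic_inv_1D (u' * T' * q0).
  exists (u + P * T' * q0), (u' * y); split; first by rewrite fTE TE; ring.
  rewrite mulrA (_ : (u + P * T' * q0) * u' = 1 + P * (u' * T' * q0)) //.
  by rewrite mulrDl uu'; ring.
have fT0 : f.[T] != 0.
  by rewrite fTU mulf_neq0 ?expf_neq0 //; apply: contra_eq_neq UU' => ->;
    rewrite mul0r eq_sym oner_eq0.
pose theta := - (U' * P * T' * f^`().[T]).
have thetaE : T * f^`().[T] = - f.[T] * theta.
  rewrite fTU {1}TE /theta.
  by transitivity (P ^+ v * (U * U') * P * T' * f^`().[T]); [rewrite UU' |]; ring.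
have [c [W [W' [EE WW']]]] := valuation Et.
have [B BP] : exists B, {in [seq f^`().[r] | r <- rs]
     ++ [seq r - r' | r <- rs, r' <- rem r rs], forall x, exists y, x * y = P ^+ B}.
  apply: padic_dvd_pow_seq => x; rewrite mem_cat => /orP [/mapP [r rrs ->]|].
    by have [] := rsP _ rrs.
  case/allpairsPdep => r [r' [rrs]]; rewrite mem_rem_uniq // inE => /andP [r'r _] ->.
  by rewrite subr_eq0 eq_sym.
(* [c] is the valuation of [E]. Agreement to order [c + 1] keeps [c] as the valuation of [2 k f(T)],
   so [k] divides [p ^ c]; order [2 c + 3] then makes [l] a multiple of [k ^ 2 p ^ 3]. The value
   [2 c + 4] covers both. *)
pose M := (2 * c + 4)%N.
have [D [DB Dtheta lD]] : exists D, [/\ (3 * B + 10 <= D)%N, dvdpi P M (D%:R - theta)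
    & D%:R != theta].
  have [D0 [y0 yE0]] := natr_dense theta M.
  have dv m : dvdpi P M ((D0 + p ^ M * m)%N%:R - theta).
    by exists (y0 + m%:R); rewrite natrD natrM natrX addrAC yE0; ring.
  have pM m : (m <= p ^ M * m)%N by rewrite leq_pmull // expn_gt0 p_gt0.
  pose m0 := (3 * B + 10)%N.
  (* [D = theta] would give [l = 0] and make [T] a multiple root; the next candidate in the same
     residue class avoids it. *)
  have [E1|?] := eqVneq ((D0 + p ^ M * m0)%N%:R : A) theta; last first.
    by exists (D0 + p ^ M * m0)%N; split=> //; rewrite (leq_trans (pM m0)) ?leq_addl.
  exists (D0 + p ^ M * m0.+1)%N; split=> //.
    by rewrite (leq_trans (leqnSn _)) // (leq_trans (pM m0.+1)) ?leq_addl.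
  rewrite -E1; apply/eqP => /natr_inj /eqP; rewrite eqn_add2l eqn_pmul2l.
    by rewrite eqn_leq ltnn.
  by rewrite expn_gt0 p_gt0.
have D_gt0 : (0 < D)%N by rewrite (leq_trans _ DB) // addn_gt0 orbT.
have [w w0 [[w' wE] FP]] : exists2 w, w != 0 & (exists y, w = P ^+ 3 * y) /\
    forall x, (x == T) || (x == T * (1 + w)) ->
      root (twin_poly f T D) x /\ (twin_poly f T D)^`().[x] != 0.
  have [z zE] := Dtheta.
  have lE : D%:R * f.[T] + T * f^`().[T] = f.[T] * (D%:R - theta).
    by rewrite thetaE; ring.
  apply: twin_roots => //; rewrite lE; first by rewrite mulf_neq0 // subr_eq0.
  move=> kap kapE.
  pose Q := f.[T] * (D%:R - theta) - f.[T].
  have [y yE] := padic_inv_1D (W' * P ^+ (c + 3) * (f.[T] * z * Q)).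
  have kk' : kap * (2%:R * f.[T] * W' * y) = P ^+ c.
    have -> : kap * (2%:R * f.[T] * W' * y) = 2%:R * kap * f.[T] * W' * y by ring.
    have -> : 2%:R * kap * f.[T] = P ^+ c * W + f.[T] * (D%:R - theta) * Q.
      rewrite kapE -EE /Ep /Q !(hornerE, hornerXn) /=; ring.
    have -> : (P ^+ c * W + f.[T] * (D%:R - theta) * Q) * W'
        = P ^+ c * (W * W' + P * (W' * P ^+ (c + 3) * (f.[T] * z * Q))).
      rewrite zE /M (_ : (2 * c + 4 = c + (c + 3).+1)%N); last by clear; lia.
      by rewrite [P ^+ (c + _.+1)]exprD [P ^+ _.+1]exprS; ring.
    by rewrite WW' -[LHS]mulrA yE mulr1.
  split.
    by apply: contra_eq_neq kk' => ->; rewrite mul0r eq_sym expf_neq0.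
  exists ((2%:R * f.[T] * W' * y) ^+ 2 * P * f.[T] * z).
  rewrite zE /M (_ : (2 * c + 4 = c + c + 3 + 1)%N); last by clear; lia.
  by rewrite !exprD -kk' expr1; ring.
pose F := twin_poly f T D.
have hensB : henselian (P ^+ B.+3 : A) by rewrite exprS; apply: henselianM.
(* At an old root, [F(r) = - T ^ D f(T)] and [F'(r) = r ^ D f'(r)]. As [T] is a multiple of
   [eps r ^ 2] and [D] is large, [T ^ D] is a multiple of [F'(r) ^ 2 p ^ (B + 3)], so Hensel
   applies. Roots move by multiples of [p ^ (B + 1)] while their differences divide [p ^ B], so they
   stay distinct. *)
have /choice [h hP] : forall r, exists r', r \in rs ->
    [/\ root F r', F^`().[r'] != 0, exists y, r' - r = P ^+ B.+1 * y &
      exists j z, (j < t)%N /\ r' = eps ^+ (2 * j) * (1 + P ^+ 3 * z)].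
  move=> r.
  case: (boolP (r \in rs)) => [rrs|]; last by exists 0.
  have [fr f'r _] := rsP _ rrs; have [j [z [jS rE]]] := SP _ rrs.
  have F'E : F^`().[r] = r ^+ D * f^`().[r].
    rewrite /F /twin_poly derivB derivC subr0 derivM hornerD !hornerM hornerXn.
    by rewrite (rootP fr) mulr0 add0r.
  have [y yE] : exists y, f^`().[r] * y = P ^+ B.
    by apply: BP; rewrite mem_cat map_f.
  have [v1 v1E] := padic_inv_1D (P ^+ 2 * z).
  have jt : (4 * j + 1 <= 2 * t)%N by move: jS tS; clear; lia.
  have TD : T ^+ D = r ^+ D ^+ 2 * (v1 ^+ D ^+ 2 * P ^+ (3 * B + 3)
      * P ^+ (N * (2 * t - 4 * j) * D - (3 * B + 3))).
    have E1 : T ^+ D = eps ^+ (4 * j) ^+ D * P ^+ (N * (2 * t - 4 * j) * D).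
      have -> : T = eps ^+ (4 * j) * eps ^+ (2 * t - 4 * j).
        by rewrite /T -exprM -exprD; congr (_ ^+ _); move: jt; clear; lia.
      by rewrite exprMn /eps -!exprM.
    have E2 : P ^+ (N * (2 * t - 4 * j) * D)
        = P ^+ (3 * B + 3) * P ^+ (N * (2 * t - 4 * j) * D - (3 * B + 3)) :> A.
      rewrite -exprD subnKC // (leq_trans _ (leq_pmull _ _)) //.
        by move: DB; clear; lia.
      by rewrite muln_gt0 N_gt0; move: jt; clear; lia.
    have rv1 : r * v1 = eps ^+ (2 * j).
      by rewrite rE -mulrA [P ^+ 3]exprS -(mulrA P) v1E mulr1.
    have E3 : eps ^+ (4 * j) ^+ D = r ^+ D ^+ 2 * v1 ^+ D ^+ 2.
      by rewrite -!exprMn rv1 -!exprM; congr (_ ^+ _); clear; lia.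
    by rewrite E1 E2 E3 !mulrA.
  have [] := @hensel _ _ hensB F r (- (y ^+ 2 * v1 ^+ D ^+ 2
      * P ^+ (N * (2 * t - 4 * j) * D - (3 * B + 3)) * f.[T])).
    rewrite F'E /F /twin_poly hornerD hornerN hornerC hornerM (rootP fr) mulr0 add0r.
    rewrite TD (_ : (3 * B + 3 = B + B + B.+3)%N) ?exprD -?yE; last by clear; lia.
    by ring.
  move=> y1 [z1 [rF F'r]]; exists (r + F^`().[r] * P ^+ B.+3 * y1) => _; split => //.
  - rewrite F'r mulf_neq0 //; last by rewrite exprS -mulrA padic_1D_neq0.
    by rewrite F'E mulf_neq0 // expf_neq0 // good0 //; exists j, z.
  - by exists (F^`().[r] * P ^+ 2 * y1); rewrite addrC addKr !exprS; ring.
  exists j, (z + (1 + P ^+ 3 * z) * (r ^+ D.-1 * f^`().[r] * P ^+ B * y1)).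
  split; first by move: jS tS; clear; lia.
  rewrite F'E -{1}(prednK D_gt0) exprS {1 2}rE !exprS; ring.
exists F, (0%N :: [seq (D + i)%N | i <- s]), ([:: T; T * (1 + w)] ++ map h rs).
have cF : T ^+ D * f.[T] != 0 by rewrite mulf_neq0 ?expf_neq0.
have TE2 : T = eps ^+ (2 * t) by rewrite /T -exprM.
split; last first.
  move=> x; rewrite mem_cat => /orP [|/mapP [r /hP [rF F'r _ [j [z [_ hE]]]] ->]].
    rewrite !inE => xT; have [? ?] := FP _ xT; split => //.
    case/orP: xT => /eqP ->; first by exists t, 0; rewrite mulr0 addr0 mulr1.
    by exists t, w'; rewrite TE2 wE.
  by split=> //; exists j, z.
(* Moved roots keep their exponent [j < t], so they stay apart from both new roots. *)
have hT r x : r \in rs -> h r <> T * (1 + P * x).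
  move=> /hP [_ _ _ [j [z [jt ->]]]]; rewrite TE2.
  rewrite -(subnKC (ltnW jt)) mulnDr exprD -mulrA.
  move/(mulfI (expf_neq0 _ eps0)) => /(canRL (addrK _)) E.
  have := P_nonunit (P ^+ (2 * N * (t - j) - 1) * (1 + P * x) - P ^+ 2 * z).
  rewrite mulrBr mulrA -!exprS subn1 prednK ?muln_gt0 ?N_gt0 ?subn_gt0 //.
  have -> : P ^+ (2 * N * (t - j)) = eps ^+ (2 * (t - j)).
    by rewrite /eps -exprM mulnA [(N * 2)%N]mulnC.
  by rewrite mulrA -exprS -E eqxx.
split=> //.
- exact: sparse_twin_poly.
- by rewrite /= size_map ss.
- by rewrite /F /twin_poly coefB coefXnM D_gt0 coefC sub0r oppr_eq0.
- rewrite /= !inE negb_or -andbA; apply/and4P; split.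
  + by rewrite -{1}[T]mulr1 (inj_eq (mulfI T0)) -subr_eq0 opprD addNKr oppr_eq0.
  + by apply/mapP => -[r /hT Nr E]; apply: (Nr 0); rewrite mulr0 addr0 mulr1.
  + apply/mapP => -[r /hT Nr E]; apply: (Nr (P ^+ 2 * w')).
    by rewrite -E wE mulrA -exprS.
  + rewrite map_inj_in_uniq // => r r' rrs r'rs hE; apply: contrapT => /eqP rr'.
    have [y yE] : exists y, (r - r') * y = P ^+ B.
      apply: BP; rewrite mem_cat; apply/orP; right; apply/allpairsPdep.
      by exists r, r'; rewrite mem_rem_uniq // inE eq_sym rr' r'rs.
    have [_ _ [y1 E1] _] := hP _ rrs; have [_ _ [y2 E2] _] := hP _ r'rs.
    have := P_nonunit ((y2 - y1) * y).
    rewrite -(inj_eq (mulfI (expf_neq0 B P0))) mulr1 -{2}yE.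
    case/eqP; have -> : r - r' = (h r' - r') - (h r - r) by rewrite hE; ring.
    by rewrite E1 E2 exprSr; ring.
- by rewrite size_cat size_map srs /=; clear; lia.
Qed.

Lemma sparse_roots_exists k : exists f s rs, sparse_roots k f s rs.
Proof.
elim: k => [|k [f [s [rs /sparse_rootsS //]]]].
exact: sparse_roots0.
Qed.

End PadicSparse.

(** Multiplication by [X - e ^ N] adds one term and one root, provided that [N] lets no coefficient
    vanish. *)
Lemma full_support_poly (A : idomainType) (e : A) k :
  e != 0 -> injective (fun n => e ^+ n) ->
  exists (f : {poly A}) (ts : seq nat),
    [/\ sparse f (iota 0 k.+1), uniq ts, size ts = k &
      {in ts, forall t, root f (e ^+ t) /\ f^`().[e ^+ t] != 0}].
Proof.
move=> e0 e_inj; elim: k => [|k [f [ts [[_ fs] uts sts tsP]]]].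
  exists 1, [::]; split=> //; split=> // i; rewrite coef1 inE.
  by case: i => [|i]; rewrite /= ?oner_eq0 ?eqxx.
have fk i : (i <= k)%N -> f`_i != 0 by move=> ik; rewrite fs mem_iota add0n ltnS ik.
have fk0 i : (k < i)%N -> f`_i = 0.
  move=> ki; apply/eqP; apply: contraTT ki.
  by rewrite fs mem_iota add0n ltnS -leqNgt.
(* The inner coefficients of [f * ('X - x)] are [f_i - f_(i+1) x]; a nonroot of [Q] keeps them
   nonzero and is a new root. *)
pose Q := f * \prod_(i < k) ((f`_i)%:P - f`_i.+1 *: 'X).
have Q0 : Q != 0.
  rewrite mulf_neq0 //; first by apply: contraTneq (fk 0%N isT) => ->; rewrite coef0 eqxx.
  apply/prodf_neq0 => i _; apply/eqP => /polyP /(_ 1%N) /eqP.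
  rewrite coefB coefC coefZ coefX coef0 /= mulr1 sub0r oppr_eq0.
  by rewrite (negbTE (fk _ (ltn_ord i))).
have [N _] := pow_nonroot 0 e_inj Q0.
rewrite hornerM mulf_eq0 negb_or horner_prod => /andP [fN /prodf_neq0 QN].
have Ntsx t : t \in ts -> e ^+ t - e ^+ N != 0.
  move=> /tsP [ft _]; rewrite subr_eq0; by apply: contraNneq fN => <-.
exists (f * ('X - (e ^+ N)%:P)), (N :: ts); split.
- split=> [|i]; first exact: iota_uniq.
  rewrite mulrBr coefB coefMX coefMC mem_iota add0n /=.
  case: i => [|i] /=; first by rewrite sub0r oppr_eq0 mulf_neq0 ?fk ?expf_neq0.
  rewrite !ltnS; case: (ltngtP i k) => ik.
  + have := QN (Ordinal ik) isT; rewrite !hornerE /=; exact.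
  + by rewrite !fk0 ?mul0r ?subrr ?eqxx // ltnW.
  + by rewrite (fk0 i.+1) ?mul0r ?subr0 ?ik ?fk // ltnS.
- rewrite /= uts andbT; apply/negP => /Ntsx.
  by rewrite subrr eqxx.
- by rewrite /= sts.
move=> t; rewrite inE => /orP [/eqP ->|tts].
  split; first by rewrite rootM root_XsubC eqxx orbT.
  by rewrite derivM derivXsubC !hornerE subrr mulr0 add0r.
have [ft f't] := tsP _ tts; split; first by rewrite rootM ft.
rewrite derivM derivXsubC !hornerE (rootP ft) addr0 mulf_neq0 //.
exact: Ntsx.
Qed.

Lemma sparse_map (A : nzRingType) (K : fieldType) (iota : {rmorphism A -> K})
    (f : {poly A}) s :
  injective iota -> sparse f s -> sparse (map_poly iota f) s.
Proof.
move=> iota_inj [us fs]; split=> // i; rewrite coef_map -(fs i) -(rmorph0 iota).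
by rewrite (inj_eq iota_inj).
Qed.

Lemma sparse_comp_square (K : fieldType) (f : {poly K}) s :
  sparse f s -> sparse (f \Po 'X^2) [seq (2 * i)%N | i <- s].
Proof.
move=> [us fs]; split.
  by rewrite map_inj_uniq // => i j /eqP; rewrite eqn_pmul2l // => /eqP.
move=> i; rewrite coef_comp_poly_Xn //; case: ifP => [d|nd].
  rewrite -{2}(divnK d) mulnC mem_map; first exact: fs.
  by move=> m n /eqP; rewrite eqn_pmul2l // => /eqP.
rewrite eqxx; apply/esym/negP => /mapP [j _ E].
by rewrite E dvdn_mulr in nd.
Qed.

(** [f(X ^ 2)] has as many terms as [f], and a root [q ^ 2] of [f] gives the two roots [q] and
    [- q]. *)
Lemma attains_square (K : fieldType) (P : set K) (f : {poly K}) s k (qs : seq K) :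
  (forall y, P y -> y != 0) -> 2%:R != 0 :> K ->
  sparse f s -> size s = k.+1 -> uniq qs -> {in qs &, injective (fun q => q ^+ 2)} ->
  {in qs, forall q, [/\ root f (q ^+ 2), f^`().[q ^+ 2] != 0, P q & P (- q)]} ->
  attains P 1 k (2 * size qs).
Proof.
move=> P0 two0 fs ss uqs sq_inj qsP.
have -> : (2 * size qs = size (qs ++ [seq - q | q <- qs]))%N.
  by rewrite size_cat size_map mul2n addnn.
have qneq0 q : q \in qs -> q != 0 by move=> /qsP [_ _ /P0].
apply: (attains_poly P0 (sparse_comp_square fs)).
- by rewrite size_map.
- rewrite cat_uniq uqs map_inj_uniq ?uqs ?andbT; last exact: oppr_inj.
  apply/hasPn => _ /mapP [q qqs ->]; apply/negP => Nq.
  have : - q = q.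
    by apply: sq_inj => //; rewrite sqrrN.
  move/eqP; rewrite eq_sym -subr_eq0 opprK -mulr2n -mulr_natl mulf_eq0.
  by rewrite (negbTE two0) (negbTE (qneq0 _ qqs)).
move=> x; rewrite mem_cat => xq.
have [q qqs [xE Px]] : exists2 q, q \in qs & (x = q \/ x = - q) /\ P x.
  case/orP: xq => [xqs|/mapP [q qqs ->]].
    by exists x => //; have [] := qsP _ xqs; split=> //; left.
  by exists q => //; have [] := qsP _ qqs; split=> //; right.
have x2 : x ^+ 2 = q ^+ 2 by case: xE => ->; rewrite ?sqrrN.
have [fq f'q _ _] := qsP _ qqs; split => //.
  by rewrite /root horner_comp hornerXn x2 (rootP fq).
rewrite deriv_comp hornerM horner_comp hornerXn x2 derivXn hornerMn hornerXn /= expr1.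
by rewrite mulf_neq0 // -mulr_natl mulf_neq0 // P0.
Qed.

Section PadicUnivariate.
Variables (p : nat) (p_pr : prime p) (L : fieldExtType (padic_num p_pr)).
Variable rho : L.
Local Notation Zp := (padic_int p_pr).
Local Notation O := (@padic_integers p p_pr L).
Local Notation iota := (@padic_iota p p_pr L).
Hypothesis rhoP : uniformizer O rho.
Local Notation P := (nonarch_phase1 O rho).

Let PM := nonarch_phase1M (padic_O1 L) (@padic_OB _ _ L) (@padic_OM _ _ L) rhoP (padic_M_neq0 L).
Let PX := nonarch_phase1X (padic_O1 L) (@padic_OB _ _ L) (@padic_OM _ _ L) rhoP (padic_M_neq0 L).
Let P0 := @nonarch_phase1_neq0 L O rho.

Lemma padic_natr_inj : injective (fun n => n%:R : Zp).
Proof.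
move=> m n /(congr1 (fun x : Zp => x (m + n)%N)); rewrite !pdig_nat.
have p1 := prime_gt1 p_pr.
by rewrite !modn_small //; apply: leq_ltn_trans (ltn_expl _ p1);
  rewrite ?leq_addr ?leq_addl.
Qed.

Lemma padic_natr_dense (x : Zp) n : exists m : nat, dvdpi p%:R n (m%:R - x).
Proof.
exists (x n); apply/padic_dvd_subP; rewrite pdig_nat; exact: pdig_mod.
Qed.

Lemma padic_sparse_roots N k : (0 < N)%N ->
  exists f s rs, sparse_roots (A := Zp) p N k f s rs.
Proof.
move=> N0; apply: (@sparse_roots_exists Zp p _ _ _ _ _ _ N N0 k).
- exact: prime_gt0.
- exact: padic_henselian.
- exact: padic_p_nonunit.
- exact: padic_natr_inj.
- exact: padic_natr_dense.
- exact: padic_valuation.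
Qed.

Lemma padic_attains_univariate k : attains P 1 k.+1 (2 * k + 1).
Proof.
have [N N0 PN] := padic_phase1_pow rhoP.
have [f [s [rs [[sf ss _ urs srs] rsP]]]] := padic_sparse_roots k N0.
rewrite -srs -(size_map iota).
apply: (attains_poly P0 (sparse_map (@padic_iota_inj _ _ L) sf)) => //.
  by rewrite map_inj_uniq //; exact: padic_iota_inj.
move=> _ /mapP [r /rsP [fr f'r [j [z rE]]] ->]; split.
- by rewrite /root horner_map (rootP fr) rmorph0.
- rewrite deriv_map horner_map -(rmorph0 iota).
  by apply: contra_neq f'r => /padic_iota_inj.
rewrite rE rmorphM !rmorphXn rmorph_nat; apply: PM; first exact/PX.
by rewrite exprS -mulrA; exact: padic_phase1_1D.
Qed.

End PadicUnivariate.

(** * Univariate bounds over extensions of Q_2 *)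

Section DyadicUnivariate.
Variables (p_pr : prime 2) (L : fieldExtType (padic_num p_pr)) (rho : L).
Local Notation Zp := (padic_int p_pr).
Local Notation O := (@padic_integers 2 p_pr L).
Local Notation iota := (@padic_iota 2 p_pr L).
Hypothesis rhoP : uniformizer O rho.
Local Notation P := (nonarch_phase1 O rho).

Let PM := nonarch_phase1M (padic_O1 L) (@padic_OB _ _ L) (@padic_OM _ _ L) rhoP (padic_M_neq0 L).
Let PX := nonarch_phase1X (padic_O1 L) (@padic_OB _ _ L) (@padic_OM _ _ L) rhoP (padic_M_neq0 L).
Let P0 := @nonarch_phase1_neq0 L O rho.

Let two0 : 2%:R != 0 :> L.
Proof.
rewrite -(rmorph_nat iota) -(rmorph0 iota).
by apply: contra_neq (padic_p_neq0 p_pr) => /padic_iota_inj.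
Qed.

(** [-1 = 1 + 2 * (-1)] has phase 1. *)
Let P_N x : P x -> P (- x).
Proof.
move=> Px; rewrite -mulN1r; apply: PM => //.
have := padic_phase1_1D rhoP (-1); rewrite rmorphD rmorph1 rmorphM rmorph_nat.
by rewrite rmorphN1 mulrN1 -opprB addrK.
Qed.

Lemma dyadic_attains_binomial : attains P 1 1 2.
Proof.
apply: (@attains_square L P ('X - 1%:P) [:: 0%N; 1%N] 1 [:: 1]) => //; first 1 last.
- by move=> x y; rewrite !inE => /eqP -> /eqP ->.
- have P_1 : P 1 by exact: (PX 0 (padic_phase1_1D rhoP 0)).
  move=> q; rewrite inE => /eqP ->; split=> //; last exact: P_N.
    by rewrite expr1n root_XsubC.
  by rewrite derivXsubC hornerC oner_eq0.
- split=> // i; rewrite coefB coefX coefC !inE.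
  by case: i => [|[|i]] /=; rewrite ?sub0r ?oppr_eq0 ?subr0 ?oner_eq0 ?eqxx.
Qed.

(** Hensel's lemma at 1 for [X ^ 2 - (1 + 8 z)]: the derivative is 2, and [8 = 2 ^ 2 * 2] is the
    precision required. *)
Lemma dyadic_sqrt (z : Zp) : exists y, (1 + 2%:R * y) ^+ 2 = 1 + 2%:R ^+ 3 * z.
Proof.
pose f : {poly Zp} := 'X^2 - (1 + 2%:R ^+ 3 * z)%:P.
have f'E : f^`().[1] = 2%:R.
  by rewrite derivB derivC subr0 derivXn hornerMn hornerXn expr1n.
have [|y [_ [fr _]]] := @hensel _ _ (@padic_henselian 2 p_pr) f 1 (- z).
  by rewrite f'E !hornerE /= expr1n; ring.
exists (2%:R * y); move: fr; rewrite f'E /root !hornerE /= subr_eq0 => /eqP <-.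
by [].
Qed.

(** The three roots of a sparse trinomial are [good], hence squares of elements of phase 1, and
    substituting [x ^ 2] gives six. *)
Lemma dyadic_attains_trinomial : attains P 1 2 6.
Proof.
have [N N0 PN] := padic_phase1_pow rhoP.
have [f [s [rs [[sf ss _ urs srs] rsP]]]] := padic_sparse_roots p_pr 1 N0.
have /choice [h hP] : forall r, exists q, r \in rs -> q ^+ 2 = r /\ P (iota q).
  move=> r; case: (boolP (r \in rs)) => [rrs|]; last by exists 0.
  have [_ _ [j [z ->]]] := rsP _ rrs; have [y yE] := dyadic_sqrt z.
  exists (2%:R ^+ N ^+ j * (1 + 2%:R * y)) => _; split.
    by rewrite exprMn yE -!exprM [(2 * j)%N]mulnC mulnA.
  rewrite rmorphM !rmorphXn rmorph_nat; apply: PM; first exact/PX.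
  exact: padic_phase1_1D.
have -> : 6%N = (2 * size [seq iota (h r) | r <- rs])%N by rewrite size_map srs.
apply: (attains_square P0 two0 (sparse_map (@padic_iota_inj _ _ L) sf)) => //.
- rewrite map_inj_in_uniq // => r r' /hP [hr _] /hP [hr' _] /padic_iota_inj E.
  by rewrite -hr E.
- move=> _ _ /mapP [r rrs ->] /mapP [r' r'rs ->] /=; rewrite -!rmorphXn.
  have [hr _] := hP _ rrs; have [hr' _] := hP _ r'rs.
  by rewrite hr hr' => /padic_iota_inj ->.
move=> _ /mapP [r rrs ->]; have [hr Phr] := hP _ rrs.
have [fr f'r _] := rsP _ rrs; rewrite -rmorphXn hr; split=> //; last exact: P_N.
- by rewrite /root horner_map (rootP fr) rmorph0.
- rewrite deriv_map horner_map -(rmorph0 iota).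
  by apply: contra_neq f'r => /padic_iota_inj.
Qed.

Lemma dyadic_attains_univariate k : attains P 1 k (2 * k).
Proof.
have [N N0 PN] := padic_phase1_pow rhoP.
(* The base [4 ^ N] is a square, so its powers have the square roots [2 ^ (N t)], of phase 1. *)
have e_inj : injective (fun n => (2%:R ^+ N ^+ 2 : L) ^+ n).
  move=> m n; rewrite -!exprM -!natrX -!(rmorph_nat iota) => /padic_iota_inj.
  move=> /padic_natr_inj /eqP; rewrite eqn_exp2l // !eqn_pmul2l //.
  by move/eqP.
have e0 : (2%:R ^+ N ^+ 2 : L) != 0 by rewrite !expf_neq0.
have [f [ts [fs uts sts tsP]]] := full_support_poly k e0 e_inj.
rewrite -{2}sts -(size_map (fun t => 2%:R ^+ N ^+ t : L)).
have tE t : (2%:R ^+ N ^+ t : L) ^+ 2 = 2%:R ^+ N ^+ 2 ^+ t by exact: exprAC.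
apply: (attains_square P0 two0 fs).
- by rewrite size_iota.
- rewrite map_inj_uniq // => m n E; apply: e_inj.
  by rewrite -!tE /= E.
- by move=> _ _ /mapP [t _ ->] /mapP [t' _ ->] /=; rewrite !tE => /e_inj ->.
move=> _ /mapP [t /tsP [ft f't] ->]; rewrite tE; split=> //; first exact/PX.
by apply: P_N; exact/PX.
Qed.

End DyadicUnivariate.

(** * Additive polynomials *)

Section Linearized.
Variables (F : finFieldType) (K : fieldType) (phi : {rmorphism F -> K}).
Variables (P : set K) (e : K).
Local Notation q := #|F|.
Hypothesis P0 : forall y, P y -> y != 0.
Hypotheses (e_inj : injective (fun n => e ^+ n)) (Pe : forall n, P (e ^+ n)).
Hypotheses (Pnear : forall v, P v ->
  exists N0, forall N c, (N0 <= N)%N -> P (v + phi c * e ^+ N)).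

Lemma q_gt1 : (1 < q)%N. Proof. exact: finNzRing_gt1. Qed.

Lemma card_pchar : exists p n, p \in [pchar K] /\ q = (p ^ n.+1)%N.
Proof.
have [p p_pr pF] := finPcharP F.
exists p, (logn p q).-1; split; first exact: (rmorph_pchar phi pF).
have qE : q = (p ^ logn p q)%N by exact: card_pprimeChar pF.
rewrite prednK // lt0n; apply: contraTneq q_gt1 => l0.
by rewrite qE l0.
Qed.

Lemma frobD (x y : K) : (x + y) ^+ q = x ^+ q + y ^+ q.
Proof.
have [p [n [pK ->]]] := card_pchar; rewrite exprDn_pchar //.
rewrite pnatX; apply/orP; left.
by rewrite pnatE ?(pcharf_prime pK).
Qed.

Lemma q_eq0 : q%:R = 0 :> K.
Proof.
have [p [n [pK ->]]] := card_pchar; apply/eqP; rewrite -(dvdn_pcharf pK).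
by rewrite expnS dvdn_mulr.
Qed.

Lemma frob_sum n (g : 'I_n -> K) : (\sum_i g i) ^+ q = \sum_i g i ^+ q.
Proof.
elim/big_rec2: _ => [|i x y _ <-]; last exact: frobD.
by rewrite expr0n gtn_eqF // (ltnW q_gt1).
Qed.

Lemma frobXD n (x y : K) : (x + y) ^+ (q ^ n) = x ^+ (q ^ n) + y ^+ (q ^ n).
Proof.
elim: n x y => [|n IH] x y; first by rewrite !expr1.
by rewrite expnS !exprM frobD IH.
Qed.

Definition lin k (a : nat -> K) (x : K) := \sum_(i < k.+1) a i * x ^+ (q ^ i).

Lemma linD k a x y : lin k a (x + y) = lin k a x + lin k a y.
Proof. by rewrite -big_split; apply: eq_bigr => i _; rewrite frobXD mulrDr. Qed.

Lemma linZ k a c x : lin k a (phi c * x) = phi c * lin k a x.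
Proof.
rewrite mulr_sumr; apply: eq_bigr => i _; rewrite exprMn mulrCA; congr (_ * _).
rewrite -rmorphXn; congr (phi _); elim: (nat_of_ord i) => [|n IH]; first by rewrite expr1.
by rewrite expnS exprM expf_card.
Qed.

(* For C = lin k a w ^+ (q - 1), the right-hand side vanishes on the F-span of w
   and of the zeros of lin k a. *)
Lemma lin_step k a x C : (forall i, (k < i)%N -> a i = 0) ->
  lin k.+1 (fun i => (if i is j.+1 then a j ^+ q else 0) - C * a i) x
    = lin k a x ^+ q - C * lin k a x.
Proof.
move=> ak; rewrite /lin frob_sum mulr_sumr.
under eq_bigr => i _ do rewrite mulrBl.
rewrite sumrB; congr (_ - _).
  rewrite big_ord_recl mul0r add0r; apply: eq_bigr => i _ /=.
  by rewrite exprMn -exprM expnSr.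
rewrite big_ord_recr /= ak // mulr0 mul0r addr0.
by apply: eq_bigr => i _; rewrite mulrA.
Qed.

(** This is [lin k a x] divided by [x], which discards the root 0 and keeps the number of terms. *)
Definition lin_poly k (a : nat -> K) : {poly K} :=
  \sum_(i < k.+1) a i *: 'X^(q ^ i - 1).

Lemma q_exp_gt0 i : (0 < q ^ i)%N. Proof. by rewrite expn_gt0 (ltnW q_gt1). Qed.

Lemma lin_polyE k a x : x * (lin_poly k a).[x] = lin k a x.
Proof.
rewrite /lin_poly horner_sum mulr_sumr; apply: eq_bigr => i _.
by rewrite hornerZ hornerXn mulrCA -exprS subn1 prednK // q_exp_gt0.
Qed.

(** The left side is the derivative of [x * lin_poly], constant because [q = 0] in [K]; for [a 0]
    nonzero all roots are therefore simple. *)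
Lemma lin_poly_deriv k a x : (lin_poly k a).[x] + x * (lin_poly k a)^`().[x] = a 0%N.
Proof.
transitivity ('X * lin_poly k a)^`().[x].
  by rewrite derivM derivX mul1r hornerD hornerM hornerX.
rewrite /lin_poly mulr_sumr linear_sum horner_sum big_ord_recl big1 => [|i _].
  by rewrite /= expn0 subnn expr0 alg_polyC mulrC mul_polyC derivZ derivX alg_polyC hornerC addr0.
rewrite /= -scalerAr -exprS derivZ derivXn hornerZ hornerMn.
rewrite (_ : (q ^ (bump 0 i) - 1).+1 = q * q ^ i)%N; last first.
  by rewrite subn1 prednK ?q_exp_gt0 // -expnS.
by rewrite -mulr_natr natrM q_eq0 mul0r !mulr0.
Qed.

Lemma sparse_lin_poly k a : (forall i, (i <= k)%N -> a i != 0) ->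
  sparse (lin_poly k a) [seq (q ^ i - 1)%N | i <- iota 0 k.+1].
Proof.
move=> ak.
have q_inj : injective (fun i => (q ^ i - 1)%N).
  move=> i j /= /(congr1 S); rewrite !subn1 !prednK ?q_exp_gt0 // => /eqP.
  by rewrite eqn_exp2l ?q_gt1 // => /eqP.
split; first by rewrite map_inj_uniq ?iota_uniq.
move=> m; rewrite /lin_poly coef_sum.
under eq_bigr => i _ do rewrite coefZ coefXn.
apply/idP/mapP => [|[i0]].
  apply: contraNP => N; apply/eqP; rewrite big1 // => i _.
  case: eqP => [E|]; last by rewrite mulr0.
  by case: N; exists (nat_of_ord i) => //; rewrite mem_iota /= add0n.
rewrite mem_iota add0n /= => ik ->.
rewrite (bigD1 (Ordinal ik)) //= eqxx mulr1 big1 ?addr0 ?ak // => j.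
rewrite -val_eqE /= => ji; case: eqP => [/q_inj E|]; last by rewrite mulr0.
by rewrite E eqxx in ji.
Qed.

(** The number of lines in an [F]-space of dimension [k]. *)
Fixpoint nroots k := if k is k'.+1 then (q * nroots k' + 1)%N else 0%N.

Lemma nrootsE k : nroots k = ((q ^ k - 1) %/ (q - 1))%N.
Proof.
suff <- : (nroots k * (q - 1) = q ^ k - 1)%N by rewrite mulnK // subn_gt0 q_gt1.
elim: k => [|k IH]; first by rewrite mul0n.
rewrite /= mulnDl mul1n -mulnA IH mulnBr muln1 -expnS.
have : (q <= q ^ k.+1)%N by rewrite expnS leq_pmulr // q_exp_gt0.
by move=> le; rewrite addnBA ?(ltnW q_gt1) // subnK.
Qed.

(** A new vector [w] enlarges the zero space, whose lines are then represented by [w] and by all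
    [v + c w]. Taking [w] tiny compared with every [v] preserves phase 1. *)
Lemma lin_roots k : exists (a : nat -> K) (vs : seq K),
  [/\ forall i, (i <= k)%N -> a i != 0, forall i, (k < i)%N -> a i = 0,
      uniq vs, size vs = nroots k &
      {in vs, forall v, lin k a v = 0 /\ P v}].
Proof.
elim: k => [|k [a [vs [ak ak0 uvs svs vsP]]]].
  exists (fun i => (i == 0%N)%:R), [::]; split=> // i.
    by rewrite leqn0 => /eqP ->; exact: oner_neq0.
  by case: i.
have [N0 N0P] : exists N0, forall v N c, v \in vs -> (N0 <= N)%N ->
    P (v + phi c * e ^+ N).
  have : {in vs, forall v, P v} by move=> v /vsP [].
  elim: (vs) => [|v l IH] lP; first by exists 0%N.
  have [N1 N1P] : exists N0, forall v N c, v \in l -> (N0 <= N)%N ->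
      P (v + phi c * e ^+ N).
    by apply: IH => u ul; apply: lP; rewrite inE ul orbT.
  have [N2 N2P] := Pnear (lP _ (mem_head _ _)).
  exists (N1 + N2)%N => u N c; rewrite inE => /orP [/eqP ->|ul] NN.
    by apply: N2P; rewrite (leq_trans _ NN) // leq_addl.
  by apply: N1P => //; rewrite (leq_trans _ NN) // leq_addr.
pose La : {poly K} := 'X * lin_poly k a.
have LaE x : La.[x] = lin k a x by rewrite hornerM hornerX lin_polyE.
have q1 : (q - 1 = (q - 2).+1)%N by rewrite -subSn ?q_gt1.
(* The new coefficients of index 1 to [k] are [a_i ^ q - a_(i+1) C]. A nonroot of [Q] keeps them
   nonzero and lies outside the old zero space. *)
pose Q := La * \prod_(i < k) ((a i ^+ q)%:P - a i.+1 *: La ^+ (q - 1)).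
have Q0 : Q != 0.
  rewrite !mulf_neq0 ?polyX_eq0 //.
    apply: contraTneq (ak 0%N isT) => l0; rewrite negbK -(lin_poly_deriv k a 0).
    by rewrite l0 deriv0 !horner0 mulr0 addr0.
  apply/prodf_neq0 => i _; apply/eqP => /(congr1 (fun f => f.[0])) /eqP.
  rewrite hornerD hornerN hornerC hornerZ horner_exp hornerM hornerX mul0r horner0.
  rewrite q1 expr0n mulr0 subr0 expf_eq0 (negbTE (ak _ _)) ?andbF //.
  by rewrite ltnW.
have [N NN0] := pow_nonroot N0 e_inj Q0.
set w := e ^+ N; rewrite hornerM mulf_eq0 negb_or LaE horner_prod.
move=> /andP [Lw /prodf_neq0 QN].
pose C := lin k a w ^+ (q - 1).
have C0 : C != 0 by rewrite expf_neq0.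
pose a' i := (if i is j.+1 then a j ^+ q else 0) - C * a i.
exists a', (w :: [seq v + phi c * w | v <- vs, c <- enum F]); split.
- case=> [_|i]; first by rewrite /a' sub0r oppr_eq0 mulf_neq0 ?ak.
  rewrite ltnS leq_eqVlt => /orP [/eqP ->|ik].
    by rewrite /a' (ak0 k.+1) // mulr0 subr0 expf_neq0 ?ak.
  have := QN (Ordinal ik) isT.
  by rewrite hornerD hornerN hornerC hornerZ horner_exp LaE mulrC.
- case=> // i; rewrite ltnS => ki; rewrite /a' (ak0 i) // (ak0 i.+1) ?ltnS ?(ltnW ki) //.
  by rewrite expr0n mulr0 subr0 gtn_eqF // (ltnW q_gt1).
- rewrite cons_uniq; apply/andP; split.
    apply/allpairsP => -[[v c] /= [vvs _ E]]; have [Lv Pv] := vsP _ vvs.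
    have : (1 - phi c) * lin k a w = 0.
      rewrite -(rmorph1 phi) -rmorphB -linZ rmorphB rmorph1 mulrBl mul1r {1}E addrK.
      exact: Lv.
    move/eqP; rewrite mulf_eq0 (negbTE Lw) orbF subr_eq0 => /eqP c1.
    have v0 : v = 0.
      move/eqP: E; rewrite -c1 mul1r -subr_eq0 opprD addrCA subrr addr0 oppr_eq0.
      by move/eqP.
    by have := P0 Pv; rewrite v0 eqxx.
  rewrite allpairs_uniq ?enum_uniq // => -[v c] [v' c'] /allpairsP [[? ?] /= [vvs _ [-> ->]]].
  move=> /allpairsP [[? ?] /= [v'vs _ [-> ->]]] /= E.
  have [Lv _] := vsP _ vvs; have [Lv' _] := vsP _ v'vs.
  move/(congr1 (lin k a)): (E); rewrite !linD !linZ Lv Lv' !add0r.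
  move=> /(mulIf Lw) /fmorph_inj cc; move: E; rewrite cc => /addIr ->.
  by [].
- by rewrite /= size_allpairs -cardE svs mulnC addn1.
move=> x; rewrite inE lin_step //.
have Lx' (y : K) : y ^+ q = y ^+ (q - 1) * y by rewrite -exprSr subn1 prednK // ltnW // q_gt1.
case/orP => [/eqP ->|/allpairsP [[v c] /= [vvs _ ->]]].
  by split; [rewrite Lx' subrr | exact: Pe].
have [Lv Pv] := vsP _ vvs; split; last exact: N0P.
rewrite linD linZ Lv add0r exprMn -rmorphXn expf_card Lx' -/C.
by rewrite mulrCA subrr.
Qed.

Lemma attains_linearized k : attains P 1 k ((q ^ k - 1) %/ (q - 1)).
Proof.
have [a [vs [ak ak0 uvs svs vsP]]] := lin_roots k.
rewrite -nrootsE -svs; apply: (attains_poly P0 (sparse_lin_poly ak)) => //.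
  by rewrite size_map size_iota.
move=> v /vsP [Lv Pv]; have v0 := P0 Pv.
have fv : (lin_poly k a).[v] = 0.
  by apply: (mulfI v0); rewrite lin_polyE Lv mulr0.
split=> //; first exact/rootP.
have := lin_poly_deriv k a v; rewrite fv add0r => E.
by apply: contraTneq (ak 0%N isT) => f'v; rewrite -E f'v mulr0 eqxx.
Qed.

End Linearized.

Section LaurentUnivariate.
Variables (F : finFieldType).
Local Notation PS := (power_series F).
Local Notation L := (laurent_series F).
Local Notation O := (@laurent_integers F).
Variable rho : L.
Hypothesis rhoP : uniformizer O rho.
Local Notation P := (nonarch_phase1 O rho).

Definition ps_const (c : F) : PS := PowerSeries (fun n => if n == 0%N then c else 0).

Lemma ps_constM : {morph ps_const : x y / x * y}.
Proof.
move=> c d; apply: power_series_eq => n.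
rewrite -[RHS]/(\sum_(i < n.+1) (if i == 0%N :> nat then c else 0)
  * (if (n - i == 0)%N then d else 0)).
rewrite big_ord_recl /= subn0 big1 ?addr0 => [|i _]; last by rewrite mul0r.
by case: (n == 0%N); rewrite ?mulr0.
Qed.

Lemma ps_constB : {morph ps_const : x y / x - y}.
Proof.
move=> c d; apply: power_series_eq => n.
rewrite -[RHS]/((if n == 0%N then c else 0) - (if n == 0%N then d else 0)) /=.
by case: (n == 0%N); rewrite ?subr0.
Qed.

Lemma ps_const1 : ps_const 1 = 1.
Proof. by apply: power_series_eq => n /=; case: (n == 0%N). Qed.

HB.instance Definition _ := GRing.isZmodMorphism.Build F PS ps_const ps_constB.
HB.instance Definition _ :=
  GRing.isMonoidMorphism.Build F PS ps_const (ps_const1, ps_constM).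

Let O1 := @laurent_O1 F.
Let OB := @laurent_OB F.
Let OM := @laurent_OM F.
Let M0 := @laurent_M_neq0 F.

Lemma laurent_attains_univariate k : attains P 1 k ((#|F| ^ k - 1) %/ (#|F| - 1)).
Proof.
have rho0 := rho_neq0 rhoP M0.
apply: (@attains_linearized F L (@laurent_iota F \o ps_const) P rho).
- exact: nonarch_phase1_neq0.
- move=> m n /= E; have : rho ^ (m%:Z - n%:Z) = 1.
    by rewrite expfzDr // -invr_expz -!exprnP E divff // expf_neq0.
  move=> E1; have : int_unit O (rho ^ (m%:Z - n%:Z)).
    by rewrite E1; split; rewrite ?oner_eq0 ?invr1.
  by move/(int_unit_rho O1 OM rhoP M0)/eqP; rewrite subr_eq0 => /eqP [].
- by move=> n; exact: (nonarch_phase1_rho O1 OB OM rhoP M0 n).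
move=> v /(nonarch_phase1P O1 OB OM rhoP M0) [m [a [Oa vE]]].
(* [N > m] suffices: adding [c rho ^ N] to [rho ^ m (1 + rho a)] only changes [a]. *)
exists (absz m).+1 => N c Nm; apply/(nonarch_phase1P O1 OB OM rhoP M0).
have [d dE] : exists d : nat, N%:Z = m + d.+1%:Z.
  by exists (absz (N%:Z - m)).-1; lia.
exists m, (a + laurent_iota (ps_const c) * rho ^+ d); split.
  apply: (O_D O1 OB) => //; apply: OM; first exact: laurent_O_iota.
  by apply: (O_X O1 OM); exact: (O_rho O1 rhoP).
rewrite vE (exprnP rho N) dE expfzDr //= -exprnP exprS; ring.
Qed.

End LaurentUnivariate.

(** * The real case *)

Lemma poly_pos_near0 (R : realFieldType) (c : R) (s : {poly R}) : 0 < c ->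
  exists2 d, 0 < d & forall e, 0 < e < d -> 0 < c + e * s.[e].
Proof.
move=> c0; have [B BP] := poly_itv_bound s 0 1.
have B0 : 0 <= B by apply: le_trans (BP 0 _); rewrite ?normr_ge0 ?lexx ?ler01.
have B1 : 0 < B + 1 by rewrite ltr_wpDl.
exists (Num.min 1 (c / (B + 1))); first by rewrite lt_min ltr01 divr_gt0.
move=> e /andP [e0]; rewrite lt_min => /andP [e1 ec].
have sB : `|s.[e]| <= B by apply: BP; rewrite !ltW.
have : `|e * s.[e]| < c.
  rewrite normrM (gtr0_norm e0); rewrite ltr_pdivlMr // in ec.
  apply: le_lt_trans ec; rewrite ler_pM2l // (le_trans sB) // lerDl ler01 //.
by rewrite ltr_norml => /andP [H _]; rewrite addrC -ltrBlDr sub0r.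
Qed.

Section RealChain.
Variables (R : realType) (n : nat).

(** The congruence is used in [R[X]] with [X] in place of [e], so the error is [e] times a
    polynomial in [e], bounded near 0. *)
Lemma chain_poly_near0 j (w : R) : (j <= n)%N ->
  exists s : {poly R}, forall e,
    chain_poly n j e w = (-1) ^+ j * (w ^+ j * (1 - w)) + e * s.[e].
Proof.
move=> jn; have [s sE] := @chain_poly_mod {poly R} n j 'X w%:P jn.
exists s => e; move/(congr1 (horner_eval e)): sE.
rewrite rmorph_chain_poly rmorphD !rmorphM rmorph_sign rmorphXn rmorphB rmorph1 /=.
by rewrite /horner_eval hornerX hornerC.
Qed.

(** For small [e] the sign at [1/2] and at [2] is that of [(-1) ^ j w ^ j (1 - w)], which changes in
    between. *)
Lemma chain_root_near0 j : (j <= n)%N ->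
  exists2 d : R, 0 < d & forall e, 0 < e < d ->
    exists2 w, 2^-1 <= w <= 2%:R & chain_poly n j e w = 0.
Proof.
move=> jn; have h0 : 0 < 2^-1 :> R by rewrite invr_gt0 ltr0n.
have [s1 s1E] := chain_poly_near0 2^-1 jn; have [s2 s2E] := chain_poly_near0 2 jn.
have c1 : 0 < 2^-1 ^+ j * (1 - 2^-1) :> R.
  by rewrite mulr_gt0 ?exprn_gt0 // subr_gt0 invf_lt1 ?ltr0n // ltr1n.
have c2 : 0 < 2 ^+ j :> R by rewrite exprn_gt0 // ltr0n.
have [d1 d10 d1P] := poly_pos_near0 ((-1) ^+ j *: s1) c1.
have [d2 d20 d2P] := poly_pos_near0 (- ((-1) ^+ j *: s2)) c2.
exists (Num.min d1 d2); first by rewrite lt_min d10.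
move=> e /andP [e0]; rewrite lt_min => /andP [ed1 ed2].
have sg : (-1) ^+ j * (-1) ^+ j = 1 :> R by rewrite -expr2 sqrr_sign.
pose p := - ((-1) ^+ j *: chain_poly n j e%:P 'X) : {poly R}.
have pE w : p.[w] = - ((-1) ^+ j * chain_poly n j e w).
  by rewrite hornerN hornerZ horner_chain_poly.
have p1 : p.[2^-1] <= 0.
  rewrite pE oppr_le0 s1E mulrDr mulrA sg mul1r mulrCA -hornerZ.
  by apply/ltW/d1P; rewrite e0.
have p2 : 0 <= p.[2].
  rewrite pE s2E mulrDr mulrA sg mul1r mulrCA -hornerZ opprD -mulrN.
  rewrite -mulrN -hornerN (_ : - (1 - 2) = 1 :> R) ?mulr1; last by ring.
  by apply/ltW/d2P; rewrite e0.
have le12 : 2^-1 <= 2 :> R by rewrite (@le_trans _ _ 1) ?invf_le1 ?ltr0n ?ler1n.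
have [w wP /rootP pw] : exists2 w, 2^-1 <= w <= 2 & root p w.
  by apply: poly_ivt => //; rewrite p1.
exists w => //; move/eqP: pw; rewrite pE oppr_eq0 mulf_eq0 signr_eq0 /=.
by move/eqP.
Qed.

Lemma chain_roots_near0 m : (m <= n.+1)%N ->
  exists2 d : R, 0 < d & forall e, 0 < e < d -> forall j, (j < m)%N ->
    exists2 w, 2^-1 <= w <= 2%:R & chain_poly n j e w = 0.
Proof.
elim: m => [|m IH] mn; first by exists 1 => // e _ j.
have [d1 d10 d1P] := IH (ltnW mn); have [d2 d20 d2P] := chain_root_near0 mn.
exists (Num.min d1 d2); first by rewrite lt_min d10.
move=> e /andP [e0]; rewrite lt_min => /andP [ed1 ed2] j.
rewrite ltnS leq_eqVlt => /orP [/eqP ->|]; first by apply: d2P; rewrite e0.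
by apply: d1P; rewrite e0.
Qed.

Lemma real_attains_chain (K : fieldType) (phi : {rmorphism R -> K}) (P : set K) :
  (0 < n)%N -> (forall y, P y -> y != 0) ->
  (forall x y, P x -> P y -> P (x * y)) -> (forall x, 0 < x -> P (phi x)) ->
  attains P n 2 n.+1.
Proof.
move=> n0 P0 PM Pphi; have [d d0 dP] := chain_roots_near0 (leqnn n.+1).
have eighth0 : 0 < 8%:R^-1 :> R by rewrite invr_gt0 ltr0n.
(* [e <= 1/8] separates the roots: [w_j = e ^ (j - i) w_i] would give [w_j <= 2/8 < 1/2]. *)
pose e := Num.min (d / 2) 8%:R^-1.
have e0 : 0 < e by rewrite lt_min divr_gt0 ?ltr0n.
have ed : e < d by rewrite gt_min ltr_pdivrMr ?ltr0n // ltr_pMr // ltr1n.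
have e8 : e <= 8%:R^-1 by rewrite ge_min lexx orbT.
have /choice [ws wsP] : forall j, exists w, (j < n.+1)%N ->
    2^-1 <= w <= 2%:R /\ chain_poly n j e w = 0.
  move=> j; case: (ltnP j n.+1) => [jn|]; last by exists 0.
  have /dP /(_ _ jn) [w w1 w2] : 0 < e < d by rewrite e0.
  by exists w.
have h0 : 0 < 2^-1 :> R by rewrite invr_gt0 ltr0n.
have ws0 j : (j <= n)%N -> 0 < ws j.
  by move=> jn; have [/andP [w1 _] _] := wsP j jn; apply: lt_le_trans w1.
apply: (@chain_poly_attains K P n (phi e) n0 _ (fun j => phi (ws j))) => //.
- exact/P0/Pphi.
- by rewrite -(rmorph1 phi); exact: Pphi.
- by rewrite -fmorphV; apply: Pphi; rewrite invr_gt0.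
- by move=> j jn; rewrite -rmorph_chain_poly (wsP j jn).2 rmorph0.
- move=> i j jn; rewrite -rmorph_chain_form; apply: Pphi.
  have w0 := ws0 j jn; rewrite /chain_form; case: ifP => _.
    by rewrite addr_gt0 // exprn_gt0.
  by rewrite addr_gt0 ?mulr_gt0 ?exprn_gt0.
move=> i j /andP [ij jn]; rewrite -rmorphXn -rmorphM => /fmorph_inj E.
have [/andP [w1 _] _] := wsP j jn.
have [/andP [_ w2] _] := wsP i (leq_trans (ltnW ij) jn).
have e1 : e <= 1 by rewrite (le_trans e8) // invf_le1 ?ltr0n // ler1n.
have : ws j <= 8%:R^-1 * 2%:R.
  have wi0 := ws0 i (leq_trans (ltnW ij) jn).
  rewrite E ler_pM ?exprn_ge0 ?(ltW wi0) ?(ltW e0) //.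
  rewrite -(subnSK ij) exprS (le_trans _ e8) // ler_piMr ?(ltW e0) //.
  by rewrite exprn_ile1 // ltW.
rewrite leNgt; case/negP; apply: lt_le_trans w1.
by rewrite mulrC ltr_pdivrMr ?ltr0n // mulrC ltr_pdivlMr ?ltr0n // -natrM ltr_nat.
Qed.

End RealChain.

(** In [R[i]] the order is partial and [0 < y] forces [y] to be real, so one description serves both
    Archimedean fields. *)
Lemma arch_phase1P (K : numFieldType) (y : K) : arch_phase1 y <-> 0 < y.
Proof.
split=> [[y0 /eqP]|y0].
  rewrite -(inj_eq (mulIf (_ : `|y| != 0))) ?normr_eq0 // mul1r divfK ?normr_eq0 //.
  by move/eqP => ->; rewrite normr_gt0.
by split; rewrite ?gt_eqF // gtr0_norm // divff // gt_eqF.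
Qed.

Lemma real_attains_univariate (R : realType) k : attains (@arch_phase1 R) 1 k k.
Proof.
have two0 : 2%:R != 0 :> R by rewrite pnatr_eq0.
have e_inj : injective (fun n => (2%:R : R) ^+ n).
  by move=> m n; rewrite -!natrX => /eqP; rewrite eqr_nat eqn_exp2l // => /eqP.
have [f [ts [fs uts sts tsP]]] := full_support_poly k two0 e_inj.
rewrite -{2}sts -(size_map (fun t => (2%:R : R) ^+ t)).
apply: (attains_poly _ fs) => //.
- by move=> y [].
- by rewrite size_iota.
- by rewrite map_inj_uniq.
move=> _ /mapP [t /tsP [ft f't] ->]; split=> //.
by apply/arch_phase1P; rewrite exprn_gt0 // ltr0n.
Qed.

(** * The lower bounds *)

Section LowerBounds.
Variables (R : realType) (L : local_field R).
Local Open Scope ereal_scope.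

Lemma lee_expe (x y : \bar R) n : 0 <= x -> x <= y -> x ^+ n <= y ^+ n.
Proof.
move=> x0 xy; elim: n => [|n IH]; first by rewrite !expe0.
by rewrite !expeS; apply: lee_pmul => //; exact: expe_ge0.
Qed.

Lemma natr_powM_le (a b m1 m2 : nat) (x y z : \bar R) :
  a%:R%:E <= x -> b%:R%:E <= y -> x ^+ m1 * y ^+ m2 <= z ->
  (a ^ m1 * b ^ m2)%N%:R%:E <= z.
Proof.
move=> ax by_; apply: le_trans; rewrite natrM !natrX EFinM !EFin_expe.
by apply: lee_pmul; rewrite ?expe_ge0 ?lee_fin //; apply: lee_expe; rewrite ?lee_fin.
Qed.

Lemma Y_chain n : (0 < n)%N -> (n + 1)%N%:R%:E <= Y L n 2.
Proof.
move=> n0; rewrite addn1; apply: attains_le_Y.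
case: L => [||p p_pr E rho rhoP|F rho rhoP].
- apply: (@real_attains_chain R n R idfun) => // [y []|x y|x x0] //.
    by move=> /arch_phase1P x0 /arch_phase1P y0; apply/arch_phase1P; rewrite mulr_gt0.
  exact/arch_phase1P.
- apply: (@real_attains_chain R n R[i] (real_complex R)) => // [y []|x y|x x0] //.
    by move=> /arch_phase1P x0 /arch_phase1P y0; apply/arch_phase1P; rewrite mulr_gt0.
  by apply/arch_phase1P; rewrite ltcR.
- exact: padic_attains_chain.
- exact: laurent_attains_chain.
Qed.

(** The binomial [X - 1]; it pads a bound to more variables without losing roots. *)
Lemma Y11_ge1 : 1 <= Y L 1 1.
Proof.
apply: (@attains_le_Y R L 1 1 1).
have P1 : phase1 (1%R : carrier L).
  case: L => [||p p_pr E rho rhoP|F rho rhoP].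
  - exact/arch_phase1P.
  - exact/arch_phase1P.
  - exact: (nonarch_phase1_rho (padic_O1 E) (@padic_OB _ _ E) (@padic_OM _ _ E)
      rhoP (padic_M_neq0 E) 0).
  - exact: (nonarch_phase1_rho (laurent_O1 F) (@laurent_OB F) (@laurent_OM F)
      rhoP (laurent_M_neq0 F) 0).
apply: (@attains_poly _ _ ('X - 1%:P)%R [:: 0%N; 1%N] 1 [:: 1%R]) => //.
- exact: phase1_neq0.
- split=> // i; rewrite coefB coefX coefC !inE.
  by case: i => [|[|i]] /=; rewrite ?sub0r ?oppr_eq0 ?subr0 ?oner_eq0 ?eqxx.
move=> r; rewrite inE => /eqP ->; split=> //; first by rewrite root_XsubC.
by rewrite derivXsubC hornerC oner_eq0.
Qed.

Lemma Y_large_n1 n K : (0 < K <= n)%N ->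
  Y L 1 1 ^+ (n - K) * Y L 1 2 ^+ K <= Y L n K.+1.
Proof.
move=> /andP [K0 Kn]; rewrite muleC.
have := @Y_powM R L 1 1 K 1 0 (n - K) isT isT K0.
by rewrite !mul1n mul0n addn0 subnKC.
Qed.

(** The [n] variables are split into [K] blocks of sizes as equal as possible. *)
Lemma Y_large_n2 n K : (0 < K <= n)%N ->
  Y L (n %/ K) 2 ^+ (K - n %% K) * Y L (n %/ K + 1) 2 ^+ (n %% K) <= Y L n K.+1.
Proof.
move=> /andP [K0 Kn].
have q0 : (0 < n %/ K)%N by rewrite divn_gt0.
have rK : (n %% K < K)%N by rewrite ltn_mod.
have := @Y_powM R L (n %/ K) 1 (K - n %% K) (n %/ K + 1) 1 (n %% K) q0.
rewrite addn1 subn_gt0 => /(_ isT rK); rewrite !mul1n subnK ?(ltnW rK) //.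
by rewrite mulSn addnCA -mulnDr subnK ?(ltnW rK) // addnC -divn_eq.
Qed.

(** Here it is [K] that is split as equally as possible, among [n] univariate blocks. *)
Lemma Y_small_n n K : (0 < n <= K)%N ->
  Y L 1 (K %/ n + 1) ^+ (n - K %% n) * Y L 1 (K %/ n + 2) ^+ (K %% n) <= Y L n K.+1.
Proof.
move=> /andP [n0 nK]; have rn : (K %% n < n)%N by rewrite ltn_mod.
have := @Y_powM R L 1 (K %/ n) (n - K %% n) 1 (K %/ n).+1 (K %% n) isT isT.
rewrite addn1 addn2 subn_gt0 => /(_ rn); rewrite !mul1n subnK ?(ltnW rn) //.
by rewrite mulSn addnCA -mulnDr subnK ?(ltnW rn) // addnC -divn_eq.
Qed.

End LowerBounds.

Local Open Scope ereal_scope.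

Theorem theorem1p5 (R : realType) :
  (forall L : local_field R,
     [/\ forall n : nat, (1 <= n)%N ->
           maxe (Y L 1 1 ^+ (n - 1) * Y L 1 2) (n + 1)%N%:R%:E <= Y L n 2,
         forall n k : nat, (1 <= k - 1 <= n)%N ->
           maxe (Y L 1 1 ^+ (n - (k - 1)) * Y L 1 2 ^+ (k - 1))
                (Y L (n %/ (k - 1)) 2 ^+ (k - 1 - n %% (k - 1))
                 * Y L (n %/ (k - 1) + 1) 2 ^+ (n %% (k - 1)))
           <= Y L n k &
         forall n k : nat, (1 <= n <= k - 1)%N ->
           Y L 1 ((n + k - 1) %/ n) ^+ (n - (k - 1) %% n)
           * Y L 1 ((n + k - 1) %/ n + 1) ^+ ((k - 1) %% n)
           <= Y L n k])
  /\
  (forall n k : nat,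
     ((1 <= k - 1 <= n)%N ->
        (((n + k - 1) %/ (k - 1)) ^ (k - 1 - n %% (k - 1))
         * ((n + 2 * k - 2) %/ (k - 1)) ^ (n %% (k - 1)))%N%:R%:E
        <= Y (RealField R) n k)
     /\
     ((1 <= n <= k - 1)%N ->
        (((n + k - 1) %/ n) ^ (n - (k - 1) %% n)
         * ((2 * n + k - 1) %/ n) ^ ((k - 1) %% n))%N%:R%:E
        <= Y (RealField R) n k))
  /\
  (forall (p_pr : prime 2) (rho : (padic_num p_pr)^o)
          (rhoP : uniformizer (@padic_integers 2 p_pr (padic_num p_pr)^o) rho)
          (n k : nat),
     ((1 <= k - 1 <= n)%N ->
        (2 ^ n * 3 ^ (k - 1))%N%:R%:E
        <= Y (PadicField R (padic_num p_pr)^o rhoP) n k)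
     /\
     ((1 <= n <= k - 1)%N ->
        (2 ^ n * ((n + k - 1) %/ n) ^ (n - (k - 1) %% n)
         * ((2 * n + k - 1) %/ n) ^ ((k - 1) %% n))%N%:R%:E
        <= Y (PadicField R (padic_num p_pr)^o rhoP) n k))
  /\
  (forall (p : nat) (p_pr : prime p) (rho : (padic_num p_pr)^o)
          (rhoP : uniformizer (@padic_integers p p_pr (padic_num p_pr)^o) rho)
          (n k : nat), (3 <= p)%N ->
     ((1 <= k - 1 <= n)%N ->
        (((n + k - 1) %/ (k - 1)) ^ (k - 1 - n %% (k - 1))
         * ((n + 2 * k - 2) %/ (k - 1)) ^ (n %% (k - 1)))%N%:R%:E
        <= Y (PadicField R (padic_num p_pr)^o rhoP) n k)
     /\
     ((1 <= n <= k - 1)%N ->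
        ((2 * ((n + k - 1) %/ n) - 1) ^ (n - (k - 1) %% n)
         * (2 * ((n + k - 1) %/ n) + 1) ^ ((k - 1) %% n))%N%:R%:E
        <= Y (PadicField R (padic_num p_pr)^o rhoP) n k))
  /\
  (forall (F : finFieldType) (rho : laurent_series F)
          (rhoP : uniformizer (@laurent_integers F) rho) (n k : nat),
     let q := #|F| in
     ((1 <= k - 1 <= n)%N ->
        (maxn (q + 1) ((n + k - 1) %/ (k - 1)) ^ (k - 1 - n %% (k - 1))
         * maxn (q + 1) ((n + 2 * k - 2) %/ (k - 1)) ^ (n %% (k - 1)))%N%:R%:E
        <= Y (LaurentField R F rhoP) n k)
     /\
     ((1 <= n <= k - 1)%N ->
        (((q ^ ((n + k - 1) %/ n) - 1) %/ (q - 1)) ^ (n - (k - 1) %% n)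
         * ((q ^ ((2 * n + k - 1) %/ n) - 1) %/ (q - 1)) ^ ((k - 1) %% n))%N%:R%:E
        <= Y (LaurentField R F rhoP) n k)).
Proof.
have large_n n k : (1 <= k - 1 <= n)%N ->
    [/\ (0 < k - 1 <= n)%N, (k - 1).+1 = k,
      ((n + k - 1) %/ (k - 1) = n %/ (k - 1) + 1)%N &
      ((n + 2 * k - 2) %/ (k - 1) = n %/ (k - 1) + 1 + 1)%N].
  case: k => [|[|k]] //; rewrite subn1 /= => kn; split=> //.
    by rewrite addnS subn1 /= addnC -{1}[k.+1]mul1n divnMDl // addnC.
  rewrite (_ : n + 2 * k.+2 - 2 = 2 * k.+1 + n)%N; last lia.
  by rewrite divnMDl //; lia.
have small_n n k : (1 <= n <= k - 1)%N ->
    [/\ (0 < n <= k - 1)%N, (k - 1).+1 = k,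
      ((n + k - 1) %/ n = (k - 1) %/ n + 1)%N &
      ((2 * n + k - 1) %/ n = (k - 1) %/ n + 2)%N].
  case: k => [|k]; first by case: n.
  rewrite subn1 /= => nk; have n0 : (0 < n)%N by case/andP: nk.
  split=> //; first by rewrite addnS subn1 /= -{1}[n]mul1n divnMDl // addnC.
  by rewrite addnS subn1 /= divnMDl // addnC.
split; [|split; [|split; [|split]]].
- move=> L; split.
  + move=> n n1; rewrite ge_max Y_chain // andbT.
    exact: (@Y_large_n1 R L n 1).
  + move=> n k /large_n [kn kE _ _]; rewrite ge_max.
    by have := Y_large_n1 L kn; have := Y_large_n2 L kn; rewrite kE => -> ->.
  + move=> n k /small_n [nk kE -> _]; rewrite -addnA.
    by have := Y_small_n L nk; rewrite kE.
- move=> n k; split=> [/large_n [kn kE -> ->]|/small_n [nk kE -> ->]].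
    have := Y_large_n2 (RealField R) kn; rewrite kE => H.
    apply: natr_powM_le H; apply: Y_chain.
      by case/andP: kn => k0 kn; rewrite divn_gt0.
    by rewrite addn1.
  have := Y_small_n (RealField R) nk; rewrite kE => H; apply: natr_powM_le H;
    exact/attains_le_Y/real_attains_univariate.
- move=> p_pr rho rhoP n k; split=> [/large_n [kn kE _ _]|/small_n [nk kE -> ->]].
    (* Each of the [k - 1] trinomials has 6 roots, and each of the remaining [n - (k - 1)] binomials
       has 2. *)
    have -> : (2 ^ n * 3 ^ (k - 1) = 2 ^ (n - (k - 1)) * 6 ^ (k - 1))%N.
      case/andP: kn => _ kn.
      by rewrite -[6%N]/(2 * 3)%N expnMn mulnA -expnD subnK.
    have := Y_large_n1 (PadicField R _ rhoP) kn; rewrite kE => H.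
    apply: natr_powM_le H; apply: attains_le_Y.
      exact: dyadic_attains_binomial.
    exact: dyadic_attains_trinomial.
  set d := (_ %/ n)%N; set r := (_ %% n)%N.
  have -> : (2 ^ n * (d + 1) ^ (n - r) * (d + 2) ^ r
      = (2 * (d + 1)) ^ (n - r) * (2 * (d + 2)) ^ r)%N.
    have rn : (r <= n)%N by rewrite ltnW // ltn_mod; case/andP: nk.
    by rewrite !expnMn -{1}(subnK rn) expnD; ring.
  have := Y_small_n (PadicField R _ rhoP) nk; rewrite kE => H; apply: natr_powM_le H;
    exact/attains_le_Y/dyadic_attains_univariate.
- move=> p p_pr rho rhoP n k p3; split=> [/large_n [kn kE -> ->]|/small_n [nk kE -> _]].
    have := Y_large_n2 (PadicField R _ rhoP) kn; rewrite kE => H.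
    apply: natr_powM_le H; apply: Y_chain.
      by case/andP: kn => k0 kn; rewrite divn_gt0.
    by rewrite addn1.
  have := Y_small_n (PadicField R _ rhoP) nk; rewrite kE => H.
  apply: natr_powM_le H; apply: attains_le_Y.
    have -> : (2 * ((k - 1) %/ n + 1) - 1 = 2 * ((k - 1) %/ n) + 1)%N by lia.
    by rewrite [in X in attains _ _ X]addn1; exact: padic_attains_univariate.
  by rewrite addn2 [(_ %/ n + 1)%N]addn1; exact: padic_attains_univariate.
- move=> F rho rhoP n k q; split=> [/large_n [kn kE -> ->]|/small_n [nk kE -> ->]].
    (* When [q + 1] is the larger value, a trinomial with [q + 1] roots is padded by [m - 1]
       univariate binomials. *)
    have bound m : (0 < m)%N ->
        ((maxn (q + 1) (m + 1))%N%:R%:E <= Y (LaurentField R F rhoP) m 2)%E.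
      move=> m0; rewrite /maxn; case: ifP => _; first exact: Y_chain.
      have q1 : (1 < q)%N by exact: finNzRing_gt1.
      have Y12 : ((q + 1)%N%:R%:E <= Y (LaurentField R F rhoP) 1 2)%E.
        apply: attains_le_Y; have := laurent_attains_univariate rhoP 2.
        rewrite (_ : (#|F| ^ 2 - 1) %/ (#|F| - 1) = q + 1)%N //.
        have -> : (q ^ 2 - 1 = (q + 1) * (q - 1))%N.
          by rewrite mulnC -subn_sqr exp1n.
        by rewrite mulnK // subn_gt0.
      have := @natr_powM_le R 1 (q + 1) (m - 1) 1 _ _ _ (Y11_ge1 _) Y12
        (Y_large_n1 _ (_ : 0 < 1 <= m)%N).
      by rewrite exp1n mul1n expn1; exact.
    have := Y_large_n2 (LaurentField R F rhoP) kn; rewrite kE => H.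
    apply: natr_powM_le H; apply: bound.
      by case/andP: kn => k0 kn; rewrite divn_gt0.
    by rewrite addn1.
  have := Y_small_n (LaurentField R F rhoP) nk; rewrite kE => H; apply: natr_powM_le H;
    exact/attains_le_Y/laurent_attains_univariate.
Qed.
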